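(* Let $0<\alpha<n$, $b\in BMO(\mathbb{R}^n)$ and let $\Phi,\Psi$ be Young functions such that $\Phi\in\Delta_2\cap\nabla_2$ and $\Psi\in\Delta_2\cap\nabla_2$. Then the condition $$r^{-\frac{\alpha}{n}}\,\Phi^{-1}(r)\le C\,\Psi^{-1}(r)\quad\text{for all } r>0,$$ where $C>0$ does not depend on $r$, is necessary and sufficient for the boundedness of $|b,I_\alpha|$ from $L^{\Phi}(\mathbb{R}^n)$ to $L^{\Psi}(\mathbb{R}^n)$.
   Context: A function $\Phi:[0,\infty)\to[0,\infty]$ is a Young function if it is convex, left-continuous, $\lim_{r\to+0}\Phi(r)=\Phi(0)=0$ and $\lim_{r\to\infty}\Phi(r)=\infty$. For $0\le s\le\infty$, $\Phi^{-1}(s)=\inf\{r\ge 0:\Phi(r)>s\}$. $\Phi\in\Delta_2$ means that there is $C>1$ with $\Phi(2r)\le C\Phi(r)$ for all $r>0$ (such a $\Phi$ satisfies $0<\Phi(r)<\infty$ for $0<r<\infty$). $\Phi\in\nabla_2$ means that there is $C>1$ with $\Phi(r)\le\frac{1}{2C}\Phi(Cr)$ for all $r\ge 0$. The Orlicz space $L^{\Phi}(\mathbb{R}^n)$ is the set of measurable $f$ with $\int_{\mathbb{R}^n}\Phi(k|f(x)|)\,dx<\infty$ for some $k>0$, with norm $\|f\|_{L^\Phi}=\inf\{\lambda>0:\int_{\mathbb{R}^n}\Phi(|f(x)|/\lambda)\,dx\le 1\}$. $BMO(\mathbb{R}^n)$ is the set of $b\in L^1_{\rm loc}(\mathbb{R}^n)$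 with $\|b\|_*=\sup_{x\in\mathbb{R}^n,r>0}\frac{1}{|B(x,r)|}\int_{B(x,r)}|b(y)-b_{B(x,r)}|\,dy<\infty$, where $B(x,r)$ is the ball of radius $r$ centered at $x$, $|B(x,r)|$ is its Lebesgue measure and $b_{B(x,r)}$ is the average of $b$ over $B(x,r)$. For a measurable function $b$, $|b,I_\alpha|f(x)=\int_{\mathbb{R}^n}\frac{|b(x)-b(y)|}{|x-y|^{n-\alpha}}f(y)\,dy$. Boundedness of an operator $T$ from $X$ to $Y$ means that there is a constant $C>0$ with $\|Tf\|_Y\le C\|f\|_X$ for all $f\in X$.
   Formalization: For a fixed b (e.g. b constant, Φ=Ψ=r²) necessity is false; the formal theorem says the condition holds if and only if |b,I_α| is bounded from L^Φ to L^Ψ for every b in BMO. Functions are Borel measurable representatives. *)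

(* Defs.v *)
From HB Require Import structures.
From mathcomp Require Import all_boot all_order all_algebra.
From mathcomp Require Import all_classical all_reals all_analysis.
From mathcomp Require Import measurable_realfun.

Set Implicit Arguments.
Unset Strict Implicit.
Unset Printing Implicit Defensive.

Import Order.TTheory GRing.Theory Num.Theory.
Import numFieldNormedType.Exports.

Local Open Scope classical_set_scope.
Local Open Scope ring_scope.
Local Open Scope ereal_scope.

(* R^n is [n.-tuple (measurableTypeR R)], which carries the product of the
   Borel sigma-algebras, i.e. the Borel sigma-algebra of R^n.  (The library has
   no measurable structure on ['rV[R]_n], and its norm there is the sup norm.)
   Every Lebesgue measurable function is a.e. equal to a Borel one. *)
Notation euclidean R n := (n.-tuple (measurableTypeR R)).

Section lebesgue_measure_tuple.
Context {R : realType}.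

Section step.
Variables (n : nat) (mu : {sigma_finite_measure set (euclidean R n) -> \bar R}).

Definition cons_pair (p : measurableTypeR R * euclidean R n) :
  euclidean R n.+1 := [the n.+1.-tuple _ of p.1 :: p.2].

Lemma measurable_cons_pair : measurable_fun setT cons_pair.
Proof. exact: measurable_cons. Qed.

Definition lebesgue_step : set (euclidean R n.+1) -> \bar R :=
  pushforward (@lebesgue_measure R \x mu) cons_pair.

Let lebesgue_step0 : lebesgue_step set0 = 0.
Proof. by rewrite /lebesgue_step /pushforward preimage_set0 measure0. Qed.

Let lebesgue_step_ge0 A : 0 <= lebesgue_step A.
Proof. by rewrite /lebesgue_step /pushforward measure_ge0. Qed.

Let lebesgue_step_sigma_additive : semi_sigma_additive lebesgue_step.
Proof.
move=> F mF tF mUF; rewrite /lebesgue_step /pushforward preimage_bigcup.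
apply: measure_semi_sigma_additive.
- by move=> k; rewrite -[X in measurable X]setTI; apply: measurable_cons_pair.
- apply/trivIsetP => /= i j _ _ ij; rewrite -preimage_setI.
  by move/trivIsetP : tF => /(_ _ _ _ _ ij) ->//; rewrite preimage_set0.
- rewrite -preimage_bigcup -[X in measurable X]setTI.
  exact: measurable_cons_pair.
Qed.

HB.instance Definition _ := isMeasure.Build _ _ _ lebesgue_step
  lebesgue_step0 lebesgue_step_ge0 lebesgue_step_sigma_additive.

Let lebesgue_step_sigma_finite : sigma_finite setT lebesgue_step.
Proof.
pose g (x : euclidean R n.+1) : measurableTypeR R * euclidean R n :=
  (thead x, [tuple of behead x]).
have mg : measurable_fun setT g.
  by apply/measurable_fun_pair => /=;
    [exact: measurable_tnth|exact: measurable_behead].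
have gK : cancel cons_pair g.
  by move=> [x t]; rewrite /g/= theadE; congr pair; exact/val_inj.
have /sigma_finiteP[F [FT ndF Foo]] := sigma_finiteT (@lebesgue_measure R).
have /sigma_finiteP[G [GT ndG Goo]] := sigma_finiteT mu.
exists (fun i => g @^-1` (F i `*` G i)).
  rewrite -preimage_bigcup (_ : \bigcup_i _ = setT) ?preimage_setT//.
  apply/seteqP; split => // -[x t] _.
  have [i _ Fx] : (\bigcup_i F i) x by rewrite -FT.
  have [j _ Gt] : (\bigcup_i G i) t by rewrite -GT.
  exists (maxn i j) => //; split => /=.
    by move: x Fx; exact/subsetPset/ndF/leq_maxl.
  by move: t Gt; exact/subsetPset/ndG/leq_maxr.
move=> i; have [mF Fi] := Foo i; have [mG Gi] := Goo i.
have mFG : measurable (F i `*` G i) by exact: measurableX.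
split; first by rewrite -[X in measurable X]setTI; exact: mg.
rewrite /lebesgue_step /pushforward -comp_preimage.
rewrite (_ : g \o cons_pair = id); last by apply/funext => p /=; rewrite gK.
by rewrite preimage_id product_measure1E// lte_mul_pinfty// ge0_fin_numE.
Qed.

HB.instance Definition _ := Measure_isSigmaFinite.Build _ _ _ lebesgue_step
  lebesgue_step_sigma_finite.

End step.

Fixpoint lebesgue_tuple (n : nat) :
    {sigma_finite_measure set (euclidean R n) -> \bar R} :=
  match n with
  | 0%N => @dirac _ (euclidean R 0) [tuple] R
  | m.+1 => lebesgue_step (lebesgue_tuple m)
  end.

Lemma lebesgue_tuple_box n (A : 'I_n -> set (measurableTypeR R)) :
  (forall i, measurable (A i)) ->
  lebesgue_tuple n [set x | forall i, A i (tnth x i)] =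
  \prod_(i < n) lebesgue_measure (A i).
Proof.
elim: n => [|n ih] in A *; move=> mA.
  by rewrite big_ord0 /= diracE mem_set// => -[].
rewrite big_ord_recl -ih//= /lebesgue_step /pushforward.
rewrite -product_measure1E//.
  congr (product_measure1 _ _ _); apply/seteqP; split => -[x t] /=.
    move=> H; split; first exact: (H ord0).
    by move=> i; have := H (lift ord0 i); rewrite tnthS.
  move=> [Ax At] i; case: (unliftP ord0 i) => [j ->|->//].
  by rewrite tnthS.
rewrite (_ : [set x : euclidean R n | _] =
    \bigcap_(i in [set: 'I_n]) ((@tnth _ _ ^~ i) @^-1` (A (lift ord0 i)))); last first.
  by apply/seteqP; split => t /= H i; [move=> _; exact: H|exact: (H i I)].
apply: fin_bigcap_measurable; first exact: finite_finset.
move=> i _; rewrite -[X in measurable X]setTI.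
exact: measurable_tnth.
Qed.

End lebesgue_measure_tuple.

Section euclidean_space.
Context {R : realType} {n : nat}.
Implicit Types x y : euclidean R n.

Definition euclidean_dist x y : R :=
  Num.sqrt (\sum_(i < n) (tnth x i - tnth y i) ^+ 2)%R.

Definition euclidean_ball x (r : R) : set (euclidean R n) := [set y | (euclidean_dist x y < r)%R].

End euclidean_space.

Section BMO.
Context {R : realType} {n : nat}.
Local Notation mu := (@lebesgue_tuple R n).
Implicit Type b : euclidean R n -> R.

Definition locally_integrable_euclidean b :=
  measurable_fun setT b /\
  forall x (r : R), (0 < r)%R -> mu.-integrable (euclidean_ball x r) (EFin \o b).

Definition ball_average b x (r : R) : R :=
  ((fine (mu (euclidean_ball x r)))^-1 * \int[mu]_(y in euclidean_ball x r) b y)%R.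

Definition mean_oscillation b x (r : R) : \bar R :=
  (mu (euclidean_ball x r))^-1 *
  \int[mu]_(y in euclidean_ball x r) `|b y - ball_average b x r|%:E.

Definition bmo_norm b : \bar R :=
  ereal_sup [set mean_oscillation b p.1 p.2 | p in [set p | (0 < p.2)%R]].

Definition BMO b := locally_integrable_euclidean b /\ bmo_norm b < +oo.

End BMO.

Section young.
Context {R : realType}.
(* Only the values of [Phi] on [0, +oo[ are ever used. *)
Implicit Type Phi : R -> \bar R.

Definition young_function Phi :=
  [/\ forall r : R, (0 <= r)%R -> 0 <= Phi r,
      forall x y t : R, (0 <= x)%R -> (0 <= y)%R -> (0 <= t <= 1)%R ->
        Phi (t * x + (1 - t) * y)%R <= t%:E * Phi x + (1 - t)%:E * Phi y,
      forall r : R, (0 < r)%R -> Phi s @[s --> r^'-] --> Phi r,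
      Phi 0%R = 0 /\ Phi r @[r --> 0^'+] --> 0 &
      Phi r @[r --> +oo%R] --> +oo].

Definition young_inverse Phi (s : \bar R) : \bar R :=
  ereal_inf [set r%:E | r in [set r : R | (0 <= r)%R /\ s < Phi r]].

Definition Delta2 Phi :=
  exists2 C : R, (1 < C)%R &
    forall r : R, (0 < r)%R -> Phi (2 * r)%R <= C%:E * Phi r.

Definition nabla2 Phi :=
  exists2 C : R, (1 < C)%R &
    forall r : R, (0 <= r)%R -> Phi r <= (2 * C)^-1%:E * Phi (C * r)%R.

(* Extension by Phi(oo) = oo, so that extended-real-valued functions have a
   modular. *)
Definition young_ext Phi (s : \bar R) : \bar R :=
  if s is r%:E then Phi r else +oo.

End young.

Section orlicz.
Context {R : realType} {n : nat}.
Local Notation mu := (@lebesgue_tuple R n).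
Implicit Types (Phi Psi : R -> \bar R) (f : euclidean R n -> \bar R).

Definition orlicz_modular Phi (k : R) f : \bar R :=
  \int[mu]_x young_ext Phi (k%:E * `|f x|).

Definition orlicz_space Phi f :=
  measurable_fun setT f /\
  exists2 k : R, (0 < k)%R & orlicz_modular Phi k f < +oo.

Definition orlicz_norm Phi f : \bar R :=
  ereal_inf [set l%:E | l in
    [set l : R | (0 < l)%R /\ orlicz_modular Phi l^-1 f <= 1]].

Definition orlicz_bounded Phi Psi
    (T : (euclidean R n -> \bar R) -> euclidean R n -> \bar R) :=
  exists2 C : R, (0 < C)%R &
    forall f, orlicz_space Phi f ->
      orlicz_space Psi (T f) /\
      orlicz_norm Psi (T f) <= C%:E * orlicz_norm Phi f.

(* The library integral is the difference of the integrals of the positive and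
   negative parts, with (+oo) - (+oo) = -oo; hence the value below is infinite
   wherever the integral does not converge absolutely, and membership in an
   Orlicz space forces absolute convergence almost everywhere. *)
Definition riesz_commutator_abs (b : euclidean R n -> R) (alpha : R) f x :
    \bar R :=
  \int[mu]_y ((`|b x - b y| / euclidean_dist x y `^ (n%:R - alpha))%R%:E * f y).

End orlicz.

(* Main.v *)
Require Import Defs.
From mathcomp Require Import all_boot all_order all_algebra.
From mathcomp Require Import all_classical all_reals all_analysis.
From mathcomp Require Import measurable_realfun lra ring zify.

(** Write Phi(r) = r * th(r).  Under Delta_2 and nabla_2 the slope th is a
    nondecreasing function with 2 th(x) <= th(a x) and th(2 x) <= D th(x)
    ([growth]).  This class is stable under the generalized inverse
    ([growth_dual]), which plays the role of the conjugate Young function, and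
    in it the hypothesis on the inverses takes the inverse-free form
      Phi(u) <= s < Psi(w)  implies  u <= C s^(alpha/n) w
    ([index_condition]).

    Necessity.  Take for b the indicator of a half-space, which is in BMO
    because it is bounded, and for f the indicator of a cube of side l with a
    face on the boundary of the half-space.  On the adjacent cube the operator
    is at least a constant times l^alpha, so boundedness compares
    l^alpha times 1/Psi^-1(l^-n) with 1/Phi^-1(l^-n); put s = l^-n.

    Sufficiency.
    (1) Discretization.  Two points at distance comparable to 2^-k lie in a
    common cube of side 2^-k of one of the 2^n dyadic grids obtained by
    shifting each coordinate by 0 or 1/3 ([gidx_close], [kernel_le]).  So the
    truncated operator is at most a constant times the sum over these grids of
      T F(x) = sum_k v_k^kappa E_k(|b(x) - b| F)(x),  kappa = alpha/n,
    where E_k averages over the cube of volume v_k around x.  The bounds on a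
    grid do not depend on the grid, and the truncation is removed by Fatou's
    lemma ([fatou_young_mod]).
    (2) On a grid with maximal function M, the main estimate is [bmo_avg]:
      E_k(|b - b_k| F) <= C E_k(M M F),  b_k(x) being the mean over the cell.
    It replaces the John-Nirenberg inequality, and is proved by stopping at the
    first finer cell on which the mean of F has doubled; it needs F <= 2 M F
    almost everywhere, a weak form of Lebesgue's density theorem
    ([max_density]).
    (3) Split |b(x) - b(y)| <= |b(x) - b_k(x)| + |b(y) - b_k(y)|.  By (2) the
    second part is at most C A(M M F) with A = sum_k v_k^kappa E_k.  Hedberg's
    argument gives the pointwise bound Psi(A F / K) <= Phi(M F)
    ([hedberg_sum]); the index condition makes the sums over large and over
    small cells geometric.  The maximal theorem [max_modular] concludes.
    (4) The first part I = sum_k v_k^kappa |b - b_k| E_k F is treated by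
    duality.  Since averaging is self-adjoint, (2) gives
      int I g <= C int A F . M M g.
    With g the slope of Psi at I, the left side is int Psi(I), and Young's
    inequality for the slope of Psi and its generalized inverse, followed by
    the maximal theorem for the latter, bounds the right side by
    int Psi(I) / 2 + C' int Psi(K A F).  Truncating I makes the first term
    finite, so it can be absorbed ([osc_out_modular]). *)

Set Implicit Arguments.
Unset Strict Implicit.
Unset Printing Implicit Defensive.

Import Order.TTheory GRing.Theory Num.Theory.
Import numFieldNormedType.Exports.

Local Open Scope classical_set_scope.
Local Open Scope ring_scope.

(** * Slopes of Young functions *)

(** The slope x |-> Phi(x) / x of a Young function: monotonicity is the
    convexity of Phi (up to constants), the last two fields are nabla_2 and
    Delta_2.  Extended by 0 to the negative reals, slopes are monotone on the
    whole line. *)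
Record growth (R : realType) (th : R -> R) (a D : R) : Prop := Growth {
  growth_a : 1 < a;
  growth_D : 1 < D;
  growth_mono : {homo th : x y / x <= y};
  growth_neg : forall x, x <= 0 -> th x = 0;
  growth_pos : forall x, 0 < x -> 0 < th x;
  growth_nabla : forall x, 2 * th x <= th (a * x);
  growth_delta : forall x, th (2 * x) <= D * th x }.

Section growth_theory.
Context {R : realType}.
Implicit Types (th om : R -> R) (a D x y z : R).

Lemma growth_ge0 th a D x : growth th a D -> 0 <= th x.
Proof.
move=> g; case: (lerP x 0) => [/(growth_neg g) -> //|/(growth_pos g)/ltW //].
Qed.

Lemma growth_nablaX th a D n x : growth th a D -> 2 ^+ n * th x <= th (a ^+ n * x).
Proof.
move=> g; elim: n => [|n ih]; first by rewrite !expr0 !mul1r.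
rewrite !exprS -!mulrA; apply: le_trans (growth_nabla g _).
by rewrite ler_pM2l.
Qed.

Lemma growth_nablaV th a D n x : growth th a D -> th (x / a ^+ n) <= th x / 2 ^+ n.
Proof.
move=> g; rewrite ler_pdivlMr ?exprn_gt0// mulrC.
apply: (le_trans (growth_nablaX n _ g)).
have a0 : 0 < a by apply: lt_trans (growth_a g).
by rewrite mulrCA divff ?mulr1// gt_eqF// exprn_gt0.
Qed.

Lemma growth_deltaX th a D n x : growth th a D -> th (2 ^+ n * x) <= D ^+ n * th x.
Proof.
move=> g; elim: n => [|n ih]; first by rewrite !expr0 !mul1r.
rewrite !exprS -!mulrA; apply: (le_trans (growth_delta g _)).
by rewrite ler_pM2l// (lt_trans _ (growth_D g)).
Qed.

Lemma expr2_unbounded x : exists n, x < 2 ^+ n.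
Proof.
exists (Num.bound x).
have := archi_boundP (normr_ge0 x) => h.
have nx := ler_norm x.
rewrite (le_lt_trans nx)//.
have -> : Num.bound x = Num.bound `|x|.
  by rewrite /Num.bound /= normr_id.
apply: (lt_trans h); rewrite -natrX ltr_nat; exact: ltn_expl.
Qed.

Lemma growth_unbounded th a D z : growth th a D -> exists2 t, 0 < t & z < th t.
Proof.
move=> g; have a0 : 0 < a by apply: lt_trans (growth_a g).
have t0 := growth_pos g ltr01.
have [n hn] := expr2_unbounded (z / th 1).
exists (a ^+ n * 1); first by rewrite mulr1 exprn_gt0.
apply: lt_le_trans (growth_nablaX n _ g).
by rewrite -ltr_pdivrMr.
Qed.

Lemma growth_small th a D z : growth th a D -> 0 < z -> exists2 t, 0 < t & th t <= z.
Proof.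
move=> g z0; have a0 : 0 < a by apply: lt_trans (growth_a g).
have [n hn] := expr2_unbounded (th 1 / z).
exists (1 / a ^+ n); first by rewrite divr_gt0// exprn_gt0.
apply: (le_trans (growth_nablaV n _ g)).
by rewrite ler_pdivrMr ?exprn_gt0// mulrC -ler_pdivrMr// ltW.
Qed.

(** The generalized inverse of [th].  As the derivative of a Young function is
    comparable to its slope, [gdual th] is the slope of a function equivalent to
    the complementary Young function. *)
Definition gdual th z : R := sup [set t | 0 <= t /\ th t <= z].

Lemma gdual_has_sup th a D z : growth th a D -> 0 <= z ->
  has_sup [set t | 0 <= t /\ th t <= z].
Proof.
move=> g z0; split.
  by exists 0; split => //=; rewrite (growth_neg g).
have [t t0 ht] := growth_unbounded z g.
exists t => s [s0 hs]; rewrite leNgt; apply/negP => ts.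
by have := growth_mono g (ltW ts); rewrite leNgt (le_lt_trans hs ht).
Qed.

Lemma gdual_ub th a D z t : growth th a D -> 0 <= t -> th t <= z -> t <= gdual th z.
Proof.
move=> g t0 ht; have z0 := le_trans (growth_ge0 t g) ht.
have [_ hs] := gdual_has_sup g z0.
exact: ub_le_sup.
Qed.

Lemma gdual_le th a D z t : growth th a D -> 0 <= t ->
  (forall s, 0 <= s -> th s <= z -> s <= t) -> gdual th z <= t.
Proof.
move=> g t0 h; case: (leP 0 z) => z0.
  apply: ge_sup; first by have [] := gdual_has_sup g z0.
  by move=> s [s0 hs]; exact: h.
rewrite /gdual (_ : [set _ | _] = set0) ?sup0//.
apply/seteqP; split => // s [s0 /(le_trans (growth_ge0 s g))].
by rewrite leNgt z0.
Qed.

Lemma gdual_gt th a D z t : growth th a D -> gdual th z < t -> 0 <= t -> z < th t.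
Proof.
move=> g h t0; rewrite ltNge; apply/negP => /(gdual_ub g t0).
by rewrite leNgt h.
Qed.

Lemma gdual_ge0 th a D z : growth th a D -> 0 <= gdual th z.
Proof.
move=> g; case: (leP 0 z) => z0.
  by apply: (gdual_ub g) => //; rewrite (growth_neg g).
rewrite /gdual (_ : [set _ | _] = set0) ?sup0//.
apply/seteqP; split => // s [s0 /(le_trans (growth_ge0 s g))].
by rewrite leNgt z0.
Qed.

(** Inverting exchanges the two growth constants: this is the duality between
    Delta_2 and nabla_2. *)
Lemma growth_dual th a D : growth th a D -> growth (gdual th) D a.
Proof.
move=> g; have a0 : 0 < a by apply: lt_trans (growth_a g).
have D0 : 0 < D by apply: lt_trans (growth_D g).
split; [exact: growth_D g|exact: growth_a g| | | | |].
- move=> x y xy; apply: (gdual_le g); first exact: (gdual_ge0 _ g).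
  move=> s s0 hs; apply: (gdual_ub g) => //; exact: le_trans xy.
- move=> x x0; apply/eqP; rewrite eq_le (gdual_ge0 _ g) andbT.
  apply: (gdual_le g) => // s s0 hs; rewrite leNgt; apply/negP => /(growth_pos g).
  by rewrite ltNge (le_trans hs x0).
- move=> x x0; have [t t0 ht] := growth_small g x0.
  exact: lt_le_trans t0 (gdual_ub g (ltW t0) ht).
- move=> x; rewrite mulrC -ler_pdivlMr//.
  apply: (gdual_le g); first by rewrite divr_ge0// (gdual_ge0 _ g).
  move=> s s0 hs; rewrite ler_pdivlMr// mulrC; apply: (gdual_ub g); first by rewrite mulr_ge0.
  by apply: (le_trans (growth_delta g _)); rewrite ler_pM2l.
- move=> x; apply: (gdual_le g); first by rewrite mulr_ge0 ?(ltW a0)// (gdual_ge0 _ g).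
  move=> s s0 hs; rewrite -ler_pdivrMl//; apply: (gdual_ub g).
    by rewrite mulr_ge0// invr_ge0 ltW.
  rewrite mulrC; have := growth_nablaV 1 s g; rewrite !expr1 => /le_trans; apply.
  by rewrite ler_pdivrMr// mulrC.
Qed.

(** Young's inequality.  Either K y is at most the inverse of th at z, or z
    is at most th(K y); each of the two terms alone covers one case. *)
Lemma gdual_young th a D y z K : growth th a D -> 0 <= y -> 0 <= z -> 0 < K ->
  y * z <= (z * gdual th z + K * y * th (K * y)) / K.
Proof.
move=> g y0 z0 K0; rewrite ler_pdivlMr//.
have Ky : 0 <= K * y by rewrite mulr_ge0// ltW.
case: (leP (K * y) (gdual th z)) => h.
  apply: (@le_trans _ _ (z * gdual th z)).
    by rewrite mulrAC [y * K]mulrC [leLHS]mulrC ler_wpM2l.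
  by rewrite lerDl mulr_ge0// (growth_ge0 _ g).
have zt := ltW (gdual_gt g h Ky).
apply: (@le_trans _ _ (K * y * th (K * y))).
  by rewrite mulrAC [y * K]mulrC ler_wpM2l.
by rewrite lerDr mulr_ge0// (gdual_ge0 _ g).
Qed.

(** The counterpart of the equality case of Young's inequality: if th(s) <=
    th(t) with s > a t, then nabla_2 would give 2 th(t) <= th(t). *)
Lemma gdual_comp th a D t : growth th a D -> 0 <= t ->
  th t * gdual th (th t) <= a * (t * th t).
Proof.
move=> g; rewrite le_eqVlt => /predU1P[<-|t0].
  by rewrite (growth_neg g (lexx 0)) !mul0r mulr0.
have a0 : 0 < a by apply: lt_trans (growth_a g).
have tt := growth_pos g t0.
rewrite mulrA [leRHS]mulrC; apply: ler_wpM2l; first exact: ltW.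
apply: (gdual_le g); first by rewrite mulr_ge0// ltW.
move=> s s0 hs; rewrite leNgt; apply/negP => ats.
have := le_trans (growth_nabla g t) (growth_mono g (ltW ats)).
move=> /le_trans/(_ hs); rewrite -subr_ge0 -{1}[th t]mul1r -mulrBl.
by rewrite pmulr_lge0// leNgt; lra.
Qed.

(** Shifting the sum by d terms at least halves it, so the whole sum is at
    most twice its first d terms.  Halving after d steps, and not at each step,
    is what Delta_2 and small exponents provide. *)
Lemma sum_half_le (m d : nat) (f : nat -> R) : (forall k, 0 <= f k) ->
  (forall k, f k <= f 0%N) -> (forall k, f (k + d)%N <= f k / 2) ->
  \sum_(k < m) f k <= 2 * d%:R * f 0%N.
Proof.
move=> f0 fm fd.
have h : \sum_(k < m) f k <= \sum_(k < d) f k + \sum_(k < m) f (k + d)%N.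
  rewrite -!(big_mkord xpredT) -[X in _ <= _ + X](big_mkord xpredT (fun k => f (k + d)%N)).
  have -> : \sum_(0 <= k < m) f (k + d)%N = \sum_(d <= k < m + d) f k.
    by rewrite -{2}[d]add0n big_addn addnK.
  rewrite -big_cat_nat//= ?leq_addl//.
  by rewrite [leRHS](@big_cat_nat _ _ _ m)//= ?leq_addr// lerDl sumr_ge0.
have h1 : \sum_(k < d) f k <= d%:R * f 0%N.
  apply: (le_trans (ler_sum _ (fun i _ => fm (nat_of_ord i)))).
  by rewrite sumr_const card_ord mulr_natl.
have h2 : \sum_(k < m) f (k + d)%N <= (\sum_(k < m) f k) / 2.
  by rewrite mulr_suml; apply: ler_sum => i _; exact: fd.
have {h2} := le_trans h (lerD h1 h2).
lra.
Qed.

End growth_theory.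

Section geometric.
Context {R : realType}.

Lemma expr_unbounded (a x : R) : 1 < a -> exists N, forall n, (N <= n)%N -> x < a ^+ n.
Proof.
move=> a1.
have bern n : 1 + n%:R * (a - 1) <= a ^+ n.
  elim: n => [|n ih]; first by rewrite mul0r addr0 expr0.
  rewrite exprS; apply: le_trans (ler_wpM2l _ ih); last by lra.
  rewrite -natr1; have : 0 <= n%:R * (a - 1) * (a - 1) by rewrite !mulr_ge0//; lra.
  lra.
have a0 : 0 < a - 1 by lra.
have := archi_boundP (normr_ge0 (x / (a - 1))).
set N := Num.bound _ => hN; exists N => n Nn.
apply: lt_le_trans (bern n).
have h1 : x / (a - 1) < n%:R.
  by apply: le_lt_trans (ler_norm _) (lt_le_trans hN _); rewrite ler_nat.
by rewrite ltr_pdivrMr// in h1; lra.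
Qed.

(** The modular at r is recovered from the levels c_j below r: by nabla_2 the
    values th(c_j) at least double from one level to the next, so the last of
    them dominates the sum. *)
Lemma sum_growth_le (th : R -> R) a D (c : nat -> R) r m : growth th a D ->
  (forall j, 0 < c j) -> (forall j, c j.+1 = a * c j) ->
  \sum_(j < m) th (c j.+1) * (c j < r)%R%:R <= 2 * th (a * r).
Proof.
move=> g c0 cS.
suff [] : \sum_(j < m) th (c j.+1) * (c j < r)%R%:R <= 2 * th (a * r) /\
  \sum_(j < m) th (c j.+1) * (c j < r)%R%:R <= 2 * th (c m) by [].
elim: m => [|m [ih1 ih2]].
  by rewrite big_ord0; split; rewrite mulr_ge0// (growth_ge0 _ g).
rewrite big_ord_recr/=.
have := growth_nabla g (c m); rewrite -cS.
have t0 := growth_ge0 (c m.+1) g.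
case: (ltrP (c m) r) => cmr /= hn; rewrite ?mulr1 ?mulr0; last by split; lra.
have : th (c m.+1) <= th (a * r).
  by apply: (growth_mono g); rewrite cS ler_pM2l ?ltW// (lt_trans _ (growth_a g)).
by split; lra.
Qed.

Lemma geometric_bracket (c : nat -> R) t m : c 0%N < t -> t <= c m ->
  exists2 j, (j < m)%N & c j < t <= c j.+1.
Proof.
move=> h0; elim: m => [|m ih] h; first by move: h; rewrite leNgt h0.
have [tm|tm] := leP t (c m).
  by have [j jm hj] := ih tm; exists j => //; exact: ltnW.
by exists m => //; rewrite tm.
Qed.

Lemma quarter_lt (t r : R) : 0 <= t -> 2 * t < r -> 0 < r / 4 /\ 2 * (r / 4) < r.
Proof. by move=> h1 h2; split; lra. Qed.

End geometric.

(** * Hedberg's estimate for sequences *)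

Section hedberg.
Context {R : realType}.
Implicit Types (th om : R -> R) (a D x y z : R).

Definition young_of th (r : R) : R := r * th r.

Lemma young_of_ge0 th a D r : growth th a D -> 0 <= young_of th r.
Proof.
move=> g; rewrite /young_of; case: (lerP r 0) => h.
  by rewrite (growth_neg g h) mulr0.
by rewrite mulr_ge0 ?(growth_ge0 _ g)// ltW.
Qed.

Lemma young_of_gt0 th a D r : growth th a D -> 0 < r -> 0 < young_of th r.
Proof. by move=> g r0; rewrite mulr_gt0// (growth_pos g). Qed.

Lemma young_of_mono th a D : growth th a D -> {homo young_of th : x y / x <= y}.
Proof.
move=> g x y xy; case: (lerP x 0) => h.
  by rewrite {1}/young_of (growth_neg g h) mulr0 (young_of_ge0 _ g).
by apply: ler_pM => //; [exact: ltW|exact: (growth_ge0 _ g)|exact: growth_mono g _ _ xy].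
Qed.

Lemma young_of_deltaX th a D n r : growth th a D ->
  young_of th (2 ^+ n * r) <= (2 * D) ^+ n * young_of th r.
Proof.
move=> g; case: (lerP r 0) => h.
  rewrite /young_of !(growth_neg g) ?mulr0//.
  by rewrite pmulr_rle0// exprn_gt0.
rewrite /young_of exprMn -!mulrA ler_pM2l ?exprn_gt0//.
rewrite mulrCA ler_pM2l//; exact: growth_deltaX g.
Qed.

(** A substitute for the inverse of r * th(r), which may jump over s: the
    value s is crossed between w and 2 w. *)
Lemma young_bracket th a D s : growth th a D -> 0 < s ->
  exists2 w, 0 < w & young_of th w <= s < young_of th (2 * w).
Proof.
move=> g s0.
have [t t0 ht] := growth_small g s0.
pose r := Num.min t 1.
have r0 : 0 < r by rewrite lt_min t0 ltr01.
have hr : young_of th r <= s.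
  apply: le_trans ht; rewrite -[leRHS]mul1r; apply: ler_pM.
  - exact: ltW.
  - exact: (growth_ge0 _ g).
  - by rewrite ge_min lexx orbT.
  - by apply: (growth_mono g); rewrite ge_min lexx.
have ex : exists n, s < young_of th (2 ^+ n * r).
  have [n hn] := expr2_unbounded (s / (r * th r)).
  exists n; rewrite ltr_pdivrMr ?mulr_gt0 ?(growth_pos g)// in hn.
  apply: (lt_le_trans hn); rewrite /young_of mulrA.
  apply: ler_pM; rewrite ?(growth_ge0 _ g)//; first by rewrite mulr_ge0 ?exprn_ge0// ltW.
  apply: (growth_mono g); apply: ler_peMl; first exact: ltW.
  by rewrite exprn_ege1// ler1n.
case: (ex_minnP ex) => -[|n] hn hmin.
  by move: hn; rewrite expr0 mul1r ltNge hr.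
exists (2 ^+ n * r); first by rewrite mulr_gt0// exprn_gt0.
rewrite mulrA -exprS hn andbT leNgt; apply/negP => /hmin.
by rewrite ltnn.
Qed.

Lemma threshold_split (P : pred nat) (m : nat) : (forall k, P k -> P k.+1) ->
  exists k0, [/\ (k0 <= m)%N, forall k, (k < k0)%N -> ~~ P k &
    forall k, (k0 <= k < m)%N -> P k].
Proof.
move=> hP; elim: m => [|m [k0 [k0m h1 h2]]].
  by exists 0%N; split => // k /andP[_]; rewrite ltn0.
have mono k i : P k -> P (k + i)%N.
  by elim: i => [|i ih] h; [rewrite addn0|rewrite addnS; apply: hP; exact: ih].
have [Pm|Pm] := boolP (P m).
  exists k0; split => //; first exact: leqW.
  move=> k /andP[k0k]; rewrite ltnS leq_eqVlt => /predU1P[-> //|km].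
  by apply: h2; rewrite k0k.
exists m.+1; split => //.
  move=> k; rewrite ltnS => km; apply: contra Pm => Pk.
  by rewrite -(subnKC km); exact: mono.
by move=> k /andP[h]; rewrite ltnNge h.
Qed.

Lemma powR_half_le (kappa : R) : 0 < kappa ->
  exists d, (0 < d)%N /\ (2^-1 ^+ d : R) `^ kappa <= 2^-1.
Proof.
move=> k0; have := archi_boundP (ltW (divr_gt0 ltr01 k0)).
set d := Num.bound _ => hd; exists d.
have hd0 : (0 < d)%N by rewrite -(ltr_nat R); apply: lt_trans hd; rewrite divr_gt0.
split => //.
have h2 : (2^-1 : R) `^ 1 = 2^-1 by rewrite powRr1.
rewrite -[leRHS]h2 -powR_mulrn// -powRrM.
apply: ger_powR; first by apply/andP; split; lra.
by rewrite -ler_pdivrMr// ltW.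
Qed.

Lemma half_pow_divn d i : (0 < d)%N ->
  (2^-1 : R) ^+ ((i + d) %/ d) = (2^-1) ^+ (i %/ d) / 2.
Proof. by move=> d0; rewrite divnDr// divnn d0 addn1 exprSr. Qed.

(** The relation between the two inverses at s, tested on any u below the
    first and any w above the second. *)
Definition index_condition (thP thS : R -> R) (kappa C0 : R) :=
  forall u w s : R, 0 < u -> 0 < w -> 0 < s -> young_of thP u <= s ->
    s < young_of thS w -> u <= C0 * s `^ kappa * w.

(** Here v_k is the volume of the k-th cell around a point, e_k the average
    of F on it and u the maximal function; the last hypothesis on e is Jensen's
    inequality under a unit bound on the modular of F.  Let k1 be the first
    index with v_k Phi(u) <= 1.  For k >= k1 bound e_k by u and sum the
    geometric sequence v_k^kappa.  For k < k1 bound e_k by the inverse of Phi at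
    1 / v_k; the index condition turns v_k^kappa e_k into the inverse of Psi at
    1 / v_k, which is geometric by Delta_2.  Both sums are at most a multiple of
    the inverse of Psi at Phi(u). *)
Lemma hedberg_sum thP aP DP thS aS DS kappa C0 :
  growth thP aP DP -> growth thS aS DS -> 0 < kappa -> 0 < C0 ->
  index_condition thP thS kappa C0 ->
  exists2 K, 0 < K & forall (v : nat -> R) q (e : nat -> R) u m,
    2 <= q -> (forall k, 0 < v k) -> (forall k, v k = q * v k.+1) ->
    (forall k, 0 <= e k) -> (forall k, e k <= u) ->
    (forall k U, 0 < U -> 1 <= v k * young_of thP U -> e k <= 2 * U) ->
    young_of thS ((\sum_(k < m) v k `^ kappa * e k) / K) <= young_of thP u.
Proof.
move=> gP gS k0 C00 hC.
have D0 : 0 < DS by apply: lt_trans (growth_D gS).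
have [d1 [d10 hd1]] := powR_half_le k0.
have [d2 hd2] := expr2_unbounded (2 * DS).
have d20 : (0 < d2)%N.
  by rewrite lt0n; apply/negP => /eqP d2E; move: hd2 (growth_D gS); rewrite d2E expr0; lra.
(* The two summands are the bounds of the sums over k >= k1 and k < k1, where
   v^kappa halves every d1 steps and the inverse of Psi every d2 steps. *)
pose K := 2 * d1%:R * (2 * C0) + 2 * d2%:R * (16 * C0).
have K0 : 0 < K.
  have h1 : (0 < d1%:R :> R) by rewrite ltr0n.
  have h2 : (0 <= d2%:R :> R) by rewrite ler0n.
  rewrite /K ltr_wpDr//; [by rewrite !mulr_ge0// ltW|by rewrite !mulr_gt0].
exists K => // v q e u m q2 v0 vS e0 eu eU.
case: (lerP u 0) => [u0|u0].
  rewrite big1 ?mul0r; last first.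
    move=> i _; have -> : e i = 0 by apply/eqP; rewrite eq_le e0 (le_trans (eu _)).
    by rewrite mulr0.
  by rewrite {1}/young_of mul0r (young_of_ge0 _ gP).
set s0 := young_of thP u.
have s00 : 0 < s0 by exact: young_of_gt0 gP u0.
have [w w0 /andP[w1 w2]] := young_bracket gS s00.
apply: le_trans w1; apply: (young_of_mono gS); rewrite ler_pdivrMr// mulrC.
have uw : u <= C0 * s0 `^ kappa * (2 * w).
  by apply: hC => //; rewrite mulr_gt0.
have v2 k : v k.+1 <= v k / 2.
  rewrite (vS k) ler_pdivlMr// mulrC; apply: ler_pM => //; exact: ltW.
have v2X k i : v (k + i)%N <= v k * 2^-1 ^+ i.
  elim: i => [|i ih]; first by rewrite addn0 expr0 mulr1.
  rewrite addnS exprSr mulrA; apply: (le_trans (v2 _)).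
  by rewrite ler_pM2r// invr_gt0.
have vd k : v k.+1 <= v k by have := v2 k; have := v0 k; lra.
have [k1 [k1m hk1 hk2]] := @threshold_split (fun k => v k * s0 <= 1) m
  (fun k h => le_trans (ler_wpM2r (ltW s00) (vd k)) h).
pose F k := v k `^ kappa * e k.
(* Both sums are indexed by the distance to k1, where the terms are largest. *)
have -> : \sum_(k < m) v k `^ kappa * e k =
    \sum_(i < k1) F (k1 - i.+1)%N + \sum_(i < m - k1) F (k1 + i)%N.
  rewrite -(big_mkord xpredT F) (big_cat_nat (n := k1))//=; congr (_ + _).
    by rewrite big_nat_rev/= add0n big_mkord.
  rewrite -{1}[k1]add0n big_addn big_mkord.
  by apply: eq_bigr => i _; rewrite addnC.
rewrite addrC (mulrDl _ _ w); apply: lerD.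
- pose f i := 2 * C0 * w * (2^-1 ^+ i) `^ kappa.
  have pm i j : (i <= j)%N -> (2^-1 ^+ j : R) `^ kappa <= (2^-1 ^+ i) `^ kappa.
    move=> ij; apply: ge0_ler_powR; rewrite ?nnegrE ?exprn_ge0 ?(ltW k0)//.
    by apply: ler_wiXn2l => //; lra.
  have C0w : 0 <= 2 * C0 * w by rewrite !mulr_ge0// ltW.
  have hF i : (i < m - k1)%N -> F (k1 + i)%N <= f i.
    move=> im; have hk : v k1 * s0 <= 1.
      by apply: hk2; rewrite leqnn/= -subn_gt0; exact: leq_ltn_trans im.
    apply: (@le_trans _ _ (v (k1 + i)%N `^ kappa * (C0 * s0 `^ kappa * (2 * w)))).
      by rewrite ler_wpM2l ?powR_ge0// (le_trans (eu _)).
    rewrite (_ : _ `^ _ * _ = 2 * C0 * w * (v (k1 + i)%N * s0) `^ kappa); last first.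
      by rewrite powRM ?(ltW (v0 _)) ?(ltW s00)//; ring.
    rewrite ler_wpM2l//; apply: ge0_ler_powR; rewrite ?nnegrE ?exprn_ge0 ?(ltW k0)//.
      by rewrite mulr_ge0 ?ltW.
    apply: (le_trans (ler_wpM2r (ltW s00) (v2X _ _))).
    by rewrite mulrAC ler_piMl// exprn_ge0.
  apply: (@le_trans _ _ (\sum_(i < m - k1) f i)).
    by apply: ler_sum => i _; exact: hF.
  apply: (le_trans (@sum_half_le _ _ d1 _ _ _ _)).
  + by move=> k; rewrite mulr_ge0// powR_ge0.
  + by move=> k; rewrite /f ler_wpM2l// pm.
  + move=> k; rewrite /f -[leRHS]mulrA ler_wpM2l// exprD powRM ?exprn_ge0//.
    by rewrite ler_wpM2l ?powR_ge0.
  + by rewrite /f expr0 powR1 mulr1 -!mulrA.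
- pose f i := 16 * C0 * w * 2^-1 ^+ (i %/ d2).
  have C0w : 0 <= 16 * C0 * w by rewrite !mulr_ge0// ltW.
  have hF i : (i < k1)%N -> F (k1 - i.+1)%N <= f i.
    move=> ik; set k := (k1 - i.+1)%N.
    have vk : 0 < (v k)^-1 by rewrite invr_gt0.
    have vV y : (v k)^-1 < y -> 1 <= v k * y.
      by move=> h; rewrite -ler_pdivrMl// mulr1 ltW.
    have [uk uk0 /andP[uk1 uk2]] := young_bracket gP vk.
    have [wk wk0 /andP[wk1 wk2]] := young_bracket gS vk.
    have ek : e k <= 4 * uk.
      apply: (le_trans (eU k (2 * uk) _ (vV _ uk2))); first by rewrite mulr_gt0.
      by rewrite mulrA ler_pM2r//; lra.
    have uwk : uk <= C0 * (v k)^-1 `^ kappa * (2 * wk).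
      by apply: hC => //; rewrite mulr_gt0.
    have hwk : wk <= 2 * w * 2^-1 ^+ (i %/ d2).
      rewrite leNgt; apply/negP => h.
      have h2 : young_of thS (2 * w) <= (2 * DS) ^+ (i %/ d2) * young_of thS wk.
        apply: le_trans (ler_wpM2l _ (young_of_mono gS (ltW h))).
          apply: le_trans (young_of_deltaX _ _ gS); apply: (young_of_mono gS).
          by rewrite mulrCA -exprMn divff// expr1n mulr1.
        by rewrite exprn_ge0// mulr_ge0// ltW.
      have h3 : (2 * DS) ^+ (i %/ d2) <= 2 ^+ i.
        apply: (@le_trans _ _ ((2 ^+ d2) ^+ (i %/ d2))).
          by apply: lerXn2r; rewrite ?nnegrE ?exprn_ge0 ?mulr_ge0// ?ltW.
        rewrite -exprM ler_weXn2l ?ler1n// mulnC.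
        exact: leq_trunc_div.
      have h4 : young_of thS wk <= 2^-1 ^+ i * s0.
        apply: (le_trans wk1); have := hk1 (k1 - 1)%N.
        have -> : (k1 - 1)%N = (k + i)%N by rewrite /k; move: ik; clear; lia.
        have -> : (k + i < k1)%N by rewrite /k; move: ik; clear; lia.
        move=> /(_ isT); rewrite -ltNge => h5.
        rewrite -[leLHS]mul1r ler_pdivrMr// mulrAC.
        apply: (le_trans (ltW h5)); apply: ler_wpM2r; first exact: ltW.
        by rewrite mulrC.
      suff : young_of thS (2 * w) <= s0 by rewrite leNgt w2.
      apply: (le_trans h2); apply: (@le_trans _ _ (2 ^+ i * (2^-1 ^+ i * s0))).
        by apply: ler_pM => //; [rewrite exprn_ge0// mulr_ge0// ltW|exact: (young_of_ge0 _ gS)].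
      by rewrite mulrA -exprMn divff// expr1n mul1r.
    apply: (@le_trans _ _ (v k `^ kappa * (4 * (C0 * (v k)^-1 `^ kappa * (2 * wk))))).
      rewrite ler_wpM2l ?powR_ge0//; apply: (le_trans ek); rewrite ler_pM2l//.
    rewrite (_ : _ `^ _ * (4 * _) = 8 * C0 * wk * (v k * (v k)^-1) `^ kappa); last first.
      by rewrite powRM ?(ltW (v0 _)) ?(ltW vk)//; ring.
    rewrite divff ?gt_eqF// powR1 mulr1 /f.
    rewrite (_ : 16 * _ * _ * _ = 8 * C0 * (2 * w * 2^-1 ^+ (i %/ d2))); last by ring.
    by rewrite ler_wpM2l// mulr_ge0// ltW.
  apply: (@le_trans _ _ (\sum_(i < k1) f i)).
    by apply: ler_sum => i _; exact: hF.
  apply: (le_trans (@sum_half_le _ _ d2 _ _ _ _)).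
  + by move=> k; rewrite mulr_ge0// exprn_ge0.
  + move=> k; rewrite /f ler_wpM2l// div0n expr0.
    by apply: exprn_ile1; lra.
  + by move=> k; rewrite /f half_pow_divn// mulrA.
  + by rewrite /f div0n expr0 mulr1 -!mulrA.
Qed.

End hedberg.

(** * Shifted dyadic intervals *)

Section floor_grid.
Context {R : realType}.
Implicit Types (x y z : R) (s t : bool).

Definition side N k : R := 2 ^+ N / 2 ^+ k.

Lemma side_gt0 N k : 0 < side N k.
Proof. by rewrite divr_gt0// exprn_gt0. Qed.

Lemma sideS N k : side N k = 2 * side N k.+1.
Proof. by rewrite /side exprS; field; rewrite expf_neq0. Qed.

(** The sign alternates with k so that the intervals of step k+1 refine those
    of step k: as 2 * (1/3) = -1/3 + 1 and sides halve, end points of step k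
    are end points of step k+1. *)
Definition shift t k : R := (-1) ^+ k * (if t then 3^-1 else 0).

Definition gidx N t k x : int := Num.floor (x / side N k - shift t k).

Lemma shiftS t k : exists m : int, 3 * shift t k = m%:~R.
Proof.
rewrite /shift; case: t; last by exists 0; rewrite !mulr0.
exists ((-1) ^+ k); rewrite mulrCA divff// mulr1.
by rewrite rmorphXn rmorphN1.
Qed.

Lemma gidx_bounds N t k x : let m := (gidx N t k x)%:~R in
  side N k * (m + shift t k) <= x /\ x < side N k * (m + shift t k + 1).
Proof.
move=> m; have s0 := side_gt0 N k.
have /andP[h1 h2] := floor_itv (x / side N k - shift t k).
have xE : x = side N k * (x / side N k) by field; rewrite gt_eqF.
rewrite intrD in h2; split.
  by rewrite [leRHS]xE ler_pM2l//; rewrite /m /gidx; lra.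
by rewrite [ltLHS]xE ltr_pM2l//; rewrite /m /gidx; lra.
Qed.

Lemma gidxP N t k x (m : int) : side N k * (m%:~R + shift t k) <= x ->
  x < side N k * (m%:~R + shift t k + 1) -> gidx N t k x = m.
Proof.
move=> h1 h2; have s0 := side_gt0 N k.
apply: floor_def; rewrite intrD.
have xE : x = side N k * (x / side N k) by field; rewrite gt_eqF.
rewrite [leRHS]xE ler_pM2l// in h1; rewrite [ltLHS]xE ltr_pM2l// in h2.
by apply/andP; split; lra.
Qed.

Lemma gidx_nest N t k x y : gidx N t k.+1 x = gidx N t k.+1 y ->
  gidx N t k x = gidx N t k y.
Proof.
move=> e; have [c hc] := shiftS t k; have s0 := side_gt0 N k.+1.
have [h1 h2] := gidx_bounds N t k x.
have [h3 h4] := gidx_bounds N t k.+1 x.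
have [h5 h6] := gidx_bounds N t k.+1 y.
rewrite e in h3 h4.
set m := gidx N t k x in h1 h2 *; set p := gidx N t k.+1 y in h3 h4 h5 h6.
have shE : shift t k.+1 = - shift t k by rewrite /shift exprS mulN1r mulNr.
rewrite shE in h3 h4 h5 h6; rewrite sideS in h1 h2.
have a1 : side N k.+1 * (2 * m%:~R + 2 * shift t k) < side N k.+1 * (p%:~R - shift t k + 1) by lra.
have a2 : side N k.+1 * (p%:~R - shift t k) < side N k.+1 * (2 * m%:~R + 2 * shift t k + 2) by lra.
rewrite !ltr_pM2l// in a1 a2.
have b1 : 2 * m + c <= p.
  rewrite -ltzD1 -(ltr_int R) !intrD intrM -hc; lra.
have b2 : p <= 2 * m + c + 1.
  rewrite -ltzD1 -(ltr_int R) !intrD intrM -hc; lra.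
have {}b1 : (2 * m%:~R + 3 * shift t k <= p%:~R :> R).
  by rewrite hc -[2]/(2%:~R) -intrM -intrD ler_int.
have {}b2 : (p%:~R <= 2 * m%:~R + 3 * shift t k + 1 :> R).
  by rewrite hc -[2]/(2%:~R) -intrM -intrD -[1]/(1%:~R) -intrD ler_int.
apply/esym/gidxP; rewrite sideS.
  apply: le_trans h5; rewrite [leLHS](_ : _ = side N k.+1 * (2 * m%:~R + 2 * shift t k)); last by ring.
  by rewrite ler_pM2l//; lra.
apply: (lt_le_trans h6).
rewrite [leRHS](_ : _ = side N k.+1 * (2 * m%:~R + 2 * shift t k + 2)); last by ring.
by rewrite ler_pM2l//; lra.
Qed.

Lemma gidx_mono N t k : {homo (fun x => (gidx N t k x)%:~R : R) : x y / x <= y}.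
Proof.
move=> x y xy; rewrite ler_int; apply: le_floor.
by rewrite lerD2r ler_pM2r// invr_gt0 side_gt0.
Qed.

Lemma measurable_gidx N t k :
  measurable_fun setT (fun x : measurableTypeR R => (gidx N t k x)%:~R : R).
Proof. by apply: nondecreasing_measurable => //; exact: gidx_mono. Qed.

Lemma gidx_dist N t k x y : gidx N t k x = gidx N t k y -> `|x - y| < side N k.
Proof.
move=> e; have [h1 h2] := gidx_bounds N t k x; have [h3 h4] := gidx_bounds N t k y.
rewrite e in h1 h2; rewrite ltr_norml; apply/andP; split; lra.
Qed.

(** On the scale of the side, the end points of the two families are at
    distance at least 1/3 from each other, so an interval shorter than that
    contains end points of at most one family. *)
Lemma gidx_close N k x y : 3 * `|x - y| < side N k ->
  exists t, gidx N t k x = gidx N t k y.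
Proof.
wlog xy : x y / x <= y => [hw|].
  case/orP: (le_total x y) => h; first exact: hw.
  by rewrite distrC => /(hw _ _ h) [t e]; exists t.
move=> h; have s0 := side_gt0 N k.
rewrite distrC ger0_norm ?subr_ge0// in h.
have [h1 h2] := gidx_bounds N false k x.
have [h3 h4] := gidx_bounds N true k x.
set m := gidx N false k x in h1 h2; set p := gidx N true k x in h3 h4.
have [yl|yl] := ltrP y (side N k * (m%:~R + shift false k + 1)).
  by exists false; apply/esym/gidxP => //; exact: le_trans xy.
have [yp|yp] := ltrP y (side N k * (p%:~R + shift true k + 1)).
  by exists true; apply/esym/gidxP => //; exact: le_trans xy.
exfalso.
have a1 : side N k * (3 * (m%:~R + shift false k + 1)) < side N k * (3 * (p%:~R + shift true k + 1) + 1) by lra.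
have a2 : side N k * (3 * (p%:~R + shift true k + 1)) < side N k * (3 * (m%:~R + shift false k + 1) + 1) by lra.
rewrite !ltr_pM2l// in a1 a2.
have e0 : shift false k = 0 by rewrite /shift mulr0.
(* The offset between the families is 1/3 or -1/3; in both cases no integers
   m and p satisfy the two inequalities. *)
have [e1|e1] : 3 * shift true k = 1 \/ 3 * shift true k = -1.
  by rewrite /shift -signr_odd mulrCA divff// mulr1; case: odd; [right|left].
- rewrite e0 in a1 a2.
  have b1 : (3 * m%:~R < 3 * p%:~R + 2 :> R) by lra.
  have b2 : (3 * p%:~R < 3 * m%:~R :> R) by lra.
  rewrite -[3]/(3%:~R) -[2]/(2%:~R) -!intrM -?intrD !ltr_int in b1 b2.
  by move: b1 b2; clear; lia.
- rewrite e0 in a1 a2.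
  have b1 : (3 * m%:~R < 3 * p%:~R :> R) by lra.
  have b2 : (3 * p%:~R < 3 * m%:~R + 2 :> R) by lra.
  rewrite -[3]/(3%:~R) -[2]/(2%:~R) -!intrM -?intrD !ltr_int in b1 b2.
  by move: b1 b2; clear; lia.
Qed.

End floor_grid.

(** * Nonnegative measurable functions and modulars *)

Local Open Scope ereal_scope.

Section pmeas_theory.
Context {d} {T : measurableType d} {R : realType}.
Implicit Types (f g : T -> \bar R).

Definition pmeas f := measurable_fun setT f /\ forall x, 0 <= f x.

Lemma pmM f g : pmeas f -> pmeas g -> pmeas (fun x => f x * g x).
Proof.
by move=> [mf f0] [mg g0]; split => [|x]; [exact: emeasurable_funM|exact: mule_ge0].
Qed.

Lemma pmD f g : pmeas f -> pmeas g -> pmeas (fun x => f x + g x).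
Proof.
by move=> [mf f0] [mg g0]; split => [|x]; [exact: emeasurable_funD|exact: adde_ge0].
Qed.

Lemma pm_cst (c : \bar R) : 0 <= c -> pmeas (fun=> c).
Proof. by move=> c0; split => //; exact: measurable_cst. Qed.

Lemma pm_max f g : pmeas f -> pmeas g -> pmeas (fun x => maxe (f x) (g x)).
Proof.
move=> [mf f0] [mg g0]; split => [|x]; first exact: measurable_maxe.
by rewrite le_max f0.
Qed.

Lemma pm_min f g : pmeas f -> pmeas g -> pmeas (fun x => mine (f x) (g x)).
Proof.
move=> [mf f0] [mg g0]; split => [|x]; first exact: measurable_mine.
by rewrite le_min f0 g0.
Qed.

Lemma pm_sum (I : Type) (s : seq I) (P : pred I) (F : I -> T -> \bar R) :
  (forall i, pmeas (F i)) -> pmeas (fun x => \sum_(i <- s | P i) F i x).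
Proof.
move=> h; elim: s => [|i s ih].
  by under eq_fun do rewrite big_nil; exact: pm_cst.
under eq_fun do rewrite big_cons.
by case: (P i) => //; apply: pmD.
Qed.

Lemma pm_bigmax (I : Type) (s : seq I) (P : pred I) (F : I -> T -> \bar R) :
  (forall i, pmeas (F i)) -> pmeas (fun x => \big[maxe/0]_(i <- s | P i) F i x).
Proof.
move=> h; elim: s => [|i s ih].
  by under eq_fun do rewrite big_nil; exact: pm_cst.
under eq_fun do rewrite big_cons.
by case: (P i) => //; apply: pm_max.
Qed.

Lemma pm_if (b : T -> bool) f g : measurable_fun setT b ->
  pmeas f -> pmeas g -> pmeas (fun x => if b x then f x else g x).
Proof.
move=> mb [mf f0] [mg g0]; split => [|x]; first exact: measurable_fun_ifT.
by case: ifP.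
Qed.

Lemma pm_esup (F : nat -> T -> \bar R) : (forall i, pmeas (F i)) ->
  pmeas (fun x => ereal_sup (range (F ^~ x))).
Proof.
move=> h; split => [|x]; last first.
  apply: le_trans ((h 0%N).2 x) _; apply: ereal_sup_ubound; by exists 0%N.
rewrite (_ : (fun x => _) = fun x => esups (F ^~ x) 0%N).
  by apply: measurable_fun_esups => n; case: (h n).
apply/funext => x; rewrite /esups /=; congr ereal_sup.
by apply/seteqP; split => y [n _ <-]; exists n.
Qed.

Lemma pm_EFin (h : T -> R) : measurable_fun setT h -> (forall x, (0 <= h x)%R) ->
  pmeas (fun x => (h x)%:E).
Proof.
move=> mh h0; split => [|x]; last by rewrite lee_fin.
exact/measurable_EFinP.
Qed.

Lemma pm_indic (A : set T) : measurable A -> pmeas (fun x => (\1_A x)%:E).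
Proof. by move=> mA; apply: pm_EFin => //; exact: measurable_indic. Qed.

Lemma pm_abs (h : T -> R) : measurable_fun setT h -> pmeas (fun x => `|h x|%:E).
Proof. by move=> mh; apply: pm_EFin => //; exact: measurableT_comp. Qed.

Definition young_mod (th : R -> R) (s : \bar R) : \bar R :=
  match s with r%:E => (young_of th r)%:E | +oo => +oo | -oo => 0 end.

Lemma young_mod_ge0 th a D s : growth th a D -> 0 <= young_mod th s.
Proof. by move=> g; case: s => //= r; rewrite lee_fin (young_of_ge0 _ g). Qed.

Lemma le_young_mod th a D : growth th a D -> {homo young_mod th : x y / x <= y}.
Proof.
move=> g [x| |] [y| |]//=; rewrite ?leey ?lee_fin ?leye_eq//.
- exact: (young_of_mono g).
- by rewrite (young_of_ge0 _ g).
Qed.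

Lemma pm_young_mod th a D f : growth th a D -> pmeas f ->
  pmeas (fun x => young_mod th (f x)).
Proof.
move=> g [mf f0]; split => [|x]; last exact: young_mod_ge0 g.
rewrite (_ : (fun x => _) =
  fun x => if f x < +oo then (young_of th (fine (f x)))%:E else +oo).
  apply: measurable_fun_ifT.
  - by apply: measurable_fun_lte => //; exact: measurable_cst.
  - apply/measurable_EFinP; apply: (@measurableT_comp _ _ _ _ _ _ (young_of th)).
      by apply: nondecreasing_measurable => // x y; exact: (young_of_mono g).
    by apply: measurableT_comp => //; exact: fine_measurable.
  - exact: measurable_cst.
apply/funext => x; case: (f x) (f0 x) => //= r _; first by rewrite ltry.
Qed.

Variable mu : {measure set T -> \bar R}.

Lemma intle f g : pmeas f -> pmeas g -> (forall x, f x <= g x) ->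
  \int[mu]_x f x <= \int[mu]_x g x.
Proof. by move=> [mf f0] [mg g0] h; apply: ge0_le_integral. Qed.

Lemma intge0 f : pmeas f -> 0 <= \int[mu]_x f x.
Proof. by move=> [mf f0]; apply: integral_ge0. Qed.

Lemma intD f g : pmeas f -> pmeas g ->
  \int[mu]_x (f x + g x) = \int[mu]_x f x + \int[mu]_x g x.
Proof. by move=> [mf f0] [mg g0]; rewrite ge0_integralD. Qed.

Lemma intZ c f : 0 <= c -> pmeas f -> \int[mu]_x (c * f x) = c * \int[mu]_x f x.
Proof. by move=> c0 [mf f0]; rewrite ge0_integralZl. Qed.

Lemma int_sum (I : Type) (s : seq I) (F : I -> T -> \bar R) :
  (forall i, pmeas (F i)) ->
  \int[mu]_x (\sum_(i <- s) F i x) = \sum_(i <- s) \int[mu]_x F i x.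
Proof. by move=> h; rewrite ge0_integral_sum// => i; [case: (h i)|move=> x _; case: (h i)]. Qed.

Lemma lim_einf_ge (u : (\bar R)^nat) c N : (forall n, (N <= n)%N -> c <= u n) ->
  c <= limn_einf u.
Proof.
move=> h; rewrite limn_einf_lim.
apply: (@lime_ge _ _ _ _ c); first exact: is_cvg_einfs.
near=> n; apply: le_ereal_inf_tmp => _ [k /= nk <-]; apply: h.
by apply: leq_trans nk; near: n; exists N.
Unshelve. all: by end_near. Qed.

(** Fatou's lemma along a sequence that may merely approach f from below, in
    the limit and not monotonically.  The factor 1/2 leaves room to pass to the
    limit without continuity of the modular: F_n exceeds f/2 eventually, but
    need not reach f. *)
Lemma fatou_young_mod th a D f (F : nat -> T -> \bar R) (c : \bar R) :
  growth th a D -> pmeas f -> (forall n, pmeas (F n)) ->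
  (forall x (t : R), t%:E < f x -> exists N, forall n, (N <= n)%N -> t%:E <= F n x) ->
  (forall n, \int[mu]_x young_mod th (F n x) <= c) ->
  \int[mu]_x young_mod th ((2^-1)%:E * f x) <= c.
Proof.
move=> g pf pF hF hc.
have pmF n := pm_young_mod g (pF n).
apply: (@le_trans _ _ (\int[mu]_x limn_einf (fun n => young_mod th (F n x)))).
  apply: ge0_le_integral => //.
  - by move=> x _; exact: young_mod_ge0 g.
  - have c0 : 0 <= (2^-1)%:E :> \bar R by rewrite lee_fin.
    by have [] := pm_young_mod g (pmM (pm_cst c0) pf).
  - rewrite (_ : (fun x => _) = fun x =>
        - limn_esup (-%E \o (fun n => young_mod th (F n x)))); last first.
      by apply/funext => x; rewrite limn_esupN oppeK.
    apply: measurableT_comp => //; apply: measurable_fun_limn_esup => n.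
    by apply: measurableT_comp => //; case: (pmF n).
  - move=> x _; have [fx|] := ltP 0 (f x); last first.
      move=> h; have -> : f x = 0 by apply/eqP; rewrite eq_le h; case: pf => _ ->.
      rewrite mule0 /= /young_of mul0r.
      by apply: (@lim_einf_ge _ _ 0) => n _; exact: young_mod_ge0 g.
    move: fx; case E : (f x) => [r| |]//; rewrite ?lte_fin => fx.
      have [|N hN] := hF x (2^-1 * r)%R; first by rewrite E lte_fin; lra.
      by apply: (@lim_einf_ge _ _ N) => n /hN; exact: (le_young_mod g).
    rewrite gt0_muley ?lte_fin//= leye_eq; apply/eqP/eqyP => M M0.
    have [t t0 ht] := growth_unbounded M g.
    have [|N hN] := hF x (Num.max t 1%R); first by rewrite E ltry.
    apply: (@lim_einf_ge _ _ N) => n /hN /(le_young_mod g); apply: le_trans.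
    rewrite lee_fin /young_of -[leLHS]mul1r; apply: ler_pM => //; first exact: ltW.
      by rewrite le_max lexx orbT.
    by apply: le_trans (ltW ht) _; apply: (growth_mono g); rewrite le_max lexx.
apply: le_trans (fatou _ _ _ _) _ => //; [by move=> n; case: (pmF n)|by move=> n x _; case: (pmF n)|].
rewrite limn_einf_lim; apply: lime_le; first exact: is_cvg_einfs.
apply: nearW => n; apply: le_trans (hc n); apply: ereal_inf_lbound; by exists n => /=.
Qed.

End pmeas_theory.

Section young_mod_more.
Context {R : realType}.
Implicit Types (th : R -> R) (a D : R).

Lemma young_modZ th a D (t : R) (x : \bar R) : growth th a D -> (0 <= t <= 1)%R ->
  young_mod th (t%:E * x) <= t%:E * young_mod th x.
Proof.
move=> g /andP[t0 t1]; case: x => [r| |]/=.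
- rewrite -EFinM lee_fin /young_of -mulrA; apply: ler_wpM2l => //.
  case: (lerP r 0) => r0.
    by rewrite !(growth_neg g) ?mulr0// mulr_ge0_le0.
  apply: ler_wpM2l; first exact: ltW.
  by apply: (growth_mono g); rewrite ler_piMl// ltW.
- move: t0; rewrite le_eqVlt => /predU1P[<-|t0].
    by rewrite !mul0e /= /young_of mul0r.
  by rewrite gt0_muley ?lte_fin//= gt0_muley ?lte_fin//.
- move: t0; rewrite le_eqVlt => /predU1P[<-|t0].
    by rewrite !mul0e /= /young_of mul0r.
  by rewrite gt0_muleNy ?lte_fin//= mule0.
Qed.

Lemma young_mod_doubling th a D n (x : \bar R) : growth th a D -> 0 <= x ->
  young_mod th ((2 ^+ n)%:E * x) <= ((2 * D) ^+ n)%:E * young_mod th x.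
Proof.
move=> g; have D0 : (0 < 2 * D)%R by rewrite mulr_gt0// (lt_trans _ (growth_D g)).
case: x => [r| |] x0 //.
- by rewrite -EFinM /= -EFinM lee_fin; exact: (young_of_deltaX _ _ g).
- by rewrite gt0_muley ?lte_fin ?exprn_gt0//= gt0_muley ?lte_fin ?exprn_gt0.
Qed.

(** The sum is at most twice the larger of the two terms. *)
Lemma young_modD th a D (x y : \bar R) : growth th a D -> 0 <= x -> 0 <= y ->
  young_mod th (x + y) <= young_mod th (2%:E * x) + young_mod th (2%:E * y).
Proof.
move=> g x0 y0.
have h z : 0 <= z -> z + z = 2%:E * z :> \bar R.
  by move=> z0; rewrite (_ : 2%:E = 1 + 1) ?ge0_muleDl ?mul1e// -EFinD.
case/orP: (le_total x y) => xy.
  apply: (@le_trans _ _ (young_mod th (2%:E * y))); last first.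
    by rewrite leeDr// (young_mod_ge0 _ g).
  by apply: (le_young_mod g); rewrite -h// leeD2r.
apply: (@le_trans _ _ (young_mod th (2%:E * x))); last first.
  by rewrite leeDl// (young_mod_ge0 _ g).
by apply: (le_young_mod g); rewrite -h// leeD2l.
Qed.

Lemma young_mod_dual th a D (K : R) (y z : \bar R) : growth th a D -> (0 < K)%R ->
  0 <= y -> 0 <= z ->
  y * z <= (K^-1)%:E * (young_mod (gdual th) z + young_mod th (K%:E * y)).
Proof.
move=> g K0; have gd := growth_dual g; have KV : 0 < (K^-1)%:E by rewrite lte_fin invr_gt0.
case: y => [y| |]// y0; case: z => [z| |]// z0.
- rewrite -!EFinM /= lee_fin; rewrite !lee_fin in y0 z0.
  by rewrite [leRHS]mulrC; exact: (gdual_young g).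
- have h : young_mod th (K%:E * y%:E) != -oo.
    by rewrite gt_eqF// (lt_le_trans _ (young_mod_ge0 _ g)).
  by rewrite addye// [X in _ <= X]gt0_muley// leey.
- have h : young_mod (gdual th) z%:E != -oo.
    by rewrite gt_eqF// (lt_le_trans _ (young_mod_ge0 _ gd)).
  by rewrite [K%:E * _]gt0_muley ?lte_fin//= addey// [X in _ <= X]gt0_muley// leey.
- by rewrite [K%:E * _]gt0_muley ?lte_fin// [young_mod th _]/= addey// [X in _ <= X]gt0_muley// leey.
Qed.

Lemma young_mod_gdual th a D (t : R) : growth th a D -> (0 <= t)%R ->
  young_mod (gdual th) (th t)%:E <= a%:E * young_mod th t%:E.
Proof. by move=> g t0 /=; rewrite -EFinM lee_fin; exact: (gdual_comp g t0). Qed.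

End young_mod_more.

(** * Grids and averages *)

(** Nested partitions of a space into cells of equal measure, [cell k x] being
    the cell of step k that contains x.  There is a coarsest step 0, since only
    finitely many scales are used at a time.  By [cell_gen] the unions of cells
    generate all measurable sets; that is what differentiation of integrals
    along the cells amounts to. *)
Record grid d (T : measurableType d) (R : realType)
    (mu : set T -> \bar R) (q : R) := Grid {
  cell :> nat -> T -> set T;
  vol : nat -> R;
  cell_refl : forall k x, cell k x x;
  cell_eq : forall k x y, cell k x y -> cell k x = cell k y;
  cell_nest : forall k x, cell k.+1 x `<=` cell k x;
  cell_meas : forall k, measurable [set p : T * T | cell k p.1 p.2];
  cell_vol : forall k x, mu (cell k x) = (vol k)%:E;
  vol_gt0 : forall k, (0 < vol k)%R;
  vol_step : forall k, vol k = (q * vol k.+1)%R;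
  cell_gen : @measurable _ T `<=` <<s [set A : set T | measurable A /\
    exists k, forall x y, cell k x y -> A x -> A y] >> }.

Section grid_theory.
Context {d} {T : measurableType d} {R : realType}.
Variable mu : {sigma_finite_measure set T -> \bar R}.
Context {q : R} (G : grid mu q).
Hypothesis q2 : (2 <= q)%R.
Implicit Types (u F : T -> \bar R) (k j l : nat).

Definition inv_at {U : Type} k (u : T -> U) := forall x y, G k x y -> u x = u y.

Lemma cell_sym k x y : G k x y -> G k y x.
Proof. by move=> /cell_eq <-; exact: cell_refl. Qed.

Lemma cell_indicC k x y : \1_(G k x) y = \1_(G k y) x :> R.
Proof.
rewrite !indicE; congr (_%:R); congr nat_of_bool.
by apply/idP/idP; rewrite !inE; exact: cell_sym.
Qed.

Lemma cell_le k j x : (k <= j)%N -> G j x `<=` G k x.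
Proof.
move=> kj; rewrite -(subnKC kj); elim: (j - k)%N => [|i ih]; first by rewrite addn0.
by rewrite addnS => y /cell_nest /ih.
Qed.

Lemma inv_at_le (U : Type) k j (u : T -> U) : (k <= j)%N -> inv_at k u -> inv_at j u.
Proof. by move=> kj h x y /(cell_le kj) /h. Qed.

Lemma measurable_cell k x : measurable (G k x).
Proof.
rewrite (_ : G k x = xsection [set p | G k p.1 p.2] x).
  exact: measurable_xsection (cell_meas G k).
by apply/seteqP; split => y; rewrite /xsection/= inE.
Qed.

Definition cellind k x y : \bar R := (\1_(G k x) y)%:E.

Lemma cellindC k x y : cellind k x y = cellind k y x.
Proof. by rewrite /cellind cell_indicC. Qed.

Lemma cellind1 k x y : G k x y -> cellind k x y = 1.
Proof. by move=> h; rewrite /cellind indicE mem_set. Qed.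

Lemma cellind0 k x y : ~ G k x y -> cellind k x y = 0.
Proof. by move=> h; rewrite /cellind indicE memNset. Qed.

Lemma pm_cellind2 k : pmeas (fun p : T * T => cellind k p.1 p.2).
Proof.
rewrite (_ : (fun _ => _) = fun p => (\1_[set p | G k p.1 p.2] p)%:E).
  exact: pm_indic (cell_meas G k).
apply/funext => -[x y] /=; rewrite /cellind !indicE/=; congr (_%:R%:E).
Qed.

Lemma pm_cellind k x : pmeas (cellind k x).
Proof. exact: pm_indic (measurable_cell k x). Qed.

Lemma pm_snd F : pmeas F -> pmeas (fun p : T * T => F p.2).
Proof. by move=> [mF F0]; split => // ; exact: measurableT_comp. Qed.

Definition avg k F x : \bar R :=
  ((vol G k)^-1)%:E * \int[mu]_y (cellind k x y * F y).

Lemma avgE k F x : avg k F x =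
  ((vol G k)^-1)%:E * \int[mu]_y (cellind k x y * F y).
Proof. by []. Qed.

Lemma volV_ge0 k : 0 <= ((vol G k)^-1)%:E :> \bar R.
Proof. by rewrite lee_fin invr_ge0 ltW// vol_gt0. Qed.

Lemma pm_avg k F : pmeas F -> pmeas (avg k F).
Proof.
move=> pF; apply: pmM; first exact: pm_cst (volV_ge0 k).
have [mK K0] := pmM (pm_cellind2 k) (pm_snd pF).
split; first exact: (measurable_fun_fubini_tonelli_F _ mK K0).
by move=> x; apply: intge0; apply: pmM => //; exact: pm_cellind.
Qed.

Lemma avg_inv k F : inv_at k (avg k F).
Proof. by move=> x y /cell_eq xy; rewrite /avg /cellind xy. Qed.

Lemma inv_cellind k u x y : inv_at k u -> u x * cellind k x y = cellind k x y * u y.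
Proof.
move=> h; have [xy|xy] := pselect (G k x y).
  by rewrite (h _ _ xy) muleC.
by rewrite cellind0// mule0 mul0e.
Qed.

Lemma int_cellind k x : \int[mu]_y cellind k x y = (vol G k)%:E.
Proof.
rewrite /cellind integral_indic//; last exact: measurable_cell.
by rewrite setIT cell_vol.
Qed.

Lemma volVM k (z : \bar R) : ((vol G k)^-1)%:E * ((vol G k)%:E * z) = z.
Proof. by rewrite muleA -EFinM mulVf ?mul1e// gt_eqF// vol_gt0. Qed.

Lemma avgM k u F x : pmeas u -> pmeas F -> inv_at k u ->
  avg k (fun y => u y * F y) x = u x * avg k F x.
Proof.
move=> pu pF iu; rewrite /avg muleCA; congr (_ * _).
rewrite -intZ; [|by case: pu|by apply: pmM => //; exact: pm_cellind].
by apply: eq_integral => y _; rewrite [LHS]muleA -(inv_cellind x y iu) muleA.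
Qed.

Lemma avg_cst k (c : \bar R) x : 0 <= c -> avg k (fun=> c) x = c.
Proof.
move=> c0; rewrite /avg -[RHS](volVM k); congr (_ * _).
rewrite muleC -(int_cellind k x) -intZ//; last exact: pm_cellind.
by apply: eq_integral => y _; rewrite muleC.
Qed.

Lemma avg_id k u x : pmeas u -> inv_at k u -> avg k u x = u x.
Proof.
move=> pu iu; rewrite -[RHS]mule1 -(@avg_cst k 1 x)//.
by rewrite -avgM//; congr (avg k _ x); apply/funext => y; rewrite mule1.
Qed.

Lemma le_avg k F F' x : pmeas F -> pmeas F' -> (forall y, F y <= F' y) ->
  avg k F x <= avg k F' x.
Proof.
move=> pF pF' h; apply: lee_wpmul2l; first exact: volV_ge0.
apply: intle; [by apply: pmM => //; exact: pm_cellind..|].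
by move=> y; apply: lee_wpmul2l => //; case: (pm_cellind k x).
Qed.

Lemma le_avg_cell k F F' x : pmeas F -> pmeas F' ->
  (forall y, G k x y -> F y <= F' y) -> avg k F x <= avg k F' x.
Proof.
move=> pF pF' h; apply: lee_wpmul2l; first exact: volV_ge0.
apply: intle; [by apply: pmM => //; exact: pm_cellind..|].
move=> y; have [xy|xy] := pselect (G k x y); first by rewrite cellind1// !mul1e h.
by rewrite cellind0// !mul0e.
Qed.

Lemma avgD k F F' x : pmeas F -> pmeas F' ->
  avg k (fun y => F y + F' y) x = avg k F x + avg k F' x.
Proof.
move=> pF pF'; rewrite /avg -ge0_muleDr; last 2 first.
- by apply: intge0; apply: pmM => //; exact: pm_cellind.
- by apply: intge0; apply: pmM => //; exact: pm_cellind.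
rewrite -intD; [|by apply: pmM => //; exact: pm_cellind..].
congr (_ * _); apply: eq_integral => y _.
by rewrite ge0_muleDr//; [case: pF|case: pF'].
Qed.

Lemma avgZ k c F x : 0 <= c -> pmeas F -> avg k (fun y => c * F y) x = c * avg k F x.
Proof. by move=> c0 pF; rewrite avgM//; exact: pm_cst. Qed.

Lemma avg_step k F x : pmeas F -> avg k.+1 F x <= q%:E * avg k F x.
Proof.
move=> pF; rewrite /avg muleA -EFinM (vol_step G k).
have q0 : (q != 0)%R by apply/eqP => q0; move: q2; rewrite q0; lra.
rewrite invfM mulrA divff// mul1r; apply: lee_wpmul2l; first exact: volV_ge0.
apply: intle; [by apply: pmM => //; exact: pm_cellind..|].
move=> y; apply: lee_wpmul2r; first by case: pF.
have [xy|xy] := pselect (G k.+1 x y); last by rewrite [leLHS]cellind0//; case: (pm_cellind k x).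
by rewrite !cellind1//; exact: cell_nest.
Qed.

(** Averaging is self-adjoint and fixes functions constant on cells; the
    proof is Tonelli's theorem for the indicator of pairs in a common cell. *)
Lemma avg_int k u F : pmeas u -> pmeas F -> inv_at k u ->
  \int[mu]_x (u x * avg k F x) = \int[mu]_x (u x * F x).
Proof.
move=> pu pF iu.
have pK := pmM (pmM (pm_cellind2 k) (pm_snd pu)) (pm_snd pF).
transitivity (((vol G k)^-1)%:E *
    \int[mu]_x \int[mu]_y (cellind k x y * u y * F y)).
  rewrite -intZ; last 2 first.
  - exact: volV_ge0.
  - split; first exact: (measurable_fun_fubini_tonelli_F _ pK.1 pK.2).
    move=> x; apply: intge0; apply: pmM => //; apply: pmM => //; exact: pm_cellind.
  apply: eq_integral => x _; rewrite -avgM// /avg; congr (_ * _).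
  by apply: eq_integral => y _; rewrite muleA.
rewrite (fubini_tonelli _ pK.1 pK.2)/=.
transitivity (((vol G k)^-1)%:E * \int[mu]_y ((vol G k)%:E * (u y * F y))).
  congr (_ * _); apply: eq_integral => y _.
  rewrite -(int_cellind k y) muleC -intZ; last 2 first.
  - by apply: mule_ge0; [case: pu|case: pF].
  - exact: pm_cellind.
  by apply: eq_integral => x _; rewrite -muleA cellindC muleC.
by rewrite intZ; [rewrite volVM|rewrite lee_fin ltW// vol_gt0|exact: pmM].
Qed.

Lemma avg_int1 k F : pmeas F -> \int[mu]_x avg k F x = \int[mu]_x F x.
Proof.
move=> pF; have := @avg_int k (fun=> 1) F (pm_cst lee01) pF (fun _ _ _ => erefl).
by under eq_integral do rewrite mul1e; under [in X in _ = X -> _]eq_integral do rewrite mul1e.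
Qed.

Lemma avg_le_int k F x : pmeas F ->
  avg k F x <= ((vol G k)^-1)%:E * \int[mu]_y F y.
Proof.
move=> pF; apply: lee_wpmul2l; first exact: volV_ge0.
apply: intle => //; first by apply: pmM => //; exact: pm_cellind.
move=> y; rewrite -[leRHS]mul1e; apply: lee_wpmul2r; first by case: pF.
by rewrite /cellind lee_fin indicE; case: (_ \in _).
Qed.

Definition maxavg F x := ereal_sup (range (fun k => avg k F x)).
Definition pmaxavg m F x := \big[maxe/0]_(k < m) avg k F x.

Lemma maxavgE F x : maxavg F x = ereal_sup (range (fun k => avg k F x)).
Proof. by []. Qed.

Lemma pm_maxavg F : pmeas F -> pmeas (maxavg F).
Proof. by move=> pF; apply: pm_esup => k; exact: pm_avg. Qed.

Lemma pm_pmaxavg m F : pmeas F -> pmeas (pmaxavg m F).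
Proof. by move=> pF; apply: pm_bigmax => k; exact: pm_avg. Qed.

Lemma avg_le_max k F x : avg k F x <= maxavg F x.
Proof. by apply: ereal_sup_ubound; exists k. Qed.

Lemma avg_le_pmax k m F x : (k < m)%N -> avg k F x <= pmaxavg m F x.
Proof. by move=> km; exact: (le_bigmax _ (fun k : 'I_m => avg k F x) (Ordinal km)). Qed.

Lemma maxavg_le F x z : (forall k, avg k F x <= z) -> maxavg F x <= z.
Proof. by move=> h; apply: ge_ereal_sup => _ [k _ <-]. Qed.

Lemma pmaxavg_le m F x z : 0 <= z -> (forall k, (k < m)%N -> avg k F x <= z) ->
  pmaxavg m F x <= z.
Proof. by move=> z0 h; apply: bigmax_le => // k _; exact: h. Qed.

Lemma pmax_le_max m F x : pmeas F -> pmaxavg m F x <= maxavg F x.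
Proof.
move=> pF; apply: pmaxavg_le; first by case: (pm_maxavg pF).
by move=> k _; exact: avg_le_max.
Qed.

Lemma pmax_gtP m F x c : 0 <= c -> c < pmaxavg m F x -> exists2 k, (k < m)%N & c < avg k F x.
Proof.
move=> c0; apply: contraPP => h; apply/negP; rewrite -leNgt.
apply: bigmax_le => // k _; rewrite leNgt; apply/negP => h2; apply: h; by exists k.
Qed.

Lemma max_gtP F x c : c < maxavg F x -> exists k, c < avg k F x.
Proof. by move/ereal_sup_gt => -[_ [k _ <-] h]; exists k. Qed.

Lemma pmax_inv m F : inv_at m (pmaxavg m F).
Proof.
move=> x y xy; apply: eq_bigr => k _; apply: (avg_inv (k := k)).
by apply: cell_le xy; exact: ltnW.
Qed.

End grid_theory.

(** * The dyadic maximal theorem *)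

Section first_hit.
Context {d} {T : measurableType d} {R : realType}.
Implicit Types p : nat -> T -> bool.

Definition b2e (b : bool) : \bar R := if b then 1 else 0.

Lemma has_iotaS (p : pred nat) m : has p (iota 0 m.+1) = has p (iota 0 m) || p m.
Proof. by rewrite -addn1 iotaD has_cat/= orbF add0n. Qed.

Definition fhit p l x : bool := p l x && ~~ has (p ^~ x) (iota 0 l).

Lemma b2e_ge0 b : 0 <= b2e b. Proof. by case: b. Qed.

Lemma measurable_has p m : (forall l, measurable_fun setT (p l)) ->
  measurable_fun setT (fun x => has (p ^~ x) (iota 0 m)).
Proof.
move=> mp; elim: m => [|m ih]; first exact: measurable_cst.
rewrite (_ : (fun x => _) = fun x => has (p ^~ x) (iota 0 m) || p m x).
  exact: measurable_or.
by apply/funext => x; rewrite has_iotaS.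
Qed.

Lemma measurable_fhit p l : (forall l, measurable_fun setT (p l)) ->
  measurable_fun setT (fhit p l).
Proof.
move=> mp; apply: measurable_and => //; apply: measurable_neg.
exact: measurable_has.
Qed.

Lemma pm_b2e (b : T -> bool) : measurable_fun setT b -> pmeas (fun x => b2e (b x)).
Proof. by move=> mb; apply: pm_if => //; exact: pm_cst. Qed.

Lemma sum_fhit p m x :
  \sum_(l < m) b2e (fhit p l x) = b2e (has (p ^~ x) (iota 0 m)).
Proof.
elim: m => [|m ih]; first by rewrite big_ord0.
rewrite has_iotaS big_ord_recr ih /= /fhit.
by case: has; case: (p m x) => //=; rewrite ?adde0 ?add0e.
Qed.

End first_hit.
Arguments b2e {R} b.

Section weak_type.
Context {d} {T : measurableType d} {R : realType}.
Variable mu : {sigma_finite_measure set T -> \bar R}.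
Context {q : R} (G : grid mu q).
Hypothesis q2 : (2 <= q)%R.
Implicit Types (u F : T -> \bar R) (k j l : nat).

Lemma pmaxavg_has m F x (c : \bar R) : 0 <= c ->
  (c < pmaxavg G m F x) = has (fun l => c < avg G l F x) (iota 0 m).
Proof.
move=> c0; apply/idP/hasP.
  by move=> /pmax_gtP[]// k km ck; exists k => //; rewrite mem_iota.
move=> [k]; rewrite mem_iota add0n => /andP[_ km] h.
exact: lt_le_trans h (avg_le_pmax _ _ _ km).
Qed.

(** Split the level set according to the first k at which the average exceeds
    c.  Each piece is a union of cells of step k, so the integral of F over it
    is that of the average of F, which is larger than c there. *)
Lemma weak_type1 m F (c : \bar R) : pmeas F -> 0 <= c ->
  c * \int[mu]_x b2e (c < pmaxavg G m F x) <= \int[mu]_x F x.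
Proof.
move=> pF c0.
pose p l x := c < avg G l F x.
have mp l : measurable_fun setT (p l).
  apply: measurable_fun_lte; first exact: measurable_cst.
  by case: (pm_avg G l pF).
have pfh l : pmeas (fun x => b2e (fhit p l x) : \bar R).
  exact: pm_b2e (measurable_fhit _ mp).
under eq_integral do rewrite pmaxavg_has// -(sum_fhit (R := R) p).
rewrite int_sum//.
rewrite ge0_sume_distrr; last by move=> l _; exact: intge0.
apply: (@le_trans _ _ (\sum_(l < m) \int[mu]_x (b2e (fhit p l x) * F x))).
  apply: lee_sum => l _; rewrite -intZ//.
  rewrite -(avg_int (G := G) (k := l))//; last first.
    move=> x y xy; rewrite /fhit /p (avg_inv F xy); congr (b2e (_ && ~~ _)).
    apply: eq_in_has => i; rewrite mem_iota add0n => /andP[_ il].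
    by rewrite (avg_inv F (cell_le (ltnW il) xy)).
  apply: intle.
  - by apply: pmM => //; exact: pm_cst.
  - by apply: pmM => //; exact: pm_avg.
  move=> x; rewrite /b2e; case: ifPn => [/andP[h _]|_]; last by rewrite mule0 mul0e.
  by rewrite mule1 mul1e ltW.
rewrite -int_sum; last by move=> l; apply: pmM.
apply: intle => //; first by apply: pm_sum => l; apply: pmM.
move=> x; rewrite -ge0_sume_distrl; last by move=> l _; exact: b2e_ge0.
rewrite sum_fhit -[leRHS]mul1e; apply: lee_wpmul2r; first by case: pF.
by rewrite /b2e; case: ifP.
Qed.

Lemma measurable_lt_cst F (c : \bar R) : pmeas F -> measurable_fun setT (fun x => c < F x).
Proof.
by move=> [mF _]; apply: measurable_fun_lte => //; exact: measurable_cst.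
Qed.

(** Only the part of F above c counts, since the rest contributes at most c to
    each average. *)
Lemma weak_type2 m F (c : R) : pmeas F -> (0 <= c)%R ->
  c%:E * \int[mu]_x b2e ((2 * c)%:E < pmaxavg G m F x) <=
  \int[mu]_x (b2e (c%:E < F x) * F x).
Proof.
move=> pF c0; have c0' : 0 <= c%:E by rewrite lee_fin.
have pF' : pmeas (fun x => b2e (c%:E < F x) * F x).
  by apply: pmM => //; apply: pm_b2e; exact: measurable_lt_cst.
apply: le_trans (weak_type1 m pF' c0'); apply: lee_wpmul2l => //.
apply: intle.
- by apply: pm_b2e; apply: measurable_lt_cst; exact: pm_pmaxavg.
- by apply: pm_b2e; apply: measurable_lt_cst; exact: pm_pmaxavg.
move=> x; rewrite {1}/b2e; case: ifPn => [|_]; last exact: b2e_ge0.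
move=> /pmax_gtP[|k km h]; first by rewrite lee_fin mulr_ge0.
rewrite (_ : _ < _ = true)//; apply: lt_le_trans (avg_le_pmax _ _ _ km).
have pc := @pm_cst _ T _ _ c0'.
have : avg G k F x <= avg G k (fun x => b2e (c%:E < F x) * F x) x + c%:E.
  rewrite -[X in _ <= _ + X](avg_cst G k x c0') -avgD//; apply: le_avg => //.
    exact: pmD.
  move=> y; rewrite /b2e; case: ltP => h2; rewrite ?mul1e ?mul0e ?add0e//.
  by rewrite leeDl.
move=> /(lt_le_trans h); rewrite (_ : (2 * c)%:E = c%:E + c%:E); last first.
  by rewrite -EFinD; congr EFin; lra.
by rewrite lteD2rE.
Qed.

(** The maximal theorem for modulars.  The modular of M F is majorized by a step
    function with steps at the levels c_j = a^j, and the weak-type inequality at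
    level c_j controls the j-th step; by nabla_2 the sum over the levels below
    F(x) is geometric. *)
Lemma max_modular th a D F : growth th a D -> pmeas F ->
  \int[mu]_x young_mod th ((2^-1)%:E * ((2^-1)%:E * maxavg G F x)) <=
  2%:E * \int[mu]_x young_mod th (a%:E * F x).
Proof.
move=> g pF; have a1 := growth_a g.
have a0 : (0 < a)%R by exact: lt_trans a1.
have h0 : 0 <= (2^-1)%:E :> \bar R by rewrite lee_fin.
have ph := @pm_cst _ T _ _ h0.
(* For each n only the levels between a^-(n+1) and a^(n+1) are used; F_ n is
   the maximal function cut off to this range. *)
pose c n j : R := (a ^+ j / a ^+ n.+1)%R.
have c0 n j : (0 < c n j)%R by rewrite divr_gt0// exprn_gt0.
have cS n j : (c n j.+1 = a * c n j)%R by rewrite /c exprS mulrA.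
have an0 n : 0 <= (a ^+ n.+1)%:E by rewrite lee_fin exprn_ge0// ltW.
pose F_ n x : \bar R := if (2 * c n 0%N)%:E < pmaxavg G n F x then
  mine ((2^-1)%:E * pmaxavg G n F x) (a ^+ n.+1)%:E else 0.
have pF_ n : pmeas (F_ n).
  have pp := pm_pmaxavg G n pF.
  apply: pm_if; [exact: measurable_lt_cst| |exact: pm_cst].
  by apply: pm_min; [exact: pmM|exact: pm_cst].
apply: (fatou_young_mod (F := F_) g) => //.
- by apply: pmM => //; exact: pm_maxavg.
- move=> x t; case: (ltrP t 0) => t0 ht.
    exists 0%N => n _; apply: (@le_trans _ _ 0); first by rewrite lee_fin ltW.
    by case: (pF_ n).
  have : (2 * t)%:E < maxavg G F x.
    rewrite -(@lte_pmul2l _ (2^-1)%:E) ?lte_fin ?invr_gt0//.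
    by rewrite -EFinM mulrA mulVf// mul1r.
  move=> /max_gtP [k hk].
  have [e e0 he] : exists2 e : R, (0 < e)%R & (2 * e)%:E < avg G k F x.
    case E : (avg G k F x) hk => [r| |]// hk; last by exists 1%R => //; rewrite ltry.
    rewrite lte_fin in hk; have [h1 h2] := quarter_lt t0 hk.
    by exists (r / 4)%R; rewrite ?lte_fin.
  have [N1 hN1] := expr_unbounded (e^-1) a1.
  have [N2 hN2] := expr_unbounded t a1.
  exists (maxn k.+1 (maxn N1 N2)) => n; rewrite !geq_max => /and3P[kn n1 n2].
  have pk : avg G k F x <= pmaxavg G n F x by exact: avg_le_pmax.
  have -> : F_ n x = mine ((2^-1)%:E * pmaxavg G n F x) (a ^+ n.+1)%:E.
    rewrite /F_ ifT//; apply: lt_le_trans pk; apply: le_lt_trans he.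
    rewrite lee_fin ler_pM2l// /c expr0 mul1r -[leRHS]invrK lef_pV2 ?posrE ?exprn_gt0 ?invr_gt0//.
    by apply: ltW; apply: hN1; exact: leqW.
  rewrite le_min; apply/andP; split.
    apply: le_trans (lee_wpmul2l h0 (ltW (lt_le_trans hk pk))).
    by rewrite -EFinM mulrA mulVf// mul1r.
  by rewrite lee_fin ltW// hN2// leqW.
move=> n.
pose S x := \sum_(j < n.+1 + n.+1) (a * th (c n j.+1))%:E *
     ((c n j)%:E * b2e ((2 * c n j)%:E < pmaxavg G n F x)).
have pb j : pmeas (fun x => b2e ((2 * c n j)%:E < pmaxavg G n F x) : \bar R).
  by apply: pm_b2e; apply: measurable_lt_cst; exact: pm_pmaxavg.
have cc j : 0 <= (c n j)%:E by rewrite lee_fin ltW.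
have ct j : 0 <= (a * th (c n j.+1))%:E.
  by rewrite lee_fin mulr_ge0 ?(growth_ge0 _ g)// ltW.
have pcb j : pmeas (fun x => (c n j)%:E * b2e ((2 * c n j)%:E < pmaxavg G n F x)).
  by apply: pmM => //; exact: pm_cst.
have pS1 j : pmeas (fun x => (a * th (c n j.+1))%:E *
     ((c n j)%:E * b2e ((2 * c n j)%:E < pmaxavg G n F x))).
  by apply: pmM => //; exact: pm_cst.
have pS : pmeas S by apply: pm_sum => j; exact: pS1.
apply: (@le_trans _ _ (\int[mu]_x S x)).
  apply: intle => //; first exact: pm_young_mod g _.
  move=> x; rewrite /F_; case: ifPn => [h|_]; last first.
    by rewrite /= /young_of mul0r; case: pS.
  have [t tE] : exists t : R,
      mine ((2^-1)%:E * pmaxavg G n F x) (a ^+ n.+1)%:E = t%:E.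
    case: (pmaxavg G n F x) h => [r _| _|//].
      by rewrite -EFinM -EFin_min; eexists.
    by rewrite gt0_muley ?lte_fin// min_r ?leey//; eexists.
  have tc : (c n 0%N < t)%R.
    rewrite -lte_fin -tE lt_min; apply/andP; split.
      rewrite -(@lte_pmul2l _ 2%:E) ?lte_fin// -EFinM.
      by rewrite muleA -EFinM divff// mul1e.
    rewrite lte_fin /c expr0 mul1r; apply: (@lt_trans _ _ 1%R).
      by rewrite invf_lt1 ?exprn_gt0// exprn_egt1.
    by rewrite exprn_egt1.
  have tm : (t <= c n (n.+1 + n.+1))%R.
    rewrite -lee_fin -tE /c exprD mulfK ?gt_eqF ?exprn_gt0//.
    by rewrite ge_min lexx orbT.
  have [j jm /andP[tj1 tj2]] := geometric_bracket tc tm.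
  rewrite tE /S (bigD1 (Ordinal jm))//=.
  apply: (@le_trans _ _ ((a * th (c n j.+1))%:E *
     ((c n j)%:E * b2e ((2 * c n j)%:E < pmaxavg G n F x)))); last first.
    rewrite leeDl// sume_ge0// => i _; by case: (pS1 i).
  rewrite /b2e ifT; last first.
    rewrite -(@lte_pmul2l _ (2^-1)%:E) ?lte_fin ?invr_gt0//.
    rewrite -EFinM mulrA mulVf// mul1r.
    apply: (@lt_le_trans _ _ t%:E); first by rewrite lte_fin.
    by rewrite -tE ge_min lexx.
  rewrite mule1 -EFinM lee_fin.
  rewrite (_ : _ * _ * _ = young_of th (c n j.+1))%R; first exact: (young_of_mono g).
  by rewrite /young_of {2}cS; ring.
rewrite /S int_sum//.
apply: (@le_trans _ _ (\sum_(j < n.+1 + n.+1) (a * th (c n j.+1))%:E *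
    \int[mu]_x (b2e ((c n j)%:E < F x) * F x))).
  apply: lee_sum => j _; rewrite intZ//; apply: lee_wpmul2l => //.
  by rewrite intZ//; apply: weak_type2 => //; exact: ltW.
have pf j : pmeas (fun x => b2e ((c n j)%:E < F x) * F x).
  by apply: pmM => //; apply: pm_b2e; exact: measurable_lt_cst.
under eq_bigr => j _ do rewrite -intZ//.
rewrite -int_sum; last by move=> j; apply: pmM => //; exact: pm_cst.
have paF : pmeas (fun x => a%:E * F x).
  by apply: pmM => //; apply: pm_cst; rewrite lee_fin ltW.
rewrite -intZ//; last exact: pm_young_mod g _.
apply: intle.
- by apply: pm_sum => j; apply: pmM => //; exact: pm_cst.
- by apply: pmM; [exact: pm_cst|exact: pm_young_mod g _].
move=> x; case E : (F x) => [r| |]/=.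
- rewrite /young_of -!EFinM.
  under eq_bigr => j _.
    rewrite (_ : _ * _ = (a * r * (th (c n j.+1) * (c n j < r)%R%:R))%:E); last first.
      rewrite lte_fin /b2e; case: ifP => _; rewrite ?mul1e ?mul0e ?mule0 ?mulr0 ?mulr1//.
      by rewrite -EFinM; congr EFin; ring.
    over.
  rewrite sumEFin lee_fin -mulr_sumr.
  have r0 : (0 <= r)%R by rewrite -lee_fin -E; case: pF.
  rewrite [leRHS]mulrCA; apply: ler_wpM2l; first by rewrite mulr_ge0// ltW.
  exact: sum_growth_le g _ _.
- by rewrite gt0_muley ?lte_fin//= gt0_muley ?lte_fin//= leey.
- by case: pF => _ /(_ x); rewrite E.
Qed.

End weak_type.

(** * A weak density theorem *)

Section density.
Context {d} {T : measurableType d} {R : realType}.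
Variable mu : {sigma_finite_measure set T -> \bar R}.
Context {q : R} (G : grid mu q).
Hypothesis q2 : (2 <= q)%R.
Implicit Types (A B Q E : set T) (F : T -> \bar R) (k j l : nat).

Definition symdiff A B := (A `\` B) `|` (B `\` A).

Lemma measurable_symdiff A B : measurable A -> measurable B -> measurable (symdiff A B).
Proof. by move=> mA mB; apply: measurableU; exact: measurableD. Qed.

Definition approximable Q A := forall e : R, (0 < e)%R ->
  exists k B, [/\ measurable B, inv_at G k B & mu (Q `&` symdiff A B) <= e%:E].

Lemma measure_cover2 A B C : measurable A -> measurable B -> measurable C ->
  A `<=` B `|` C -> mu A <= mu B + mu C.
Proof.
move=> mA mB mC s; apply: (le_trans _ (measureU2 mu mB mC)).
by apply: le_measure => //; rewrite inE//; exact: measurableU.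
Qed.

Lemma approximableU Q A1 A2 : measurable Q -> measurable A1 -> measurable A2 ->
  approximable Q A1 -> approximable Q A2 -> approximable Q (A1 `|` A2).
Proof.
move=> mQ m1 m2 h1 h2 e e0.
have e20 : (0 < e / 2)%R by rewrite divr_gt0.
have [k1 [B1 [mB1 i1 d1]]] := h1 _ e20.
have [k2 [B2 [mB2 i2 d2]]] := h2 _ e20.
exists (maxn k1 k2), (B1 `|` B2); split; first exact: measurableU.
  move=> x y xy.
  have E1 := inv_at_le (leq_maxl k1 k2) i1 xy.
  have E2 := inv_at_le (leq_maxr k1 k2) i2 xy.
  by rewrite /setU /mkset E1 E2.
apply: (@le_trans _ _ ((e / 2)%:E + (e / 2)%:E)); last by rewrite -EFinD lee_fin -splitr.
apply: le_trans (leeD d1 d2); apply: measure_cover2.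
- by apply: measurableI => //; apply: measurable_symdiff; exact: measurableU.
- by apply: measurableI => //; exact: measurable_symdiff.
- by apply: measurableI => //; exact: measurable_symdiff.
move=> x [Qx [[[?|?] /not_orP[? ?]]|[[?|?] /not_orP[? ?]]]].
- by left; split => //; left.
- by right; split => //; left.
- by left; split => //; right.
- by right; split => //; right.
Qed.

Lemma approximable0 Q : approximable Q set0.
Proof.
move=> e e0; exists 0%N, set0; split => //.
by rewrite /symdiff setD0 setU0 setI0 measure0 lee_fin ltW.
Qed.

Lemma approximable_bigcup Q (A : (set T)^nat) : measurable Q -> mu Q < +oo ->
  (forall n, measurable (A n)) -> (forall n, approximable Q (A n)) ->
  approximable Q (\bigcup_n A n).
Proof.
move=> mQ Qoo mA hA e e0.
have e20 : (0 < e / 2)%R by rewrite divr_gt0.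
pose U m := \big[setU/set0]_(i < m) A i.
have mU m : measurable (U m) by apply: bigsetU_measurable => i _.
have aU m : approximable Q (U m).
  elim: m => [|m ih]; first by rewrite /U big_ord0; exact: approximable0.
  by rewrite /U big_ord_recr/=; exact: (approximableU mQ (mU m) (mA m) ih (hA m)).
pose C m := Q `&` (\bigcup_n A n `\` U m).
have mC m : measurable (C m).
  by apply: measurableI => //; apply: measurableD => //; exact: bigcup_measurable.
have C0 : \bigcap_m C m = set0.
  apply/seteqP; split => // x h; have [_ [[n _ An] _]] := h 0%N I.
  have [_ [_]] := h n.+1 I; apply.
  by rewrite /U big_ord_recr/=; right.
have cv : mu (C n) @[n --> \oo] --> mu (\bigcap_m C m).
  apply: nonincreasing_cvg_mu => //.
  - apply: le_lt_trans Qoo; apply: le_measure; rewrite ?inE//; exact: subIsetl.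
  - by rewrite C0.
  - apply/nonincreasing_seqP => n; apply/subsetPset => x [Qx [Ax Ux]].
    split => //; split => // h; apply: Ux.
    by rewrite /U big_ord_recr/=; left.
rewrite C0 measure0 in cv.
have [m hm] : exists m, mu (C m) <= (e / 2)%:E.
  move/fine_cvgP : cv => [fc /cvgrPdist_le /(_ _ e20) cv].
  near \oo => m; exists m.
  have h1 : mu (C m) \is a fin_num by near: m.
  have : (`|0 - fine (mu (C m))| <= e / 2)%R by near: m.
  rewrite sub0r normrN ger0_norm ?fine_ge0// => h2.
  by rewrite -(fineK h1) lee_fin.
have [k [B [mB iB dB]]] := aU m _ e20.
exists k, B; split => //.
apply: (@le_trans _ _ ((e / 2)%:E + (e / 2)%:E)); last by rewrite -EFinD lee_fin -splitr.
apply: le_trans (leeD hm dB); apply: measure_cover2 => //.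
- by apply: measurableI => //; apply: measurable_symdiff => //; exact: bigcup_measurable.
- by apply: measurableI => //; exact: measurable_symdiff.
move=> x [Qx [[Ax Bx]|[Bx Ax]]].
- have [Ux|Ux] := pselect (U m x); last by left.
  by right; split => //; left.
- right; split => //; right; split => // Ux; apply: Ax; move: Ux.
  by rewrite /U -bigcup_mkord => -[n _ An]; exists n.
Unshelve. all: by end_near. Qed.

(** The approximable sets form a sigma-algebra, and it contains the unions of
    cells. *)
Lemma approximable_measurable Q A : measurable Q -> mu Q < +oo -> measurable A ->
  approximable Q A.
Proof.
move=> mQ Qoo mA.
suff [] : [set A | measurable A /\ approximable Q A] A by [].
move: A mA; apply: (subset_trans (cell_gen (g := G))).
apply: smallest_sub.
- split.
  + by split => //; exact: approximable0.
  + move=> A [mA hA]; rewrite setTD; split; first exact: measurableC.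
    move=> e /hA[k [B [mB iB dB]]]; exists k, (~` B); split.
    * exact: measurableC.
    * by move=> x y /iB; rewrite /setC /mkset => ->.
    * rewrite (_ : symdiff _ _ = symdiff A B)//.
      rewrite /symdiff !setDE !setCK [in RHS]setUC.
      by rewrite [B `&` _]setIC [A `&` ~` B]setIC.
  + move=> A hA; split; first by apply: bigcup_measurable => n _; case: (hA n).
    by apply: approximable_bigcup => // n; case: (hA n).
- move=> A [mA [k hk]]; split => // e e0; exists k, A; split => //.
    move=> x y xy; apply/propext; split; first exact: hk.
    by apply: hk; exact: (cell_sym xy).
  by rewrite /symdiff setDv setU0 setI0 measure0 lee_fin ltW.
Qed.

Lemma indicMI A B y : (\1_A y)%:E * (\1_B y)%:E = (\1_(A `&` B) y)%:E :> \bar R.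
Proof. by rewrite indicI EFinM. Qed.

(** Approximate E by a union B of cells: E fills at most half of B, yet
    nearly all of it. *)
Lemma sparse_null E : measurable E ->
  (forall k x, E x -> avg G k (fun y => (\1_E y)%:E) x <= (2^-1)%:E) -> mu E = 0.
Proof.
move=> mE hE.
have pE := @pm_indic _ T R _ mE.
suff h x0 : mu (E `&` G 0%N x0) = 0.
  have := @avg_int1 _ _ _ mu _ G 0%N _ pE.
  rewrite integral_indic// setIT => <-; apply: integral0_eq => x _.
  rewrite /avg (_ : \int[mu]_y _ = 0) ?mule0//.
  under eq_integral => y _ do rewrite /cellind indicMI.
  rewrite integral_indic//; last by apply: measurableI => //; exact: measurable_cell.
  rewrite setIT setIC; exact: h.
set Q := G 0%N x0; have mQ : measurable Q by exact: measurable_cell.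
have Qoo : mu Q < +oo by rewrite cell_vol ltry.
set E' := E `&` Q; have mE' : measurable E' by exact: measurableI.
have pE' := @pm_indic _ T R _ mE'.
have hE' k x : avg G k (fun y => (\1_E' y)%:E) x <= (2^-1)%:E.
  have [[y [xy [Ey Qy]]]|no] := pselect (exists y, G k x y /\ E' y).
    rewrite (avg_inv _ xy); apply: le_trans (hE k _ Ey).
    apply: le_avg => // z; rewrite lee_fin indicI/= /GRing.mul/=.
    by rewrite ler_piMr// indicE; case: (_ \in _).
  rewrite /avg (_ : \int[mu]_y _ = 0) ?mule0 ?lee_fin//.
  apply: integral0_eq => y _; have [xy|xy] := pselect (G k x y).
    rewrite [X in _ * X](_ : _ = 0) ?mule0// indicE memNset// => E'y.
    by apply: no; exists y.
  by rewrite cellind0// mul0e.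
apply/eqP; rewrite eq_le measure_ge0 andbT; apply/lee_addgt0Pr => e e0.
rewrite add0e; have e20 : (0 < e / 2)%R by rewrite divr_gt0.
have [k [B0 [mB0 iB0 dB0]]] := approximable_measurable mQ Qoo mE' e20.
pose B := B0 `&` Q.
have mB : measurable B by exact: measurableI.
have iB : inv_at G k B.
  move=> x y xy; rewrite /B /setI /mkset (iB0 _ _ xy).
  suff -> : Q x = Q y by [].
  have xy0 := cell_le (leq0n k) xy.
  by apply/propext; rewrite /Q; split => /cell_sym h; apply: cell_sym;
    [rewrite -(cell_eq xy0)|rewrite (cell_eq xy0)].
have pB := @pm_indic _ T R _ mB.
have mEB : measurable (E' `&` B) by exact: measurableI.
have h1 : mu (E' `&` B) <= (2^-1)%:E * mu B.
  have <- : \int[mu]_x ((\1_B x)%:E * (\1_E' x)%:E) = mu (E' `&` B).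
    under eq_integral => y _ do rewrite indicMI.
    by rewrite integral_indic ?setIT 1?setIC.
  rewrite -(avg_int (G := G) (k := k))//; last first.
    move=> x y xy; rewrite !indicE; congr (_%:R%:E); congr nat_of_bool.
    by apply/idP/idP; rewrite !inE (iB _ _ xy).
  have <- : \int[mu]_x (\1_B x)%:E = mu B by rewrite integral_indic// setIT.
  rewrite -intZ//; apply: intle.
  - by apply: pmM => //; exact: pm_avg.
  - by apply: pmM => //; apply: pm_cst; rewrite lee_fin.
  - by move=> x; rewrite muleC; apply: lee_wpmul2r => //; case: pB.
have h2 : mu B <= mu (E' `&` B) + (e / 2)%:E.
  apply: le_trans (leeD (lexx _) dB0); apply: measure_cover2 => //.
    by apply: measurableI => //; exact: measurable_symdiff.
  move=> x [B0x Qx]; have [Ex|Ex] := pselect (E' x); first by left.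
  by right; split => //; right.
have h3 : mu E' <= mu (E' `&` B) + (e / 2)%:E.
  apply: le_trans (leeD (lexx _) dB0); apply: measure_cover2 => //.
    by apply: measurableI => //; exact: measurable_symdiff.
  move=> x [Ex Qx]; have [Bx|Bx] := pselect (B0 x); first by left.
  by right; split => //; left.
have fB : mu B \is a fin_num.
  rewrite ge0_fin_numE//; apply: le_lt_trans Qoo; apply: le_measure; rewrite ?inE//.
  exact: subIsetr.
have fEB : mu (E' `&` B) \is a fin_num.
  rewrite ge0_fin_numE//; apply: le_lt_trans (_ : mu B < +oo); last by rewrite -ge0_fin_numE.
  by apply: le_measure; rewrite ?inE//; exact: subIsetr.
apply: (le_trans h3); move: h1 h2.
rewrite -(fineK fB) -(fineK fEB) -EFinM -!EFinD !lee_fin; lra.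
Qed.

(** Where M F <= r and 2 r < F, every average of the indicator is at most
    1/2, so this set is null; let r run through the rationals. *)
Lemma max_density F : pmeas F -> {ae mu, forall x, F x <= 2%:E * maxavg G F x}.
Proof.
move=> pF; have pM := pm_maxavg G pF.
pose E (r : R) := [set x | maxavg G F x <= r%:E] `&` [set x | (2 * r)%:E < F x].
have mE r : measurable (E r).
  apply: measurableI.
    rewrite -[X in measurable X]setTI; apply: emeasurable_fun_infty_c => //.
    by case: pM.
  rewrite -[X in measurable X]setTI; apply: emeasurable_fun_o_infty => //.
  by case: pF.
have E0 r : (0 < r)%R -> mu (E r) = 0.
  move=> r0; apply: sparse_null => // k x [/= Mx _].
  have r20 : 0 < (2 * r)%:E by rewrite lte_fin mulr_gt0.
  rewrite -(@lee_pmul2l _ (2 * r)%:E)// -EFinM mulrAC divff// mul1r.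
  apply: le_trans Mx; rewrite -avgZ; [|exact: ltW|exact: pm_indic].
  apply: le_trans (avg_le_max G k F x); apply: le_avg => //.
    by apply: pmM; [apply: pm_cst; exact: ltW|exact: pm_indic].
  move=> y; rewrite indicE; case: (boolP (y \in E r)) => [|_].
    by rewrite inE => -[_ /ltW]; rewrite mule1.
  by rewrite mule0; case: pF.
(* A countable cover of the exceptional set, indexed by the rationals. *)
pose E_ i := if (unpickle i : option rat) is Some r then
  (if (0 < ratr r :> R)%R then E (ratr r) else set0) else set0.
have E_0 i : mu.-negligible (E_ i).
  rewrite /E_; case: unpickle => [r|]; last exact: negligible_set0.
  case: ifPn => r0; last exact: negligible_set0.
  by exists (E (ratr r)); split => //; exact: E0.
have := negligible_bigcup E_0; apply: negligibleS => x /= /negP; rewrite -ltNge => h.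
have [s sE] : exists s, maxavg G F x = s%:E.
  case: (maxavg G F x) (pM.2 x) h => [s _ _|_|//]; first by exists s.
  by rewrite gt0_muley ?lte_fin// => /lt_le_trans/(_ (leey _)); rewrite ltxx.
have s0 : (0 <= s)%R by rewrite -lee_fin -sE; case: pM.
rewrite sE -EFinM in h.
have [t st tF] : exists2 t, (s < t)%R & (2 * t)%:E <= F x.
  case: (F x) h => [r| |//]; rewrite ?lte_fin => h.
    by exists (r / 2)%R; [rewrite ltr_pdivlMr// mulrC|rewrite mulrCA divff ?mulr1].
  by exists (s + 1)%R; [rewrite ltrDl|rewrite leey].
have [r] := rat_in_itvoo st; rewrite in_itv/= => /andP[sr rt].
exists (pickle r); first exact: I.
rewrite /E_ pickleK.
rewrite (le_lt_trans s0 sr); split => /=; first by rewrite sE lee_fin ltW.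
by apply: lt_le_trans tF; rewrite lte_fin ltr_pM2l.
Qed.

Lemma int_le_max w F : pmeas w -> pmeas F ->
  \int[mu]_x (w x * F x) <= 2%:E * \int[mu]_x (w x * maxavg G F x).
Proof.
move=> pw pF; have pM := pm_maxavg G pF.
have h20 : 0 <= 2%:E :> \bar R by rewrite lee_fin.
rewrite -intZ//; last exact: pmM.
have [m1 p1] := pmM pw pF.
have [m2 p2] := pmM (pm_cst h20) (pmM pw pM).
apply: ae_ge0_le_integral => //.
apply: filterS (max_density pF) => x h _.
rewrite muleCA; apply: lee_wpmul2l => //; by case: pw.
Qed.

End density.

(** * Averages against dyadic BMO functions *)

Local Opaque avg maxavg pmaxavg.

Section bmo_constant.
Context {R : realType} {q : R}.
Variable B : R.

Definition bmo_cst : R := (2 * (B + 8 * (1 + q) * B))%R.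

Lemma bmo_cst_gt0 : (2 <= q)%R -> (0 < B)%R -> (0 < bmo_cst)%R.
Proof.
move=> q2 B0; have q1 : (0 < 1 + q)%R by lra.
by rewrite mulr_gt0// addr_gt0// !mulr_gt0.
Qed.

End bmo_constant.

Section bmo.
Context {d} {T : measurableType d} {R : realType}.
Variable mu : {sigma_finite_measure set T -> \bar R}.
Context {q : R} (G : grid mu q).
Hypothesis q2 : (2 <= q)%R.
Implicit Types (u F w : T -> \bar R) (k j l m n : nat).

Variables (b : T -> R) (c : nat -> T -> R) (B : R).

(** The numbers [c k x] play the part of the mean of b over the cell. *)
Record dyadic_bmo : Prop := DyadicBMO {
  bmo_meas : measurable_fun setT b;
  bmo_cmeas : forall k, measurable_fun setT (c k);
  bmo_cinv : forall k, inv_at G k (c k);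
  bmo_gt0 : (0 < B)%R;
  bmo_bound : forall k x, avg G k (fun y => `|b y - c k y|%:E) x <= B%:E }.

Hypothesis bc : dyadic_bmo.

Definition osc k x : \bar R := `|b x - c k x|%:E.
Definition jump k j x : \bar R := `|c j x - c k x|%:E.

Lemma pm_osc k : pmeas (osc k).
Proof.
by apply: pm_abs; apply: measurable_funB; [exact: (bmo_meas bc)|exact: (bmo_cmeas bc)].
Qed.

Lemma pm_jump k j : pmeas (jump k j).
Proof. by apply: pm_abs; apply: measurable_funB; exact: (bmo_cmeas bc). Qed.

Lemma jump_inv k j : (k <= j)%N -> inv_at G j (jump k j).
Proof.
move=> kj x y xy; rewrite /jump (bmo_cinv bc xy).
by rewrite (inv_at_le kj (bmo_cinv bc (k := k)) xy).
Qed.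

Let B0 : 0 <= B%:E. Proof. by rewrite lee_fin ltW// (bmo_gt0 bc). Qed.
Let pB : pmeas (fun=> B%:E : \bar R) := @pm_cst _ T R _ B0.

Lemma jump_le k j x : (k <= j)%N -> jump k j x <= B%:E + avg G j (osc k) x.
Proof.
move=> kj; have pj := pm_jump k j.
rewrite -(avg_id (G := G) x pj (jump_inv kj)).
apply: (@le_trans _ _ (avg G j (fun y => osc j y + osc k y) x)).
  apply: le_avg => //; first by apply: pmD; exact: pm_osc.
  move=> y; rewrite /jump /osc -EFinD lee_fin.
  rewrite [X in (_ <= X + _)%R]distrC; apply: le_trans (ler_normD _ _).
  by rewrite addrA subrK.
rewrite avgD; [|exact: pm_osc..]; apply: leeD => //; exact: bmo_bound bc _ _.
Qed.

Lemma avg_osc_le k j x : (k <= j)%N -> avg G j (osc k) x <= B%:E + jump k j x.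
Proof.
move=> kj; have pj := pm_jump k j.
rewrite -[X in _ <= _ + X](avg_id (G := G) x pj (jump_inv kj)).
apply: (@le_trans _ _ (avg G j (fun y => osc j y + jump k j y) x)).
  apply: le_avg => //; [exact: pm_osc|by apply: pmD => //; exact: pm_osc|].
  move=> y; rewrite /jump /osc -EFinD lee_fin.
  by apply: le_trans (ler_normD _ _); rewrite addrA subrK.
rewrite avgD//; [|exact: pm_osc]; apply: leeD => //; exact: bmo_bound bc _ _.
Qed.

Lemma int_osc k u : pmeas u -> inv_at G k u ->
  \int[mu]_x (u x * (B%:E + osc k x)) <= (2 * B)%:E * \int[mu]_x u x.
Proof.
move=> pu iu; have po := pm_osc k.
rewrite (_ : \int[mu]_x _ = \int[mu]_x (B%:E * u x + u x * osc k x)); last first.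
  apply: eq_integral => x _; rewrite ge0_muleDr//; last by case: po.
  by rewrite [B%:E * _]muleC.
have pBu : pmeas (fun x => B%:E * u x) by exact: pmM.
rewrite intD//; last exact: pmM.
rewrite -(avg_int (G := G) (k := k) (u := u) (F := osc k))//.
apply: (@le_trans _ _ (B%:E * \int[mu]_x u x + B%:E * \int[mu]_x u x)).
  rewrite intZ//; apply: leeD => //; rewrite -intZ//; apply: intle => //.
    by apply: pmM => //; exact: pm_avg.
  move=> x; rewrite muleC; apply: lee_wpmul2r; first by case: pu.
  exact: bmo_bound bc _ _.
rewrite -ge0_muleDl// -EFinD; apply: lee_wpmul2r; first exact: intge0.
by rewrite lee_fin; have := q2; lra.
Qed.

Lemma ler_half_split (z y1 y2 : \bar R) : z < +oo -> 0 <= y1 -> 0 <= y2 ->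
  z = y1 + y2 -> 2%:E * y1 <= z -> z <= 2%:E * y2.
Proof.
case: z => [r| |] // _; case: y1 => [r1| |]//; case: y2 => [r2| |]// h1 h2.
rewrite -!EFinM -EFinD => -[->]; rewrite !lee_fin; lra.
Qed.

Let C : R := (8 * (1 + q) * B)%R.

Let C0 : 0 <= C%:E.
Proof.
rewrite lee_fin /C; apply: mulr_ge0; last exact: ltW (bmo_gt0 bc).
by have := q2; lra.
Qed.

(** Stop at the first l > k at which the mean of F exceeds twice its mean at
    step k.  In the density u * E_k F the stopped part has at most half of the
    mass, because E_l F > 2 E_k F on it; so the whole mass is at most twice the
    integral of u * M F over the part that is never stopped.  On a cell stopped
    at l, compare b_j with b_l by induction, since fewer steps remain, and b_l
    with b_k directly: E_l F is at most 2 q E_k F, because the mean had not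
    doubled at step l-1.  Where nothing is stopped, b_j is compared with b_k
    directly, with E_j F <= 2 E_k F.  The direct terms add up to a multiple of the whole
    mass.  The constant does not grow in the induction, because the inductive
    terms are integrals over the stopped part and the others are paid for by
    the part never stopped. *)
Lemma int_jump_stop n k j u F : (j - k <= n)%N -> (k <= j)%N ->
  pmeas u -> inv_at G k u -> pmeas F -> \int[mu]_x (u x * F x) < +oo ->
  \int[mu]_x (jump k j x * (u x * F x)) <= C%:E * \int[mu]_x (u x * maxavg G F x).
Proof.
elim: n k j u => [|n ih] k j u jkn kj pu iu pF foo.
  have -> : j = k by apply/eqP; rewrite eqn_leq kj -subn_eq0 -leqn0 jkn.
  rewrite integral0_eq; last by move=> x _; rewrite /jump subrr normr0 mul0e.
  by apply: mule_ge0 => //; apply: intge0; apply: pmM => //; exact: pm_maxavg.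
pose p l x := (k < l)%N && (2%:E * avg G k F x < avg G l F x).
have pA l : pmeas (avg G l F) by exact: pm_avg.
have h2 : 0 <= 2%:E :> \bar R by rewrite lee_fin.
have p2 := @pm_cst _ T R _ h2.
have pM := pm_maxavg G pF.
have mp l : measurable_fun setT (p l).
  apply: measurable_and; first exact: measurable_cst.
  apply: measurable_fun_lte; last by case: (pA l).
  by case: (pmM p2 (pA k)).
have pinv l i : (l <= i)%N -> (k <= i)%N -> inv_at G i (p l).
  move=> li ki x y xy; rewrite /p (avg_inv _ (cell_le li xy)).
  by rewrite (avg_inv _ (cell_le ki xy)).
pose X l x : \bar R := b2e (fhit p l x).
pose Xoo x : \bar R := b2e (~~ has (p ^~ x) (iota 0 j.+1)).
have pX l : pmeas (X l) by apply: pm_b2e; exact: measurable_fhit.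
have pXoo : pmeas Xoo by apply: pm_b2e; apply: measurable_neg; exact: measurable_has.
have iX l : (k <= l)%N -> inv_at G l (X l).
  move=> kl x y xy; rewrite /X /fhit (pinv l l (leqnn l) kl _ _ xy); congr (b2e (_ && ~~ _)).
  apply: eq_in_has => i; rewrite mem_iota add0n => /andP[_ il].
  by rewrite (pinv _ _ (ltnW il) kl _ _ xy).
have iXoo : inv_at G j Xoo.
  move=> x y xy; rewrite /Xoo; congr (b2e (~~ _)).
  apply: eq_in_has => i; rewrite mem_iota add0n ltnS => /andP[_ ij].
  by rewrite (pinv _ _ ij kj _ _ xy).
have Xk l : (l <= k)%N -> forall x, X l x = 0.
  by move=> lk x; rewrite /X /fhit /p ltnNge lk.
have sumX x : \sum_(l < j.+1) X l x + Xoo x = 1.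
  by rewrite sum_fhit /Xoo; case: has => /=; rewrite ?adde0 ?add0e.
have X0 l x : 0 <= X l x by case: (pX l).
have Xoo0 x : 0 <= Xoo x by case: pXoo.
have splitX (H : T -> \bar R) : pmeas H -> \int[mu]_x H x =
    \sum_(l < j.+1) \int[mu]_x (X l x * H x) + \int[mu]_x (Xoo x * H x).
  move=> pH; rewrite -int_sum; last by move=> l; exact: pmM.
  rewrite -intD; [|by apply: pm_sum => l; exact: pmM|exact: pmM].
  apply: eq_integral => x _; rewrite -ge0_sume_distrl//.
  by rewrite -ge0_muleDl ?sumX ?mul1e// sume_ge0.
have puF := pmM pu pF.
have puA := pmM pu (pA k).
have puM := pmM pu pM.
have EuA : \int[mu]_x (u x * avg G k F x) = \int[mu]_x (u x * F x) by exact: avg_int.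
have half : \int[mu]_x (u x * F x) <= 2%:E * \int[mu]_x (Xoo x * (u x * maxavg G F x)).
  apply: (@le_trans _ _ (2%:E * \int[mu]_x (Xoo x * (u x * avg G k F x)))).
    rewrite -EuA; apply: (ler_half_split _ _ _ (splitX _ puA)).
    - by rewrite EuA.
    - by apply: sume_ge0 => l _; apply: intge0; exact: pmM.
    - by apply: intge0; exact: pmM.
    rewrite EuA (splitX _ puF).
    apply: (@le_trans _ _ (\sum_(l < j.+1) \int[mu]_x (X l x * (u x * F x)))); last first.
      by rewrite leeDl//; apply: intge0; exact: pmM.
    rewrite ge0_sume_distrr; last by move=> l _; apply: intge0; exact: pmM.
    apply: lee_sum => l _; have [lk|kl] := leqP l k.
      by rewrite !integral0_eq ?mule0// => x _; rewrite Xk// mul0e.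
    rewrite -intZ//; last exact: pmM.
    under [leRHS]eq_integral do rewrite muleA.
    rewrite -(avg_int (G := G) (k := l) (u := fun x => X l x * u x) (F := F))//; last 2 first.
    - exact: pmM.
    - by move=> x y xy; rewrite (iX _ (ltnW kl) _ _ xy) (iu _ _ (cell_le (ltnW kl) xy)).
    apply: intle.
    - by apply: pmM => //; exact: pmM.
    - by apply: pmM => //; exact: pmM.
    move=> x; rewrite /X /b2e; case: ifPn => [/andP[/andP[_ /ltW h] _]|_]; last first.
      by rewrite !mul0e mule0.
    by rewrite !mul1e muleCA; apply: lee_wpmul2l => //; case: pu.
  apply: lee_wpmul2l => //; apply: intle; [by apply: pmM => //; exact: pmM..|].
  move=> x; apply: lee_wpmul2l => //; apply: lee_wpmul2l; first by case: pu.
  exact: avg_le_max.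
have pj l i := pm_jump l i.
pose W x := u x * avg G k F x * (B%:E + osc k x).
have pW : pmeas W by apply: pmM => //; apply: pmD => //; exact: pm_osc.
have q0 : 0 <= (2 * q)%:E by rewrite lee_fin; have := q2; lra.
have IW : \int[mu]_x W x <= (2 * B)%:E * \int[mu]_x (u x * F x).
  rewrite /W -EuA; apply: int_osc => //.
  by move=> x y xy; rewrite (iu _ _ xy) (avg_inv _ xy).
have stopped l : (l < j.+1)%N -> \int[mu]_x (X l x * (jump k j x * (u x * F x))) <=
    C%:E * \int[mu]_x (X l x * (u x * maxavg G F x)) +
    (2 * q)%:E * \int[mu]_x (X l x * W x).
  rewrite ltnS => lj; have [lk|kl] := leqP l k.
    rewrite integral0_eq; last by move=> x _; rewrite Xk// mul0e.
    by apply: adde_ge0; apply: mule_ge0 => //; apply: intge0; apply: pmM => //; exact: pmM.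
  have pXu : pmeas (fun x => X l x * u x) by exact: pmM.
  have iXu : inv_at G l (fun x => X l x * u x).
    by move=> x y xy; rewrite (iX _ (ltnW kl) _ _ xy) (iu _ _ (cell_le (ltnW kl) xy)).
  have X1 x : X l x <= 1 by rewrite /X /b2e; case: ifP.
  apply: (@le_trans _ _ (\int[mu]_x (jump l j x * (X l x * u x * F x)) +
     \int[mu]_x (X l x * u x * jump k l x * F x))).
    rewrite -intD; [|by apply: pmM => //; exact: pmM|by apply: pmM => //; exact: pmM].
    apply: intle; [by apply: pmM => //; exact: pmM| |].
      by apply: pmD; apply: pmM => //; exact: pmM.
    move=> x; rewrite [X in _ <= _ + X](_ : _ = jump k l x * (X l x * u x * F x)); last first.
      by rewrite [_ * jump k l x]muleC -muleA.
    rewrite -ge0_muleDl ?lee_fin//.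
    rewrite muleCA -[X l x * _ * _]muleA; apply: lee_wpmul2r.
      by apply: mule_ge0 => //; case: puF.
    rewrite /jump -EFinD lee_fin; apply: le_trans (ler_normD _ _).
    by rewrite addrA subrK.
  apply: leeD.
    rewrite (_ : \int[mu]_x (X l x * (u x * maxavg G F x)) =
        \int[mu]_x (X l x * u x * maxavg G F x)); last first.
      by apply: eq_integral => x _; rewrite muleA.
    apply: ih => //.
    - by rewrite leq_subLR (leq_trans _ (_ : k.+1 + n <= l + n)%N)// ?leq_add2r// addSnnS -leq_subLR.
    - apply: le_lt_trans foo; apply: intle => //; first exact: pmM.
      move=> x; rewrite -muleA -[leRHS]mul1e; apply: lee_wpmul2r => //; by case: puF.
  rewrite -(avg_int (G := G) (k := l) (u := fun x => X l x * u x * jump k l x) (F := F))//; last 2 first.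
  - exact: pmM.
  - by move=> x y xy; rewrite (iXu _ _ xy) (jump_inv (ltnW kl) xy).
  apply: (@le_trans _ _ ((2 * q)%:E *
      \int[mu]_x (X l x * u x * avg G k F x * (B%:E + avg G l (osc k) x)))).
    have pO := pm_avg G l (pm_osc k).
    rewrite -intZ//; last by apply: pmM; [exact: pmM|exact: pmD].
    apply: intle.
    - by apply: pmM => //; exact: pmM.
    - by apply: pmM; [exact: pm_cst|apply: pmM; [exact: pmM|exact: pmD]].
    move=> x; rewrite {1 2}/X /b2e; case: ifPn => [/andP[pl npl]|_]; last first.
      by rewrite !mul0e mule0.
    rewrite !mul1e.
    have hA : avg G l F x <= (2 * q)%:E * avg G k F x.
      have [l' lE] : exists l', l = l'.+1 by case: l kl {pl npl lj iXu pXu X1 pO} => // l' _; exists l'.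
      rewrite lE; apply: (le_trans (avg_step G q2 l' x pF)).
      rewrite mulrC EFinM -muleA; apply: lee_wpmul2l; first by rewrite lee_fin; have := q2; lra.
      move: kl; rewrite lE ltnS leq_eqVlt => /predU1P[<-|kl'].
        rewrite -[leLHS]mul1e; apply: lee_wpmul2r; first by case: (pA k).
        by rewrite lee_fin; have := q2; lra.
      move: npl => /hasPn/(_ l'); rewrite mem_iota add0n lE leqnn => /(_ isT).
      by rewrite /p kl'/= -leNgt.
    rewrite (_ : _ * (u x * _ * _) = u x * (B%:E + avg G l (osc k) x) * ((2 * q)%:E * avg G k F x)); last first.
      by rewrite [RHS]muleCA; congr (_ * _); exact: muleAC.
    apply: lee_pmul => //; first by apply: mule_ge0; [case: pu|case: (pj k l)].
      by case: (pA l).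
    apply: lee_wpmul2l; first by case: pu.
    exact: jump_le (ltnW kl).
  apply: lee_wpmul2l => //.
  have pO := pm_avg G l (pm_osc k).
  have pXA : pmeas (fun x => X l x * u x * avg G k F x) by exact: pmM.
  rewrite [leLHS](_ : _ = \int[mu]_x (X l x * u x * avg G k F x * B%:E) +
     \int[mu]_x (X l x * u x * avg G k F x * avg G l (osc k) x)); last first.
    rewrite -intD; [|exact: pmM..]; apply: eq_integral => x _.
    by rewrite ge0_muleDr//; case: pO.
  rewrite avg_int//; [|exact: pm_osc|]; last first.
    move=> x y xy; rewrite (iXu _ _ xy); congr (_ * _).
    exact: avg_inv (cell_le (ltnW kl) xy).
  rewrite -intD; [|exact: pmM|by apply: pmM => //; exact: pm_osc].
  rewrite le_eqVlt; apply/orP; left; apply/eqP; apply: eq_integral => x _.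
  by rewrite /W -ge0_muleDr ?lee_fin// [RHS]muleA [X in _ = X * _]muleA.
have unstopped : \int[mu]_x (Xoo x * (jump k j x * (u x * F x))) <=
    2%:E * \int[mu]_x W x.
  have pju : pmeas (fun x => Xoo x * (jump k j x * u x)) by apply: pmM => //; exact: pmM.
  under [leLHS]eq_integral do rewrite [jump _ _ _ * _]muleA muleA.
  rewrite -(avg_int (G := G) (k := j) (u := fun x => Xoo x * (jump k j x * u x)) (F := F))//; last first.
    by move=> x y xy; rewrite (iXoo _ _ xy) (jump_inv kj xy) (iu _ _ (cell_le kj xy)).
  have pO := pm_avg G j (pm_osc k).
  apply: (@le_trans _ _ (2%:E *
      \int[mu]_x (u x * avg G k F x * (B%:E + avg G j (osc k) x)))).
    rewrite -intZ//; last by apply: pmM => //; exact: pmD.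
    apply: intle; [exact: pmM| |].
      by apply: pmM => //; apply: pmM => //; exact: pmD.
    move=> x; rewrite {1}/Xoo /b2e; case: ifPn => [npj|_]; last first.
      rewrite !mul0e; apply: mule_ge0 => //; apply: mule_ge0; first by case: puA.
      by apply: adde_ge0 => //; case: pO.
    rewrite mul1e.
    have hA : avg G j F x <= 2%:E * avg G k F x.
      move: kj; rewrite leq_eqVlt => /predU1P[<-|kj'].
        rewrite -[leLHS]mul1e; apply: lee_wpmul2r; first by case: (pA k).
        by rewrite lee_fin; have := q2; lra.
      move: npj => /hasPn/(_ j); rewrite mem_iota add0n leqnn => /(_ isT).
      by rewrite /p kj'/= -leNgt.
    rewrite (_ : _ * (u x * _ * _) = (B%:E + avg G j (osc k) x) * u x * (2%:E * avg G k F x)); last first.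
      by rewrite [RHS]muleCA; congr (_ * _); rewrite muleC muleA.
    apply: lee_pmul => //; first by apply: mule_ge0; [case: (pj k j)|case: pu].
      by case: (pA j).
    apply: lee_wpmul2r; first by case: pu.
    exact: jump_le.
  apply: lee_wpmul2l => //.
  rewrite [leLHS](_ : _ = \int[mu]_x (u x * avg G k F x * B%:E) +
     \int[mu]_x (u x * avg G k F x * avg G j (osc k) x)); last first.
    rewrite -intD; [|exact: pmM..]; apply: eq_integral => x _.
    by rewrite ge0_muleDr//; case: pO.
  rewrite avg_int//; [|exact: pm_osc|]; last first.
    move=> x y xy; rewrite (iu _ _ (cell_le kj xy)); congr (_ * _).
    exact: avg_inv (cell_le kj xy).
  rewrite -intD; [|exact: pmM|by apply: pmM => //; exact: pm_osc].
  rewrite le_eqVlt; apply/orP; left; apply/eqP; apply: eq_integral => x _.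
  by rewrite /W -ge0_muleDr ?lee_fin.
have pjuF : pmeas (fun x => jump k j x * (u x * F x)) by exact: pmM.
rewrite (splitX _ pjuF) (splitX _ puM).
have sW : \sum_(l < j.+1) \int[mu]_x (X l x * W x) <= \int[mu]_x W x.
  by rewrite [leRHS](splitX _ pW) leeDl//; apply: intge0; exact: pmM.
have I0 f : pmeas f -> 0 <= \int[mu]_x f x by exact: intge0.
apply: (@le_trans _ _ (\sum_(l < j.+1) (C%:E * \int[mu]_x (X l x * (u x * maxavg G F x)) +
    (2 * q)%:E * \int[mu]_x (X l x * W x)) + 2%:E * \int[mu]_x W x)).
  by apply: leeD => //; apply: lee_sum => l _; exact: stopped.
rewrite big_split/= -!ge0_sume_distrr; last 2 first.
- by move=> l _; apply: I0; exact: pmM.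
- by move=> l _; apply: I0; exact: pmM.
rewrite [leRHS]ge0_muleDr; last 2 first.
- by apply: sume_ge0 => l _; apply: I0; exact: pmM.
- by apply: I0; exact: pmM.
rewrite -addeA; apply: leeD => //.
apply: (@le_trans _ _ ((2 * q)%:E * \int[mu]_x W x + 2%:E * \int[mu]_x W x)).
  by apply: leeD => //; exact: lee_wpmul2l.
rewrite -ge0_muleDl// -EFinD.
have hq : 0 <= (2 * q + 2)%:E by rewrite lee_fin; have := q2; lra.
apply: le_trans (lee_wpmul2l hq IW) _.
rewrite muleA -EFinM.
have hb : (0 <= (2 * q + 2) * (2 * B))%R.
  by rewrite !mulr_ge0 ?(ltW (bmo_gt0 bc))//; have := q2; lra.
apply: (@le_trans _ _ (((2 * q + 2) * (2 * B))%:E *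
   (2%:E * \int[mu]_x (Xoo x * (u x * maxavg G F x))))).
  by apply: lee_wpmul2l; rewrite ?lee_fin.
rewrite muleA -EFinM (_ : (_ * 2)%R = C)//.
by rewrite /C; ring.
Qed.

Lemma cvg_pmaxavg F x : pmeas F -> pmaxavg G n F x @[n --> \oo] --> maxavg G F x.
Proof.
move=> pF.
have -> : maxavg G F x = ereal_sup (range (fun n => pmaxavg G n F x)).
  apply/eqP; rewrite eq_le; apply/andP; split; last first.
    by apply: ge_ereal_sup => _ [n _ <-]; exact: pmax_le_max.
  apply: maxavg_le => n; apply: (le_trans (avg_le_pmax G F x (ltnSn n))).
  by apply: ereal_sup_ubound; exists n.+1.
apply: ereal_nondecreasing_cvgn; apply/nondecreasing_seqP => n.
apply: pmaxavg_le; first by case: (pm_pmaxavg G n.+1 pF).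
by move=> l ln; apply: avg_le_pmax; apply: leqW.
Qed.

Lemma sup_int_le w F (z : \bar R) k : pmeas w -> (forall x, w x \is a fin_num) ->
  pmeas F ->
  (forall n, (k <= n)%N -> \int[mu]_x (w x * pmaxavg G n F x) <= z) ->
  \int[mu]_x (w x * maxavg G F x) <= z.
Proof.
move=> pw fw pF h; have pm n : pmeas (fun x => w x * pmaxavg G (n + k)%N F x).
  by apply: pmM => //; exact: pm_pmaxavg.
rewrite (_ : \int[mu]_x _ =
    \int[mu]_x limn_einf (fun n => w x * pmaxavg G (n + k)%N F x)); last first.
  apply: eq_integral => x _.
  have cv : w x * pmaxavg G (n + k)%N F x @[n --> \oo] --> w x * maxavg G F x.
    apply: cvgeZl => //; have := @cvg_pmaxavg F x pF.
    by rewrite -(cvg_shiftn k).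
  rewrite is_cvg_limn_einfE; last by apply/cvg_ex; eexists; exact: cv.
  by apply/esym/cvg_lim.
apply: le_trans (fatou _ _ _ _) _ => //; [by move=> n; case: (pm n)|by move=> n x _; case: (pm n)|].
rewrite limn_einf_lim; apply: lime_le; first exact: is_cvg_einfs.
apply: nearW => n; apply: le_trans (h (n + k)%N _); last exact: leq_addl.
by apply: ereal_inf_lbound; exists n => /=.
Qed.

(** Replace F by 2 M F, and M F by the maximum over finitely many steps, which
    is constant on cells of a fine step n.  Then |b - b_k| may be replaced by
    its average at step n, at most B + |b_n - b_k|, and [int_jump_stop]
    applies. *)
Lemma bmo_avg k F x : pmeas F ->
  avg G k (fun y => osc k y * F y) x <=
  (bmo_cst (q := q) B)%:E * avg G k (maxavg G (maxavg G F)) x.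
Proof.
move=> pF; have pM := pm_maxavg G pF; have pMM := pm_maxavg G pM.
have K0 := bmo_cst_gt0 q2 (bmo_gt0 bc).
have pu := pm_cellind G k x.
have po := pm_osc k.
rewrite !avgE muleCA; apply: lee_wpmul2l; first exact: volV_ge0.
have puMM := pmM pu pMM.
have [->|foo] := eqVneq (\int[mu]_y (cellind G k x y * maxavg G (maxavg G F) y)) +oo.
  by rewrite gt0_muley ?leey.
have iu : inv_at G k (cellind G k x).
  move=> y z yz; rewrite /cellind.
  by rewrite cell_indicC (cell_eq yz) cell_indicC.
have uMM : \int[mu]_y (cellind G k x y * maxavg G F y) <=
    \int[mu]_y (cellind G k x y * maxavg G (maxavg G F) y).
  rewrite -(avg_int (G := G) (k := k) (u := cellind G k x) (F := maxavg G F))//; apply: intle => //.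
    by apply: pmM => //; exact: pm_avg.
  by move=> y; apply: lee_wpmul2l; [case: pu|exact: avg_le_max].
have uMoo : \int[mu]_y (cellind G k x y * maxavg G F y) < +oo.
  by apply: le_lt_trans uMM _; rewrite ltey.
under [leLHS]eq_integral do rewrite muleA.
apply: (le_trans (int_le_max G (pmM pu po) pF)).
rewrite /bmo_cst EFinM -muleA; apply: lee_wpmul2l; first by rewrite lee_fin.
apply: (@sup_int_le _ _ _ k) => //.
- exact: pmM.

move=> n kn; have pP := pm_pmaxavg G n pF.
have piu : inv_at G n (fun y => cellind G k x y * pmaxavg G n F y).
  by move=> y z yz; rewrite (iu _ _ (cell_le kn yz)) (pmax_inv _ yz).
have pup : pmeas (fun y => cellind G k x y * pmaxavg G n F y) by exact: pmM.
have uPM : \int[mu]_y (cellind G k x y * pmaxavg G n F y) <=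
    \int[mu]_y (cellind G k x y * maxavg G F y).
  apply: intle => //; first exact: pmM.
  by move=> y; apply: lee_wpmul2l; [case: pu|exact: pmax_le_max].
rewrite (_ : \int[mu]_y _ = \int[mu]_y ((cellind G k x y * pmaxavg G n F y) * osc k y)); last first.
  by apply: eq_integral => y _; rewrite -!muleA; congr (_ * _); rewrite muleC.
rewrite -(avg_int (G := G) (k := n) (u := fun y => cellind G k x y * pmaxavg G n F y) (F := osc k))//.
apply: (@le_trans _ _ (\int[mu]_y (B%:E * (cellind G k x y * pmaxavg G n F y) +
   jump k n y * (cellind G k x y * pmaxavg G n F y)))).
  have pj := pm_jump k n.
  apply: intle; [by apply: pmM => //; exact: pm_avg|by apply: pmD; exact: pmM|].
  move=> y; rewrite -ge0_muleDl//; last by case: pj.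
  by rewrite muleC; apply: lee_wpmul2r; [case: pup|exact: avg_osc_le].
rewrite intD; [|exact: pmM|by apply: pmM => //; exact: pm_jump].
rewrite EFinD ge0_muleDl//; apply: leeD.
  by rewrite (intZ mu B0 pup); apply: (lee_wpmul2l B0); exact: (le_trans uPM uMM).
apply: (le_trans (int_jump_stop (leqnn _) kn pu iu pP (le_lt_trans uPM uMoo))).
apply: (lee_wpmul2l C0); apply: intle.
- by apply: (pmM pu); exact: pm_maxavg.
- exact: puMM.
move=> y; apply: lee_wpmul2l; first by case: pu.
apply: maxavg_le => l; apply: (le_trans _ (avg_le_max G l _ _)).
apply: le_avg; [exact: pP|exact: pM|] => z; exact: (pmax_le_max G n z pF).
Qed.

End bmo.

(** * Dyadic fractional integrals *)

Section fractional.
Context {d} {T : measurableType d} {R : realType}.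
Variable mu : {sigma_finite_measure set T -> \bar R}.
Context {q : R}.
Hypothesis q2 : (2 <= q)%R.
Implicit Types (u F w H : T -> \bar R) (k j l m n : nat) (G : grid mu q).

Lemma maxavgZ G (c : R) F x : (0 < c)%R -> pmeas F ->
  maxavg G (fun y => c%:E * F y) x = c%:E * maxavg G F x.
Proof.
move=> c0 pF; rewrite !maxavgE -ereal_sup_pZl//; congr ereal_sup.
apply/seteqP; split => [y [k _ <-]|y [_ [k _ <-] <-]].
  exists (avg G k F x); first by exists k.
  by rewrite avgZ// lee_fin ltW.
by exists k => //; rewrite avgZ// lee_fin ltW.
Qed.

Lemma pmZ (c : R) F : (0 <= c)%R -> pmeas F -> pmeas (fun y => c%:E * F y).
Proof. by move=> c0 pF; apply: pmM => //; exact: pm_cst. Qed.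

Lemma max_modular_scale G th a D (c : R) F : growth th a D -> (0 < c)%R -> pmeas F ->
  \int[mu]_x young_mod th (c%:E * maxavg G F x) <=
  2%:E * \int[mu]_x young_mod th ((4 * a * c)%:E * F x).
Proof.
move=> g c0 pF; have c40 : (0 < 4 * c)%R by rewrite mulr_gt0.
have pc := pmZ (ltW c40) pF.
have := max_modular G g pc.
rewrite (_ : \int[mu]_x _ = \int[mu]_x young_mod th (c%:E * maxavg G F x)).
  move=> /le_trans; apply; rewrite le_eqVlt; apply/orP; left; apply/eqP.
  congr (_ * _); apply: eq_integral => x _.
  by rewrite muleA -EFinM; congr (young_mod _ (_%:E * _)); ring.
apply: eq_integral => x _; rewrite maxavgZ// !muleA -!EFinM.
by congr (young_mod _ (_%:E * _)); field.
Qed.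

Lemma max_max_modular G th a D (c : R) F : growth th a D -> (0 < c)%R -> pmeas F ->
  \int[mu]_x young_mod th (c%:E * maxavg G (maxavg G F) x) <=
  4%:E * \int[mu]_x young_mod th (((4 * a) ^+ 2 * c)%:E * F x).
Proof.
move=> g c0 pF; have a0 : (0 < 4 * a)%R by rewrite mulr_gt0// (lt_trans _ (growth_a g)).
apply: (le_trans (max_modular_scale G g c0 (pm_maxavg G pF))).
have := max_modular_scale G g (mulr_gt0 a0 c0) pF.
move=> h; rewrite (_ : 4%:E = 2%:E * 2%:E); last by rewrite -EFinM; congr EFin; ring.
rewrite -muleA; apply: lee_wpmul2l; first by rewrite lee_fin.
apply: (le_trans h); apply: lee_wpmul2l; first by rewrite lee_fin.
by rewrite (_ : (4 * a) ^+ 2 * c = 4 * a * (4 * a * c))%R; last by ring.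
Qed.

Variable kappa : R.

(** The dyadic model of the Riesz potential: on cubes of side L in dimension n
    the operator v^kappa E_k has kernel L^(n kappa - n). *)
Definition fint G m F x : \bar R :=
  \sum_(k < m) (vol G k `^ kappa)%:E * avg G k F x.

Let lam0 G k : 0 <= (vol G k `^ kappa)%:E. Proof. by rewrite lee_fin powR_ge0. Qed.

Lemma pm_fint G m F : pmeas F -> pmeas (fint G m F).
Proof. by move=> pF; apply: pm_sum => k; apply: pmM; [exact: pm_cst|exact: pm_avg]. Qed.

Lemma fintZ G m (c : R) F x : (0 <= c)%R -> pmeas F ->
  fint G m (fun y => c%:E * F y) x = c%:E * fint G m F x.
Proof.
move=> c0 pF; rewrite /fint ge0_sume_distrr; last first.
  by move=> k _; apply: mule_ge0 => //; case: (pm_avg G k pF).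
by apply: eq_bigr => k _; rewrite avgZ// muleCA.
Qed.

(** Jensen's inequality in elementary form: where F exceeds U, it is at most
    its modular divided by th(U). *)
Lemma avg_le_level G th a D k F x (U : R) : growth th a D -> pmeas F ->
  \int[mu]_x young_mod th (F x) <= 1 -> (0 < U)%R ->
  (1 <= vol G k * young_of th U)%R -> avg G k F x <= (2 * U)%:E.
Proof.
move=> g pF F1 U0 h; have t0 := growth_pos g U0.
have tV : (0 <= (th U)^-1)%R by rewrite invr_ge0 ltW.
have pm := pm_young_mod g pF.
have U0' : 0 <= U%:E by rewrite lee_fin ltW.
have pU := @pm_cst _ T R _ U0'.
apply: (@le_trans _ _ (avg G k (fun y => U%:E + ((th U)^-1)%:E * young_mod th (F y)) x)).
  apply: le_avg => //; first by apply: pmD => //; exact: pmZ.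
  move=> y; case: (F y) (pF.2 y) => [r| |]//; rewrite ?lee_fin => r0 /=; last first.
    by rewrite gt0_muley ?lte_fin ?invr_gt0// addey.
  case: (lerP r U) => rU.
    by apply: (le_trans rU); rewrite lerDl mulr_ge0// (young_of_ge0 _ g).
  apply: ler_wpDl; first exact: ltW.
  rewrite mulrC ler_pdivlMr// /young_of; apply: ler_wpM2l => //.
  by apply: (growth_mono g); exact: ltW.
rewrite avgD//; last exact: pmZ.
rewrite avg_cst ?lee_fin ?(ltW U0)// avgZ// ?lee_fin//.
rewrite (_ : (2 * U)%:E = U%:E + U%:E); last by rewrite -EFinD; congr EFin; ring.
apply: leeD => //.
apply: (@le_trans _ _ (((th U)^-1)%:E * ((vol G k)^-1)%:E)).
  apply: lee_wpmul2l; first by rewrite lee_fin.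
  apply: (le_trans (avg_le_int G k x pm)); rewrite -[leRHS]mule1.
  by apply: lee_wpmul2l => //; exact: volV_ge0.
rewrite -EFinM lee_fin -invfM -[leLHS]mul1r ler_pdivrMr; last first.
  by rewrite mulr_gt0// vol_gt0.
by rewrite (_ : U * (th U * vol G k) = vol G k * young_of th U)%R // /young_of; ring.
Qed.

Lemma fint_modular thP aP DP thS aS DS C0 :
  growth thP aP DP -> growth thS aS DS -> (0 < kappa)%R -> (0 < C0)%R ->
  index_condition thP thS kappa C0 ->
  exists2 K : R, (0 < K)%R & forall G m F, pmeas F ->
    \int[mu]_x young_mod thP ((4 * aP)%:E * F x) <= 1 ->
    \int[mu]_x young_mod thS ((K^-1)%:E * fint G m F x) <= 2%:E.
Proof.
move=> gP gS k0 C00 hC; have [K K0 hK] := hedberg_sum gP gS k0 C00 hC.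
have aP1 := growth_a gP.
exists K => // G m F pF F1.
have KV : (0 <= K^-1)%R by rewrite invr_ge0 ltW.
have pM := pm_maxavg G pF.
have F1' : \int[mu]_x young_mod thP (F x) <= 1.
  apply: le_trans F1; apply: intle.
  - exact: pm_young_mod gP _.
  - by apply: (pm_young_mod gP); apply: pmZ => //; lra.
  - move=> x; apply: (le_young_mod gP); rewrite -[leLHS]mul1e.
    by apply: lee_wpmul2r; [case: pF|rewrite lee_fin; lra].
apply: (@le_trans _ _ (\int[mu]_x young_mod thP (maxavg G F x))); last first.
  have := max_modular_scale G gP ltr01 pF; rewrite mulr1.
  under eq_integral do rewrite mul1e.
  move=> /le_trans; apply; rewrite -[leRHS]mule1; apply: lee_wpmul2l => //.
apply: intle.
- by apply: (pm_young_mod gS); apply: pmZ => //; exact: pm_fint.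
- exact: pm_young_mod gP _.
move=> x; have := pM.2 x; case E : (maxavg G F x) => [u| |]// u0; last by rewrite leey.
rewrite lee_fin in u0.
pose e k : R := fine (avg G k F x).
have eu k : avg G k F x <= u%:E by rewrite -E avg_le_max.
have eE k : avg G k F x = (e k)%:E.
  rewrite fineK// ge0_fin_numE; first by rewrite (le_lt_trans (eu k))// ltry.
  by case: (pm_avg G k pF).
have -> : fint G m F x = (\sum_(k < m) vol G k `^ kappa * e k)%:E.
  by rewrite -sumEFin; apply: eq_bigr => k _; rewrite eE.
rewrite -EFinM /= lee_fin mulrC; apply: (hK (vol G) q e) => //.
- exact: vol_gt0.
- exact: vol_step.
- by move=> k; rewrite -lee_fin -eE; case: (pm_avg G k pF).
- by move=> k; rewrite -lee_fin -eE.
- move=> k U U0 hU; rewrite -lee_fin -eE; exact: (avg_le_level x gP pF F1' U0 hU).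
Qed.

End fractional.

(** * The dyadic commutator *)

Section absorption.
Context {R : realType}.

Lemma absorb (X Z : \bar R) (L : R) : (1 <= L)%R -> X < +oo -> 0 <= X -> 0 <= Z ->
  X <= ((2 * L)^-1)%:E * (L%:E * X + Z) -> X <= Z.
Proof.
move=> L1; case: X => [x| |]//; case: Z => [z| |]// _ x0 z0; rewrite ?leey//.
rewrite -EFinM !lee_fin in x0 z0 *.
rewrite mulrC ler_pdivlMr ?mulr_gt0//; last by lra.
move=> h; have : (0 <= (L - 1) * x)%R by rewrite mulr_ge0//; lra.
by lra.
Qed.

End absorption.

Section commutator.
Context {d} {T : measurableType d} {R : realType}.
Variable mu : {sigma_finite_measure set T -> \bar R}.
Context {q : R}.
Hypothesis q2 : (2 <= q)%R.
Variable kappa : R.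
Implicit Types (u F w H : T -> \bar R) (k j l m n : nat) (G : grid mu q).
Implicit Types (b : T -> R) (c : nat -> T -> R).

(** The dyadic model of the commutator; [osc_out] and [osc_in] below are the
    parts of it in which b is compared with its cell mean at the outer point x
    and at the integration variable. *)
Definition dyadic_comm G b m F x : \bar R := \sum_(k < m)
  (vol G k `^ kappa)%:E * avg G k (fun y => `|b x - b y|%:E * F y) x.

Definition osc_out G b c m F x : \bar R := \sum_(k < m)
  (vol G k `^ kappa)%:E * (osc b c k x * avg G k F x).

Definition osc_in G b c m F x : \bar R := \sum_(k < m)
  (vol G k `^ kappa)%:E * avg G k (fun y => osc b c k y * F y) x.

Let lam0 G k : 0 <= (vol G k `^ kappa)%:E. Proof. by rewrite lee_fin powR_ge0. Qed.

Section fixed_bmo.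
Variables (G : grid mu q) (b : T -> R) (c : nat -> T -> R) (B : R).
Hypothesis bc : dyadic_bmo G b c B.

Lemma pm_osc_out m F : pmeas F -> pmeas (osc_out G b c m F).
Proof.
move=> pF; apply: pm_sum => k; apply: pmM; first exact: pm_cst.
by apply: pmM; [exact: pm_osc bc _|exact: pm_avg].
Qed.

Lemma pm_osc_in m F : pmeas F -> pmeas (osc_in G b c m F).
Proof.
move=> pF; apply: pm_sum => k; apply: pmM; first exact: pm_cst.
by apply: pm_avg; apply: pmM => //; exact: pm_osc bc _.
Qed.

Lemma pm_diff x F : pmeas F -> pmeas (fun y => `|b x - b y|%:E * F y).
Proof.
move=> pF; apply: pmM => //; apply: pm_abs; apply: measurable_funB => //.
exact: (bmo_meas bc).
Qed.

Lemma pm_dyadic_comm m F : pmeas F -> pmeas (dyadic_comm G b m F).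
Proof.
move=> pF; apply: pm_sum => k; apply: pmM; first exact: pm_cst.
have pK : pmeas (fun p : T * T => cellind G k p.1 p.2 * (`|b p.1 - b p.2|%:E * F p.2)).
  apply: pmM; first exact: pm_cellind2.
  apply: pmM; last exact: pm_snd.
  apply: pm_EFin => //; apply: measurableT_comp => //.
  have mb := bmo_meas bc.
  by apply: measurable_funB; exact: measurableT_comp.
split => [|x]; last by have [] := pm_avg G k (pm_diff x pF).
rewrite (_ : (fun _ => _) = fun x => ((vol G k)^-1)%:E *
  \int[mu]_y (cellind G k x y * (`|b x - b y|%:E * F y))); last first.
  by apply/funext => x; rewrite avgE.
apply: emeasurable_funM; first exact: measurable_cst.
exact: (measurable_fun_fubini_tonelli_F _ pK.1 pK.2).
Qed.

Lemma dyadic_comm_le m F x : pmeas F ->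
  dyadic_comm G b m F x <= osc_out G b c m F x + osc_in G b c m F x.
Proof.
move=> pF; rewrite /dyadic_comm /osc_out /osc_in -big_split/=.
apply: lee_sum => k _; have po := pm_osc bc k.
have ox : 0 <= osc b c k x by case: po.
have pa : pmeas (fun y => osc b c k x * F y) by apply: pmM => //; exact: pm_cst.
have pb : pmeas (fun y => osc b c k y * F y) by exact: pmM.
rewrite -(avgZ G k x ox pF) -ge0_muleDr; last 2 first.
- by case: (pm_avg G k pa).
- by case: (pm_avg G k pb).
apply: lee_wpmul2l => //; rewrite -avgD//.
apply: le_avg_cell; [exact: pm_diff|exact: pmD|].
move=> y xy; rewrite -ge0_muleDl//; last by case: po.
apply: lee_wpmul2r; first by case: pF.
rewrite /osc -EFinD lee_fin (bmo_cinv bc xy).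
rewrite [X in (_ <= _ + X)%R]distrC; apply: (le_trans _ (ler_normD _ _)).
by rewrite addrA subrK.
Qed.

Lemma osc_in_le m F x : pmeas F ->
  osc_in G b c m F x <= (bmo_cst (q := q) B)%:E * fint kappa G m (maxavg G (maxavg G F)) x.
Proof.
move=> pF; have pMM := pm_maxavg G (pm_maxavg G pF).
rewrite /osc_in /fint ge0_sume_distrr; last first.
  by move=> k _; apply: mule_ge0 => //; case: (pm_avg G k pMM).
apply: lee_sum => k _; rewrite [leRHS]muleCA; apply: lee_wpmul2l => //.
exact: (bmo_avg q2 bc).
Qed.

(** By self-adjointness of averages the oscillation of b moves from the outside
    of the averages of F to the inside of the averages of g, where [bmo_avg]
    applies. *)
Lemma osc_out_dual m F g : pmeas F -> pmeas g ->
  \int[mu]_x (osc_out G b c m F x * g x) <=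
  (bmo_cst (q := q) B)%:E *
    \int[mu]_x (fint kappa G m F x * maxavg G (maxavg G g) x).
Proof.
move=> pF pg; have pMM := pm_maxavg G (pm_maxavg G pg).
have C0 : 0 <= (bmo_cst (q := q) B)%:E by rewrite lee_fin ltW// (bmo_cst_gt0 q2 (bmo_gt0 bc)).
have pO := pm_osc bc.
have pA k := pm_avg G k pF.
have p1 k : pmeas (fun x => (vol G k `^ kappa)%:E * (osc b c k x * avg G k F x) * g x).
  by apply: pmM => //; apply: pmM; [exact: pm_cst|exact: pmM].
have p2 k : pmeas (fun x => (vol G k `^ kappa)%:E * avg G k F x * maxavg G (maxavg G g) x).
  by apply: pmM => //; apply: pmM => //; exact: pm_cst.
rewrite (_ : \int[mu]_x _ = \int[mu]_x \sum_(k < m)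
    ((vol G k `^ kappa)%:E * (osc b c k x * avg G k F x) * g x)); last first.
  apply: eq_integral => x _; rewrite /osc_out ge0_sume_distrl// => k _.
  by apply: mule_ge0 => //; have [] := pmM (pO k) (pA k).
rewrite (_ : \int[mu]_x (fint kappa G m F x * _) = \int[mu]_x \sum_(k < m)
    ((vol G k `^ kappa)%:E * avg G k F x * maxavg G (maxavg G g) x)); last first.
  apply: eq_integral => x _; rewrite /fint ge0_sume_distrl// => k _.
  by apply: mule_ge0 => //; case: (pA k).
rewrite !int_sum// ge0_sume_distrr; last by move=> k _; exact: intge0.
apply: lee_sum => k _.
have pog : pmeas (fun x => osc b c k x * g x) by exact: pmM.
rewrite (_ : \int[mu]_x _ = (vol G k `^ kappa)%:E *
    \int[mu]_x (avg G k F x * (osc b c k x * g x))); last first.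
  rewrite -intZ//; last exact: pmM.
  apply: eq_integral => x _; rewrite -muleA; congr (_ * _).
  by rewrite [osc b c k x * avg G k F x]muleC -muleA.
rewrite (_ : \int[mu]_x (_ * _ * maxavg _ _ _) = (vol G k `^ kappa)%:E *
    \int[mu]_x (avg G k F x * maxavg G (maxavg G g) x)); last first.
  rewrite -intZ//; last exact: pmM.
  by apply: eq_integral => x _; rewrite -muleA.
rewrite [leRHS]muleCA; apply: lee_wpmul2l => //.
rewrite -(avg_int (G := G) (k := k) (pA k) pog (avg_inv _)).
rewrite -(avg_int (G := G) (k := k) (pA k) pMM (avg_inv _)).
rewrite -intZ//; last by apply: pmM => //; exact: pm_avg.
apply: intle.
- by apply: pmM => //; exact: pm_avg.
- by apply: pmM; [exact: pm_cst|apply: pmM => //; exact: pm_avg].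
move=> x; rewrite [leRHS]muleCA; apply: lee_wpmul2l; first by case: (pA k).
exact: (bmo_avg q2 bc).
Qed.

End fixed_bmo.

(** Test I = [osc_out] against the slope of Psi at I; then the dual modular of
    the test function is again bounded by the modular of I.  The constant K is
    so large that Young's inequality returns half of the modular of I, which is
    absorbed after truncation to a finite modular. *)
Lemma osc_out_modular thS aS DS B : growth thS aS DS -> (0 < B)%R ->
  exists2 K : R, (0 < K)%R & forall G b c m F, dyadic_bmo G b c B -> pmeas F ->
  \int[mu]_x young_mod thS ((2^-1)%:E * osc_out G b c m F x) <=
  \int[mu]_x young_mod thS (K%:E * fint kappa G m F x).
Proof.
move=> g B0; have gd := growth_dual g.
have [n0 hn0] := expr2_unbounded ((4 * DS) ^+ 2 * 1)%R.
have aS1 := growth_a g; have DS1 := growth_D g.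
(* The dual modular of M M g is at most L times the modular of I: the factor 4
   comes from two uses of the maximal theorem, (2 aS)^n0 from their dilations,
   and aS from composing the slope with its inverse. *)
pose L := (4 * (2 * aS) ^+ n0 * aS)%R.
have L1 : (1 <= L)%R.
  have h : (1 <= (2 * aS) ^+ n0)%R by apply: exprn_ege1; lra.
  rewrite /L -[leLHS]mul1r; apply: ler_pM; [by []|by []| |exact: ltW].
  by rewrite -[leLHS]mul1r; apply: ler_pM; [by []|by []|lra|exact: h].
pose Cb := bmo_cst (q := q) B.
have Cb0 : (0 < Cb)%R by exact: bmo_cst_gt0.
have L0 : (0 < L)%R by lra.
have K0 : (0 < 2 * Cb * L)%R by apply: mulr_gt0 => //; exact: mulr_gt0.
exists (2 * Cb * L)%R => [//|G b c m F bc pF].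
move: K0; set K := (2 * Cb * L)%R => K0.
have /sigma_finiteP[S [ST ndS Soo]] := sigma_finiteT mu.
have mS n : measurable (S n) by case: (Soo n).
have ph := pm_osc_out bc m pF; set h := osc_out G b c m F in ph *.
(* Truncations of I in height and in support have finite modular. *)
pose hN n x : R := (fine (mine (h x) n%:R%:E) * \1_(S n) x)%R.
have hNE n x : (hN n x)%:E = mine (h x) n%:R%:E * (\1_(S n) x)%:E.
  rewrite /hN EFinM fineK// ge0_fin_numE; last by rewrite le_min ph.2 lee_fin ler0n.
  by rewrite gt_min ltry orbT.
have hN0 n x : (0 <= hN n x)%R.
  rewrite -lee_fin hNE; apply: mule_ge0; last by rewrite lee_fin.
  by rewrite le_min ph.2 lee_fin ler0n.
have phN n : pmeas (fun x => (hN n x)%:E).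
  under eq_fun do rewrite hNE.
  apply: pmM; last exact: pm_indic.
  by apply: pm_min => //; apply: pm_cst; rewrite lee_fin.
have hNh n x : (hN n x)%:E <= h x.
  rewrite hNE -[leRHS]mule1; apply: lee_pmul.
  - by rewrite le_min ph.2 lee_fin ler0n.
  - by rewrite lee_fin.
  - by rewrite ge_min lexx.
  - by rewrite lee_fin indicE; case: (_ \in _).
apply: (fatou_young_mod (F := fun n x => (hN n x)%:E) g) => //.
- move=> x t ht; have [N0 _ xN0] : (\bigcup_i S i) x by rewrite -ST.
  have := archi_boundP (normr_ge0 t); set N1 := Num.bound _ => hN1.
  exists (maxn N0 N1) => n; rewrite geq_max => /andP[n0' n1].
  have xn : S n x by move: x xN0 {ht}; exact/subsetPset/ndS.
  rewrite hNE indicE mem_set// mule1 le_min ltW//= lee_fin.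
  by rewrite (le_trans (ler_norm _))// (le_trans (ltW hN1))// ler_nat.
move=> n.
set X := (X in X <= _); set Z := (X in _ <= X).
pose gg x : \bar R := (thS (hN n x))%:E.
have mth : measurable_fun setT thS.
  by apply: nondecreasing_measurable => // x y; exact: (growth_mono g).
have pgg : pmeas gg.
  apply: pm_EFin; last by move=> x; exact: growth_ge0 _ g.
  by apply: measurableT_comp => //; apply/measurable_EFinP; case: (phN n).
have pA := pm_fint kappa G m pF.
have pMM := pm_maxavg G (pm_maxavg G pgg).
have pX := pm_young_mod g (phN n).
have X1 : X < +oo.
  apply: (@le_lt_trans _ _ (\int[mu]_x ((young_of thS n%:R)%:E * (\1_(S n) x)%:E))).
    have y0 : 0 <= (young_of thS n%:R)%:E by rewrite lee_fin (young_of_ge0 _ g).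
    apply: intle; [exact: pX|by apply: pmM; [exact: pm_cst|exact: pm_indic]|].
    move=> x; have [xS|xS] := pselect (S n x).
      rewrite indicE mem_set// mule1 /=; rewrite lee_fin; apply: (young_of_mono g).
      by rewrite -lee_fin hNE indicE mem_set// mule1 ge_min lexx orbT.
    rewrite hNE indicE memNset// !mule0 /= /young_of mul0r.
    by [].
  rewrite intZ//; [|by rewrite lee_fin (young_of_ge0 _ g)|exact: pm_indic].
  rewrite integral_indic// setIT; have [_ Soon] := Soo n.
  by rewrite lte_mul_pinfty// ?lee_fin ?(young_of_ge0 _ g).
have XE : X <= \int[mu]_x (h x * gg x).
  apply: intle => //; first exact: pmM.
  move=> x; rewrite /= /young_of EFinM; apply: lee_wpmul2r => //.
  exact: (pgg.2 x).
have dual := osc_out_dual bc m pF pgg.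
have om : \int[mu]_x young_mod (gdual thS) (maxavg G (maxavg G gg) x) <= L%:E * X.
  have := max_max_modular G gd ltr01 pgg.
  under eq_integral do rewrite mul1e.
  move=> /le_trans; apply.
  rewrite (_ : L%:E = 4%:E * ((2 * aS) ^+ n0 * aS)%:E); last first.
    by rewrite -EFinM; congr EFin; rewrite /L mulrA.
  rewrite -[leRHS]muleA; apply: lee_wpmul2l; first by rewrite lee_fin.
  rewrite /X -intZ//; last by rewrite lee_fin mulr_ge0// ?exprn_ge0//; lra.
  apply: intle.
  - by apply: (pm_young_mod gd); apply: pmZ => //; rewrite mulr_ge0// exprn_ge0//; lra.
  - by apply: pmZ => //; rewrite mulr_ge0 ?exprn_ge0//; lra.
  move=> x; apply: (@le_trans _ _ (young_mod (gdual thS) ((2 ^+ n0)%:E * gg x))).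
    apply: (le_young_mod gd); apply: lee_wpmul2r; first by case: pgg.
    by rewrite lee_fin ltW.
  apply: (le_trans (young_mod_doubling n0 gd (pgg.2 x))).
  rewrite EFinM -muleA; apply: lee_wpmul2l; first by rewrite lee_fin exprn_ge0//; lra.
  exact: (young_mod_gdual g).
have pair : \int[mu]_x (fint kappa G m F x * maxavg G (maxavg G gg) x) <=
    (K^-1)%:E * (L%:E * X + Z).
  have KV : (0 <= K^-1)%R by rewrite invr_ge0 ltW.
  have po := pm_young_mod gd pMM.
  have pz := pm_young_mod g (pmZ (ltW K0) pA).
  apply: (@le_trans _ _ ((K^-1)%:E *
    (\int[mu]_x young_mod (gdual thS) (maxavg G (maxavg G gg) x) + Z))).
    rewrite /Z -intD// -intZ//; last exact: pmD.
    apply: intle; [exact: pmM|by apply: pmZ => //; exact: pmD|].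
    move=> x; apply: (young_mod_dual g K0); first by case: pA.
    by case: pMM.
  by apply: lee_wpmul2l; [rewrite lee_fin|exact: leeD].
have Z0 : 0 <= Z by apply: intge0; exact: pm_young_mod g (pmZ (ltW K0) pA).
apply: (absorb L1 X1 (intge0 _ pX) Z0).
apply: (le_trans XE); apply: (le_trans dual).
rewrite (_ : ((2 * L)^-1)%R = (Cb * K^-1)%R); last first.
  by rewrite /K; field; rewrite !gt_eqF.
rewrite [(Cb * K^-1)%:E]EFinM -[leRHS]muleA; apply: lee_wpmul2l => //.
by rewrite lee_fin ltW.
Qed.

Lemma osc_outZ G b c B m (t : R) F x : dyadic_bmo G b c B -> (0 <= t)%R -> pmeas F ->
  osc_out G b c m (fun y => t%:E * F y) x = t%:E * osc_out G b c m F x.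
Proof.
move=> bc t0 pF; rewrite /osc_out ge0_sume_distrr; last first.
  move=> k _; apply: mule_ge0 => //; apply: mule_ge0; first by case: (pm_osc bc k).
  by case: (pm_avg G k pF).
apply: eq_bigr => k _; rewrite avgZ ?lee_fin//.
by rewrite [RHS]muleCA; congr (_ * _); rewrite muleCA.
Qed.

Lemma int_young_mod_le th a D (s t : R) F : growth th a D -> (0 <= s <= t)%R ->
  pmeas F -> \int[mu]_x young_mod th (s%:E * F x) <= \int[mu]_x young_mod th (t%:E * F x).
Proof.
move=> g /andP[s0 st] pF; apply: intle.
- exact: pm_young_mod g (pmZ s0 pF).
- exact: pm_young_mod g (pmZ (le_trans s0 st) pF).
- move=> x; apply: (le_young_mod g); apply: lee_wpmul2r; first by case: pF.
  by rewrite lee_fin.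
Qed.

Lemma dyadic_comm_modular thP aP DP thS aS DS C0 B :
  growth thP aP DP -> growth thS aS DS -> (0 < kappa)%R -> (0 < C0)%R ->
  index_condition thP thS kappa C0 -> (0 < B)%R ->
  exists2 K : R, (0 < K)%R & forall G b c m F, dyadic_bmo G b c B -> pmeas F ->
    \int[mu]_x young_mod thP (K%:E * F x) <= 1 ->
    \int[mu]_x young_mod thS (dyadic_comm G b m F x) <= 4%:E.
Proof.
move=> gP gS k0 C00 hC B0.
have [K1 K10 hK1] := osc_out_modular gS B0.
have [K2 K20 hK2] := fint_modular mu q2 gP gS k0 C00 hC.
pose Cb := bmo_cst (q := q) B.
have Cb0 : (0 < Cb)%R by exact: bmo_cst_gt0.
have aP0 : (0 < aP)%R by rewrite (lt_trans _ (growth_a gP)).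
have a40 : (0 < 4 * aP)%R by rewrite mulr_gt0.
(* Dilations of F that make each of the two parts have modular at most 2: t1
   for the outer part, t2 and t3 for the inner one and its two maximal
   functions. *)
pose t1 := (4 * K1 * K2)%R.
pose t2 := (2 * Cb * K2)%R.
have t10 : (0 < t1)%R by apply: mulr_gt0 => //; exact: mulr_gt0.
have t20 : (0 < t2)%R by apply: mulr_gt0 => //; exact: mulr_gt0.
pose t3 := (4 * ((4 * aP) ^+ 2 * (4 * aP * t2)))%R.
have t30 : (0 < t3)%R.
  by apply: mulr_gt0 => //; apply: mulr_gt0; [exact: exprn_gt0|exact: mulr_gt0].
have at1 : (0 < 4 * aP * t1)%R by exact: mulr_gt0.
exists (4 * aP * t1 + t3)%R; first exact: addr_gt0.
move=> G b c m F bc pF F1.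
have le_part t : (0 <= t <= 4 * aP * t1 + t3)%R ->
    \int[mu]_x young_mod thP (t%:E * F x) <= 1.
  by move=> ht; apply: le_trans F1; exact: int_young_mod_le gP ht pF.
have pM := pm_maxavg G pF; have pMM := pm_maxavg G pM.
have po := pm_osc_out bc m pF; have pi := pm_osc_in bc m pF.
have h20 : (0 <= 2 :> R)%R by [].
apply: (@le_trans _ _ (\int[mu]_x (young_mod thS (2%:E * osc_out G b c m F x) +
    young_mod thS (2%:E * osc_in G b c m F x)))).
  apply: intle.
  - exact: pm_young_mod gS (pm_dyadic_comm bc m pF).
  - by apply: pmD; apply: pm_young_mod gS (pmZ h20 _).
  - move=> x; apply: (le_trans (le_young_mod gS (dyadic_comm_le bc m x pF))).
    by apply: (young_modD gS); [case: po|case: pi].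
rewrite intD; [|exact: pm_young_mod gS (pmZ h20 po)|exact: pm_young_mod gS (pmZ h20 pi)].
rewrite (_ : 4%:E = 2%:E + 2%:E); last by rewrite -EFinD; congr EFin; ring.
apply: leeD.
- have p4 : pmeas (fun x => 4%:E * F x) by exact: pmZ.
  rewrite (_ : \int[mu]_x _ =
      \int[mu]_x young_mod thS ((2^-1)%:E * osc_out G b c m (fun y => 4%:E * F y) x)); last first.
    apply: eq_integral => x _; rewrite (osc_outZ m x bc _ pF)// muleA -EFinM.
    by congr (young_mod _ (_%:E * _)); field.
  apply: (le_trans (hK1 G b c m _ bc p4)).
  rewrite (_ : \int[mu]_x _ =
      \int[mu]_x young_mod thS ((K2^-1)%:E * fint kappa G m (fun y => t1%:E * F y) x)); last first.
    apply: eq_integral => x _; rewrite !fintZ//; last exact: ltW.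
    rewrite !muleA -!EFinM; congr (young_mod _ (_%:E * _)).
    by rewrite /t1; field; rewrite gt_eqF.
  apply: hK2; first exact: pmZ (ltW t10) pF.
  under eq_integral do rewrite muleA -EFinM.
  by apply: le_part; rewrite ltW//= lerDl ltW.
- apply: (@le_trans _ _ (\int[mu]_x young_mod thS ((K2^-1)%:E *
      fint kappa G m (fun y => t2%:E * maxavg G (maxavg G F) y) x))).
    have pt := pmZ (ltW t20) pMM.
    apply: intle.
    + exact: pm_young_mod gS (pmZ h20 pi).
    + apply: pm_young_mod gS (pmZ _ (pm_fint kappa G m pt)).
      by rewrite invr_ge0 ltW.
    + move=> x; apply: (le_young_mod gS); rewrite fintZ//; last exact: ltW.
      rewrite muleA -EFinM (_ : (K2^-1 * t2)%R = (2 * Cb)%R); last first.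
        by rewrite /t2; field; rewrite gt_eqF.
      rewrite [(2 * Cb)%:E]EFinM -[leRHS]muleA; apply: lee_wpmul2l => //.
      exact: (osc_in_le bc).
  apply: hK2; first exact: pmZ (ltW t20) pMM.
  under eq_integral do rewrite muleA -EFinM.
  have at2 : (0 < 4 * aP * t2)%R by exact: mulr_gt0.
  apply: (le_trans (max_max_modular G gP at2 pF)).
  have := le_part t3; rewrite (ltW t30)/= lerDr (ltW at1) => /(_ isT) h.
  rewrite -[leRHS](_ : 4%:E * (4^-1)%:E = _); last by rewrite -EFinM divff.
  apply: lee_wpmul2l; first by rewrite lee_fin.
  apply: (@le_trans _ _ ((4^-1)%:E * \int[mu]_x young_mod thP (t3%:E * F x))); last first.
    by rewrite -[leRHS]mule1; apply: lee_wpmul2l => //; rewrite lee_fin.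
  have h40 : 0 <= (4^-1)%:E :> \bar R by rewrite lee_fin.
  have pt3 := pm_young_mod gP (pmZ (ltW t30) pF).
  rewrite -intZ//; apply: intle.
  + apply: pm_young_mod gP (pmZ _ pF).
    by rewrite ltW// mulr_gt0// exprn_gt0.
  + by apply: pmM => //; exact: pm_cst.
  + move=> x; apply: (le_trans _ (young_modZ (t3%:E * F x) gP _)); last by apply/andP; split; lra.
    rewrite muleA -EFinM (_ : (4^-1 * t3)%R = ((4 * aP) ^+ 2 * (4 * aP * t2))%R)//.
    by rewrite /t3; field.
Qed.

End commutator.

(** * The shifted dyadic grids of Euclidean space *)

Local Close Scope ereal_scope.

Section euclidean_grid.
Context {R : realType} (n : nat).
Local Notation E := (euclidean R n).
Local Notation mu := (@lebesgue_tuple R n).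
Variables (N : nat) (t : {ffun 'I_n -> bool}).

Definition ecell k (x : E) : set E :=
  [set y | forall i, gidx N (t i) k (tnth x i) = gidx N (t i) k (tnth y i)].

Lemma measurable_forall_ord d (T : measurableType d) m (P : 'I_m -> set T) :
  (forall i, measurable (P i)) -> measurable [set x | forall i, P i x].
Proof.
move=> mP; rewrite (_ : [set x | _] = \bigcap_(i in [set: 'I_m]) P i).
  by apply: fin_bigcap_measurable => //; exact: finite_finset.
by apply/seteqP; split => x /= h i //; exact: h.
Qed.

Lemma ecell_meas k : measurable [set p : E * E | ecell k p.1 p.2].
Proof.
apply: measurable_forall_ord => i.
have m1 : measurable_fun [set: E * E] (fun p : E * E => (gidx N (t i) k (tnth p.1 i))%:~R : R).
  apply: (measurableT_comp (measurable_gidx N (t i) k)).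
  by apply: (measurableT_comp (measurable_tnth i)).
have m2 : measurable_fun [set: E * E] (fun p : E * E => (gidx N (t i) k (tnth p.2 i))%:~R : R).
  apply: (measurableT_comp (measurable_gidx N (t i) k)).
  by apply: (measurableT_comp (measurable_tnth i)).
have := measurable_fun_eqr m1 m2 => /(_ measurableT [set true] I).
rewrite setTI; congr measurable; apply/seteqP; split => -[x y] /=.
  by move=> /eqP/intr_inj.
by move=> ->; rewrite eqxx.
Qed.

Lemma ecell_vol k x : mu (ecell k x) = (side N k ^+ n)%:E.
Proof.
pose A i : set (measurableTypeR R) := [set y | gidx N (t i) k (tnth x i) = gidx N (t i) k y].
have AE i : A i = `[side N k * ((gidx N (t i) k (tnth x i))%:~R + shift (t i) k),
   side N k * ((gidx N (t i) k (tnth x i))%:~R + shift (t i) k + 1)[%classic.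
  apply/seteqP; split => y /=; rewrite in_itv/=.
    by rewrite /A/= => ->; have [-> ->] := gidx_bounds N (t i) k y.
  by move=> /andP[h1 h2]; rewrite /A/=; apply/esym/gidxP.
have mA i : measurable (A i) by rewrite AE; exact: measurable_itv.
rewrite (_ : ecell k x = [set y | forall i, A i (tnth y i)])//.
rewrite lebesgue_tuple_box//.
rewrite (eq_bigr (fun=> (side N k)%:E)); last first.
  move=> i _; rewrite AE lebesgue_measure_itv/= lte_fin.
  have s0 := side_gt0 (R := R) N k.
  rewrite ltr_pM2l// ltrDl ltr01 -EFinB; congr EFin; ring.
by rewrite prodEFin prodr_const card_ord.
Qed.

(** The half-space x_i > a is the union over k of the sets where the lower end
    point of the k-th interval around x_i exceeds a. *)
Lemma ecell_gen : @measurable _ E `<=` <<s [set A : set E | measurable A /\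
    exists k, forall x y, ecell k x y -> A x -> A y] >>.
Proof.
set S := [set A | _].
rewrite [X in X `<=` _]/measurable/=.
apply: smallest_sub; first exact: smallest_sigma_algebra.
rewrite -bigcup_seq => A [i _ [Y mY <-]].
rewrite setTI.
suff : image_set_system setT (fun x : E => tnth x i) <<s S >> Y.
  by rewrite /image_set_system/= setTI.
have sa : sigma_algebra [set: measurableTypeR R]
    (image_set_system setT (fun x : E => tnth x i) <<s S >>).
  by apply: sigma_algebra_image; exact: smallest_sigma_algebra.
have mY' : (@RGenOInfty.G R).-sigma.-measurable Y by rewrite -RGenOInfty.measurableE.
move: Y mY' {mY}; apply: smallest_sub => // _ [a ->].
rewrite /image_set_system/= setTI.
pose lo k (x : E) : R := side N k * ((gidx N (t i) k (tnth x i))%:~R + shift (t i) k).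
rewrite (_ : _ @^-1` _ = \bigcup_k [set x | a < lo k x]); last first.
  apply/seteqP; split => x /=; rewrite in_itv/= andbT.
    move=> ax; have e0 : 0 < tnth x i - a by rewrite subr_gt0.
    have [k hk] := expr2_unbounded (2 ^+ N / (tnth x i - a)).
    exists k => //=; have [h1 h2] := gidx_bounds N (t i) k (tnth x i).
    have : side N k < tnth x i - a.
      by rewrite /side ltr_pdivrMr ?exprn_gt0// mulrC -ltr_pdivrMr.
    rewrite /lo; lra.
  move=> [k _ /= h]; have [h1 h2] := gidx_bounds N (t i) k (tnth x i).
  exact: lt_le_trans h1.
apply: sigma_algebra_bigcup => k; apply: sub_sigma_algebra; split.
  have ml : measurable_fun setT (lo k).
    apply: measurable_funM => //; apply: measurable_funD => //.
    apply: (measurableT_comp (measurable_gidx N (t i) k)).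
    exact: measurable_tnth.
  rewrite [X in measurable X](_ : _ = setT `&` lo k @^-1` `]a, +oo[%classic).
    exact: ml.
  by apply/seteqP; split => x /=; rewrite in_itv/= andbT// => -[].
by exists k => x y xy /=; rewrite /lo (xy i).
Qed.

Definition egrid : grid mu (2 ^+ n : R).
Proof.
refine (@Grid _ _ _ _ _ ecell (fun k => side N k ^+ n) _ _ _ ecell_meas ecell_vol _ _ ecell_gen).
- by [].
- move=> k x y xy; apply/seteqP; split => z h i; first by rewrite -xy; exact: h.
  by rewrite xy; exact: h.
- by move=> k x y h i; exact: gidx_nest (h i).
- by move=> k; rewrite exprn_gt0// side_gt0.
- by move=> k; rewrite [in LHS]sideS exprMn.
Defined.

End euclidean_grid.

Section balls.
Context {R : realType} {n : nat}.
Local Notation E := (euclidean R n).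
Local Notation mu := (@lebesgue_tuple R n).

Lemma coord_le_dist (x y : E) i : `|tnth x i - tnth y i| <= euclidean_dist x y.
Proof.
rewrite -sqrtr_sqr; apply: ler_wsqrtr.
rewrite (bigD1 i)//= lerDl; apply: sumr_ge0 => j _; exact: sqr_ge0.
Qed.

Lemma dist_lt_coord (x y : E) (l : R) : 0 < l -> (forall i, `|tnth x i - tnth y i| <= l) ->
  euclidean_dist x y < n.+1%:R * l.
Proof.
move=> l0 h; have nl : 0 < n.+1%:R * l by rewrite mulr_gt0.
rewrite -[ltRHS]ger0_norm ?ltW// -sqrtr_sqr ltr_sqrt ?exprn_gt0//.
apply: (@le_lt_trans _ _ (\sum_(i < n) l ^+ 2)).
  apply: ler_sum => i _; rewrite -[leLHS]real_normK ?num_real//.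
  by apply: lerXn2r; rewrite ?nnegrE// ltW.
rewrite sumr_const card_ord -[_ *+ n]mulr_natl exprMn.
rewrite ltr_pM2r ?exprn_gt0// -natrX ltr_nat.
by rewrite (leq_trans (ltnSn n))// -{1}[n.+1]expn1 leq_pexp2l.
Qed.

Lemma dist_ge0 (x y : E) : 0 <= euclidean_dist x y.
Proof. exact: sqrtr_ge0. Qed.

Lemma dist0_eq (x y : E) : euclidean_dist x y = 0 -> x = y.
Proof.
move=> h; apply: eq_from_tnth => i; have := coord_le_dist x y i.
by rewrite h normr_le0 subr_eq0 => /eqP.
Qed.

Lemma measurable_dist : measurable_fun setT (fun p : E * E => euclidean_dist p.1 p.2).
Proof.
apply: (@measurableT_comp _ _ _ _ _ _ (@Num.sqrt R)).
  apply: nondecreasing_measurable => // x y; exact: ler_wsqrtr.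
apply: measurable_sum => i; apply: measurable_funX.
apply: measurable_funB.
  by apply: (measurableT_comp (measurable_tnth i)).
by apply: (measurableT_comp (measurable_tnth i)).
Qed.

Lemma measurable_ball x (r : R) : measurable (euclidean_ball x r : set E).
Proof.
have m : measurable_fun [set: E] (fun y => euclidean_dist x y).
  rewrite (_ : (fun y => _) =
    (fun p : E * E => euclidean_dist p.1 p.2) \o (fun y => (x, y)))//.
  by apply: (measurableT_comp measurable_dist); exact: measurable_fun_pair.
rewrite [X in measurable X](_ : _ = setT `&` (fun y => euclidean_dist x y) @^-1` `]-oo, r[%classic).
  exact: m.
by apply/seteqP; split => y /=; rewrite in_itv//= => -[].
Qed.

Lemma ball_sub_box x (r : R) : euclidean_ball x r `<=`
  [set y : E | forall i, `]tnth x i - r, tnth x i + r[%classic (tnth y i)].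
Proof.
move=> y h i /=; rewrite in_itv/=; have := le_lt_trans (coord_le_dist x y i) h.
by rewrite ltr_norml => /andP[h1 h2]; apply/andP; split; lra.
Qed.

Lemma box_vol x (r : R) : 0 < r ->
  mu [set y : E | forall i, `]tnth x i - r, tnth x i + r[%classic (tnth y i)] =
  ((2 * r) ^+ n)%:E.
Proof.
move=> r0; rewrite (lebesgue_tuple_box
  (A := fun i => `]tnth x i - r, tnth x i + r[%classic : set (measurableTypeR R))); last first.
  by move=> i; exact: measurable_itv.
rewrite (eq_bigr (fun=> (2 * r)%:E)); last first.
  move=> i _; rewrite lebesgue_measure_itv/= lte_fin.
  rewrite (_ : _ < _)%R; last by lra.
  by rewrite -EFinB; congr EFin; ring.
by rewrite prodEFin prodr_const card_ord.
Qed.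

Lemma ball_vol_le x (r : R) : 0 < r -> (mu (euclidean_ball x r) <= ((2 * r) ^+ n)%:E)%E.
Proof.
move=> r0; rewrite -(box_vol x r0); apply: le_measure; rewrite ?inE.
- exact: measurable_ball.
- apply: measurable_forall_ord => i.
  rewrite -[X in measurable X]setTI.
  exact: (@measurable_tnth _ (measurableTypeR R) n i measurableT _ (measurable_itv _)).
- exact: ball_sub_box.
Qed.

Lemma cell_sub_ball N (t : {ffun 'I_n -> bool}) k (x : E) : ecell N t k x `<=` euclidean_ball x (n.+1%:R * side N k).
Proof.
move=> y h; apply: dist_lt_coord; first exact: side_gt0.
by move=> i; apply: ltW; apply: (gidx_dist (h i)).
Qed.

End balls.

Local Open Scope ereal_scope.

(** * From balls to dyadic cubes *)

Section cell_average.
Context {d} {T : measurableType d} {R : realType}.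
Variable mu : {sigma_finite_measure set T -> \bar R}.
Context {q : R} (G : grid mu q).
Variable b : T -> R.
Hypothesis mb : measurable_fun setT b.

Definition posf (y : T) : \bar R := (Num.max (b y) 0)%:E.
Definition negf (y : T) : \bar R := (Num.max (- b y) 0)%:E.
(** The mean of b, through positive and negative parts because averages are
    defined for nonnegative functions. *)
Definition cell_mean k x : R := (fine (avg G k posf x) - fine (avg G k negf x))%R.

Lemma pm_posf : pmeas posf.
Proof.
apply: pm_EFin; last by move=> x; rewrite le_max lexx orbT.
by apply: measurable_funrpos.
Qed.

Lemma pm_negf : pmeas negf.
Proof.
apply: pm_EFin; last by move=> x; rewrite le_max lexx orbT.
by apply: measurable_funrneg.
Qed.

Lemma measurable_cell_mean k : measurable_fun setT (cell_mean k).
Proof.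
apply: measurable_funB; apply: measurableT_comp; try exact: fine_measurable.
  by case: (pm_avg G k pm_posf).
by case: (pm_avg G k pm_negf).
Qed.

Lemma cell_mean_inv k : inv_at G k (cell_mean k).
Proof. by move=> x y xy; rewrite /cell_mean !(avg_inv _ xy). Qed.

(** The mean of b differs from any constant beta by at most the mean of
    |b - beta|.  The estimate is carried out on positive and negative parts. *)
Lemma avg_cell_mean k x (beta : R) (D : R) :
  avg G k (fun y => `|b y - beta|%:E) x <= D%:E ->
  avg G k (fun y => `|b y|%:E) x < +oo ->
  avg G k (fun y => `|b y - cell_mean k y|%:E) x <= (D + D)%:E.
Proof.
move=> hD bfin.
have pd : pmeas (fun y => `|b y - beta|%:E).
  by apply: pm_abs; exact: measurable_funB.
have pb := pm_abs mb.
have finp f : pmeas f -> (forall y, f y <= `|b y|%:E) -> avg G k f x = (fine (avg G k f x))%:E.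
  move=> pf h; rewrite fineK// ge0_fin_numE; last by case: (pm_avg G k pf).
  by apply: le_lt_trans bfin; apply: le_avg.
have Ep := finp _ pm_posf.
have En := finp _ pm_negf.
have {}Ep : avg G k posf x = (fine (avg G k posf x))%:E.
  apply: Ep => y; rewrite lee_fin ge_max ler_norm normr_ge0//.
have {}En : avg G k negf x = (fine (avg G k negf x))%:E.
  apply: En => y; rewrite lee_fin ge_max normr_ge0 andbT.
  by rewrite -normrN ler_norm.
set p := fine (avg G k posf x) in Ep; set m := fine (avg G k negf x) in En.
have cx : cell_mean k x = (p - m)%R by [].
have b1 : (0 <= Num.max beta 0)%R by rewrite le_max lexx orbT.
have b2 : (0 <= Num.max (- beta) 0)%R by rewrite le_max lexx orbT.
have pc (r : R) : (0 <= r)%R -> pmeas (fun _ : T => r%:E).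
  by move=> r0; apply: pm_cst; rewrite lee_fin.
have maxE (r : R) : (Num.max r 0 - Num.max (- r) 0 = r)%R.
  rewrite !maxEle; case: (lerP r 0) => h1; case: (lerP (- r) 0) => h2; lra.
have pp := pm_posf; have pn := pm_negf.
have shift_le f g (r s : R) : pmeas f -> pmeas g -> (0 <= r)%R -> (0 <= s)%R ->
    (forall y, f y + r%:E <= g y + s%:E + `|b y - beta|%:E) ->
    avg G k f x + r%:E <= avg G k g x + s%:E + D%:E.
  move=> pf pg r0 s0 h; have pr := pc _ r0; have ps := pc _ s0.
  rewrite -(avg_cst G k x (_ : 0 <= r%:E)) ?lee_fin//.
  rewrite -(avg_cst G k x (_ : 0 <= s%:E)) ?lee_fin//.
  apply: le_trans (leeD (lexx _) hD).
  rewrite -!avgD //; last exact: pmD.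
  apply: le_avg => //; first exact: pmD.
  by apply: pmD => //; exact: pmD.
have key1 : (p + Num.max (- beta) 0 <= m + Num.max beta 0 + D)%R.
  rewrite -lee_fin !EFinD -Ep -En; apply: shift_le => // y.
  rewrite -!EFinD lee_fin.
  have := maxE (b y); have := maxE beta; have := ler_norm (b y - beta); lra.
have key2 : (m + Num.max beta 0 <= p + Num.max (- beta) 0 + D)%R.
  rewrite -lee_fin !EFinD -Ep -En; apply: shift_le => // y.
  rewrite -!EFinD lee_fin.
  have := maxE (b y); have := maxE beta; have := ler_norm (- (b y - beta)); rewrite normrN; lra.
have bD : (`|beta - cell_mean k x| <= D)%R.
  by rewrite cx ler_norml; have e := maxE beta; apply/andP; split; lra.
have D0 : (0 <= D)%R by exact: le_trans bD.
apply: (@le_trans _ _ (avg G k (fun y => `|b y - beta|%:E + D%:E) x)).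
  apply: le_avg_cell.
  - by apply: pm_abs; apply: measurable_funB => //; exact: measurable_cell_mean.
  - exact: (pmD pd (pc _ D0)).
  move=> y /(@cell_mean_inv k) <-; rewrite -EFinD lee_fin.
  apply: le_trans (_ : `|b y - beta| + `|beta - cell_mean k x| <= _)%R; last by rewrite lerD2l.
  by apply: le_trans (ler_normD _ _); rewrite addrA subrK.
rewrite (avgD G k x pd (pc _ D0)).
by rewrite avg_cst ?lee_fin// EFinD; exact: leeD.
Qed.

End cell_average.

Section bmo_grid.
Context {R : realType} {n : nat}.
Local Notation E := (euclidean R n).
Local Notation mu := (@lebesgue_tuple R n).

Lemma int_restrict (A : set E) (f : E -> \bar R) :
  \int[mu]_(y in A) f y = \int[mu]_y ((\1_A y)%:E * f y).
Proof.
rewrite integral_mkcond; apply: eq_integral => y _.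
by rewrite epatch_indic muleC.
Qed.

Lemma avg_le_ball N t k (x : E) (f : E -> \bar R) : pmeas f ->
  avg (@egrid R n N t) k f x <= ((side N k ^+ n)^-1)%:E *
    \int[mu]_(y in euclidean_ball x (n.+1%:R * side N k)%R) f y.
Proof.
move=> pf; rewrite avgE; apply: lee_wpmul2l.
  by rewrite lee_fin invr_ge0 exprn_ge0// ltW// side_gt0.
rewrite int_restrict; apply: intle.
- by apply: pmM => //; exact: pm_cellind.
- by apply: pmM => //; apply: pm_indic; exact: measurable_ball.
move=> y; apply: lee_wpmul2r; first by case: pf.
rewrite /cellind !indicE lee_fin; case: (boolP (y \in _)) => [|_]; last by rewrite ler0n.
by rewrite inE => /cell_sub_ball h; rewrite mem_set.
Qed.

(** The cell around x lies in a ball around x of comparable measure, so the mean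
    of b over the ball is a good constant on the cell, and then so is its mean
    over the cell ([avg_cell_mean]). *)
Lemma bmo_dyadic (b : E -> R) : BMO b ->
  exists2 B : R, (0 < B)%R & forall N t, dyadic_bmo (@egrid R n N t) b (cell_mean (@egrid R n N t) b) B.
Proof.
move=> [[mb bloc] bfin].
have [M M0 hM] : exists2 M : R, (0 < M)%R & bmo_norm b <= M%:E.
  case: (bmo_norm b) bfin => [r _|//|_].
    exists (Num.max r 1%R); first by rewrite lt_max ltr01 orbT.
    by rewrite lee_fin le_max lexx.
  by exists 1%R => //; rewrite leNye.
(* The first factor is the ratio of the volumes of a cube of half-side (n+1) L,
   which contains the ball, and of a cube of side L. *)
pose D := ((2 * n.+1%:R) ^+ n * M)%R.
have D0 : (0 < D)%R by rewrite mulr_gt0// exprn_gt0// mulr_gt0.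
exists (D + D)%R => [|N t]; first exact: addr_gt0.
split => //.
- by move=> k; exact: measurable_cell_mean.
- by move=> k; exact: cell_mean_inv.
- exact: addr_gt0.
move=> k x; have s0 := side_gt0 (R := R) N k.
have v0 : (0 < side N k ^+ n :> R)%R by rewrite exprn_gt0.
have r0 : (0 < n.+1%:R * side N k :> R)%R by rewrite mulr_gt0.
set r := (n.+1%:R * side N k)%R in r0.
have vV : 0 <= ((side N k ^+ n)^-1)%:E :> \bar R by rewrite lee_fin invr_ge0 ltW.
apply: (@avg_cell_mean _ _ _ _ _ _ _ mb k x (ball_average b x r)).
  have pd : pmeas (fun y => `|b y - ball_average b x r|%:E).
    by apply: pm_abs; exact: measurable_funB.
  apply: (le_trans (avg_le_ball N t k x pd)).
  have osc_le : mean_oscillation b x r <= M%:E.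
    by apply: le_trans hM; apply: ereal_sup_ubound; exists (x, r).
  have ballfin : mu (euclidean_ball x r) \is a fin_num.
    by rewrite ge0_fin_numE// (le_lt_trans (ball_vol_le x r0))// ltry.
  have ball0 : mu (euclidean_ball x r) != 0.
    rewrite gt_eqF//; apply: (@lt_le_trans _ _ (side N k ^+ n)%:E); first by rewrite lte_fin.
    rewrite -(ecell_vol N t k x); apply: le_measure; rewrite ?inE.
    - exact: (measurable_cell (@egrid R n N t)).
    - exact: measurable_ball.
    - exact: cell_sub_ball.
  have IE : \int[mu]_(y in euclidean_ball x r) `|b y - ball_average b x r|%:E =
      mu (euclidean_ball x r) * mean_oscillation b x r.
    by rewrite /mean_oscillation muleA divee// mul1e.
  rewrite IE; apply: (@le_trans _ _ (((side N k ^+ n)^-1)%:E * (((2 * r) ^+ n)%:E * M%:E))).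
    apply: lee_wpmul2l => //; apply: (@le_trans _ _ (mu (euclidean_ball x r) * M%:E)).
      exact: lee_wpmul2l.
    by apply: lee_wpmul2r; [rewrite lee_fin ltW|exact: ball_vol_le].
  rewrite -!EFinM lee_fin /D /r mulrA !exprMn.
  have cancel (v a c m : R) : (v != 0 -> v^-1 * (a * (c * v)) * m = a * c * m)%R.
    by move=> ?; field.
  by rewrite cancel// gt_eqF.
have pb := pm_abs mb.
apply: (le_lt_trans (avg_le_ball N t k x pb)).
have /integrableP[_ h] := bloc x r r0.
by apply: lte_mul_pinfty.
Qed.

End bmo_grid.

(** * Domination of the kernel *)

Section kernel.
Context {R : realType} {n : nat}.
Local Notation E := (euclidean R n).
Local Notation mu := (@lebesgue_tuple R n).
Variables (alpha : R) (b : E -> R).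
Hypothesis halpha : (0 < alpha < n%:R)%R.
Hypothesis mb : measurable_fun setT b.

Definition rkernel (x y : E) : R :=
  (`|b x - b y| / euclidean_dist x y `^ (n%:R - alpha))%R.

Lemma rkernel_ge0 x y : (0 <= rkernel x y)%R.
Proof. by rewrite divr_ge0// powR_ge0. Qed.

Lemma measurable_rkernel : measurable_fun setT (fun p : E * E => rkernel p.1 p.2).
Proof.
rewrite (_ : (fun _ => _) = fun p : E * E => (`|b p.1 - b p.2| *
    euclidean_dist p.1 p.2 `^ (- (n%:R - alpha)))%R); last first.
  by apply/funext => p; rewrite powRN.
apply: measurable_funM.
  apply: measurableT_comp => //; apply: measurable_funB; exact: measurableT_comp.
by apply: (measurableT_comp (measurable_powR _) measurable_dist).
Qed.

Lemma pm_rkernel F : pmeas F -> pmeas (fun p : E * E => (rkernel p.1 p.2)%:E * F p.2).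
Proof.
move=> pF; apply: pmM; last exact: pm_snd.
by apply: pm_EFin => [|p]; [exact: measurable_rkernel|exact: rkernel_ge0].
Qed.

Lemma pm_rkernel1 F x : pmeas F -> pmeas (fun y => (rkernel x y)%:E * F y).
Proof.
move=> pF; have [m p] := pm_rkernel pF; split => [|y]; last exact: (p (x, y)).
by apply: (measurableT_comp m (f := _) (g := fun y => (x, y))); exact: measurable_fun_pair.
Qed.

Definition riesz F x := \int[mu]_y ((rkernel x y)%:E * F y).

Lemma pm_riesz F : pmeas F -> pmeas (riesz F).
Proof.
move=> pF; have [m p] := pm_rkernel pF; split.
  exact: (measurable_fun_fubini_tonelli_F _ m p).
by move=> x; apply: intge0; exact: pm_rkernel1.
Qed.

(** For a fixed N only the 2 N scales of a grid with coarsest side 2^N are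
    involved. *)
Definition truncated N (x y : E) : bool :=
  ((2 ^+ N)^-1 <= 3 * euclidean_dist x y)%R && (3 * euclidean_dist x y < 2 ^+ N)%R.

Lemma measurable_truncated N : measurable_fun setT (fun p : E * E => truncated N p.1 p.2).
Proof.
have m3 : measurable_fun setT (fun p : E * E => (3 * euclidean_dist p.1 p.2)%R).
  by apply: measurable_funM => //; exact: measurable_dist.
by apply: measurable_and; [exact: measurable_fun_ler|exact: measurable_fun_ltr].
Qed.

Definition riesz_trunc N F x := \int[mu]_y (b2e (truncated N x y) * ((rkernel x y)%:E * F y)).

Lemma pm_trunc N F : pmeas F ->
  pmeas (fun p : E * E => b2e (truncated N p.1 p.2) * ((rkernel p.1 p.2)%:E * F p.2)).
Proof.
move=> pF; apply: pmM; last exact: pm_rkernel.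
by apply: pm_b2e; exact: measurable_truncated.
Qed.

Lemma pm_trunc1 N F x : pmeas F ->
  pmeas (fun y => b2e (truncated N x y) * ((rkernel x y)%:E * F y)).
Proof.
move=> pF; have [m p] := pm_trunc N pF; split => [|y]; last exact: (p (x, y)).
by apply: (measurableT_comp m (f := _) (g := fun y => (x, y))); exact: measurable_fun_pair.
Qed.

Lemma pm_riesz_trunc N F : pmeas F -> pmeas (riesz_trunc N F).
Proof.
move=> pF; have [m p] := pm_trunc N pF; split.
  exact: (measurable_fun_fubini_tonelli_F _ m p).
by move=> x; apply: intge0; exact: pm_trunc1.
Qed.

Lemma truncated_le N M x y : (N <= M)%N -> truncated N x y -> truncated M x y.
Proof.
move=> NM /andP[h1 h2]; have h : (2 ^+ N <= 2 ^+ M :> R)%R by rewrite ler_weXn2l ?ler1n.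
apply/andP; split; last exact: lt_le_trans h.
by apply: le_trans h1; rewrite lef_pV2 ?posrE ?exprn_gt0.
Qed.

Lemma truncated_ev x y : euclidean_dist x y != 0%R -> exists N, truncated N x y.
Proof.
move=> d0; have dp : (0 < 3 * euclidean_dist x y)%R.
  by rewrite mulr_gt0// lt_neqAle eq_sym d0 dist_ge0.
have [N1 h1] := expr2_unbounded (3 * euclidean_dist x y)%R.
have [N2 h2] := expr2_unbounded (3 * euclidean_dist x y)^-1%R.
exists (maxn N1 N2); apply/andP; split.
  rewrite -[leRHS]invrK lef_pV2 ?posrE ?exprn_gt0 ?invr_gt0//.
  by rewrite (le_trans (ltW h2))// ler_weXn2l ?ler1n// leq_maxr.
by rewrite (lt_le_trans h1)// ler_weXn2l ?ler1n// leq_maxl.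
Qed.

Lemma riesz_trunc_lim F x (z : R) : pmeas F -> z%:E < riesz F x ->
  exists N, forall M, (N <= M)%N -> z%:E <= riesz_trunc M F x.
Proof.
move=> pF hz.
pose g N y := b2e (truncated N x y) * ((rkernel x y)%:E * F y).
have pg N : pmeas (g N) := pm_trunc1 N x pF.
have gnd y : {homo g^~ y : N M / (N <= M)%N >-> N <= M}.
  move=> N M NM; apply: lee_wpmul2r; first by case: (pm_rkernel1 x pF).
  rewrite /b2e; case: ifP => [h|_]; last by case: ifP.
  by rewrite (truncated_le NM h).
have cv := @cvg_monotone_convergence _ _ _ mu _ measurableT g
  (fun N => (pg N).1) (fun N y _ => (pg N).2 y) (fun y _ => gnd y).
have E1 : \int[mu]_y (limn (g^~ y)) = riesz F x.
  apply: eq_integral => y _; have [d0|d0] := eqVneq (euclidean_dist x y) 0%R.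
    have k0 : rkernel x y = 0%R by rewrite /rkernel (dist0_eq d0) subrr normr0 mul0r.
    rewrite k0 mul0e; rewrite (_ : g^~ y = fun=> 0); first exact: lim_cst.
    by apply/funext => N; rewrite /g k0 mul0e mule0.
  have [N hN] := truncated_ev d0.
  apply/cvg_lim => //; apply: cvg_near_cst; exists N => // M /= NM.
  by rewrite /g (truncated_le NM hN) mul1e.
rewrite E1 in cv.
have nd : nondecreasing_seq (fun N => \int[mu]_y g N y).
  by move=> N M NM; apply: intle => // y; exact: gnd.
have E2 := cvg_unique _ cv (ereal_nondecreasing_cvgn nd).
rewrite E2 // in hz.
have [_ [N _ <-] h] := ereal_sup_gt hz.
exists N => M NM; apply: le_trans (ltW h) _; exact: nd.
Qed.

(** Choose k with side(k+1) <= 3 |x-y| < side(k) and, in each coordinate, the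
    shift for which the coordinates of x and y fall into one interval. *)
Lemma kernel_le N x y : truncated N x y -> exists t (k : 'I_(N + N)),
  ecell N t k x y /\ ((euclidean_dist x y `^ (n%:R - alpha))^-1 <=
    6 `^ (n%:R - alpha) * ((side N k ^+ n) `^ (alpha / n%:R) * (side N k ^+ n)^-1))%R.
Proof.
move=> /andP[h1 h2]; have /andP[a0 an] := halpha.
have n0 : (0 < n%:R :> R)%R by exact: lt_trans an.
set d := euclidean_dist x y in h1 h2 *.
have [k [kN hk1 hk2]] : exists k, [/\ (k < N + N)%N, (3 * d < side N k)%R & (side N k.+1 <= 3 * d)%R].
  have ex : exists k, (side N k <= 3 * d)%R.
    exists (N + N)%N; by rewrite /side exprD invfM mulrA divff ?mul1r//.
  case: (ex_minnP ex) => -[|k] hk kmin.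
    by move: hk; rewrite /side expr0 divr1 leNgt h2.
  exists k; split => //.
    have := kmin (N + N)%N; rewrite /side exprD invfM mulrA divff ?mul1r ?expf_neq0//.
    by move=> /(_ h1).
  rewrite ltNge; apply/negP => /kmin; by rewrite ltnn.
have tex i : exists t, gidx N t k (tnth x i) = gidx N t k (tnth y i).
  apply: gidx_close; apply: le_lt_trans hk1; rewrite ler_pM2l//.
  exact: coord_le_dist.
exists [ffun i => sval (cid (tex i))], (Ordinal kN); split.
  by move=> i; rewrite ffunE; exact: svalP (cid (tex i)).
have s0 := side_gt0 (R := R) N k.
have hd : (side N k / 6 <= d)%R.
  by move: hk2; have := sideS (R := R) N k; lra.
have sp : (0 < side N k / 6 :> R)%R by rewrite divr_gt0.
have dp : (0 < d)%R by exact: lt_le_trans hd.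
have na : (0 < n%:R - alpha)%R by rewrite subr_gt0.
apply: (@le_trans _ _ (((side N k / 6) `^ (n%:R - alpha))^-1)%R).
  rewrite lef_pV2 ?posrE ?powR_gt0//.
  by apply: ge0_ler_powR; rewrite ?nnegrE ?(ltW na) ?(ltW sp) ?(ltW dp).
rewrite powRM ?(ltW s0)// ?invr_ge0// invfM [leLHS]mulrC.
rewrite -powR_inv1// ?ler0n// -powRrM mulN1r powRN invrK.
apply: ler_wpM2l; first exact: powR_ge0.
rewrite -powR_mulrn ?(ltW s0)// -powRrM mulrCA divff ?gt_eqF// mulr1.
rewrite -!powRN -powRD; last by rewrite (gt_eqF s0) implybT.
by rewrite opprB.
Qed.

Let Cn : R := (6 `^ (n%:R - alpha))%R.

Lemma riesz_trunc_le N F x : pmeas F -> riesz_trunc N F x <=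
  Cn%:E * \sum_(t : {ffun 'I_n -> bool})
     dyadic_comm (alpha / n%:R)%R (@egrid R n N t) b (N + N) F x.
Proof.
move=> pF.
have Cn0 : 0 <= Cn%:E by rewrite lee_fin powR_ge0.
have pd : pmeas (fun y => `|b x - b y|%:E * F y).
  by apply: pmM => //; apply: pm_abs; apply: measurable_funB.
pose w N k : R := ((side N k ^+ n) `^ (alpha / n%:R) * (side N k ^+ n)^-1)%R.
have w0 k : 0 <= (w N k)%:E.
  by rewrite lee_fin mulr_ge0 ?powR_ge0// invr_ge0 exprn_ge0// ltW// side_gt0.
pose Z t k y := (w N k)%:E * (cellind (@egrid R n N t) k x y * (`|b x - b y|%:E * F y)).
have pZ t k : pmeas (Z t k).
  by apply: pmM; [exact: pm_cst|apply: pmM => //; exact: pm_cellind].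
have pZZ t : pmeas (fun y => \sum_(k < N + N) Z t k y) by apply: pm_sum => k.
rewrite (_ : \sum_t _ = \int[mu]_y \sum_(t : {ffun 'I_n -> bool}) \sum_(k < N + N) Z t k y); last first.
  rewrite int_sum//; apply: eq_bigr => t _; rewrite int_sum//.
  apply: eq_bigr => k _; rewrite avgE muleA -EFinM intZ//.
  by apply: pmM => //; exact: pm_cellind.
have pS : pmeas (fun y => \sum_(t : {ffun 'I_n -> bool}) \sum_(k < N + N) Z t k y).
  by apply: pm_sum.
rewrite -intZ//; apply: intle.
- exact: pm_trunc1.
- by apply: pmM => //; exact: pm_cst.
move=> y; rewrite /b2e; case: ifPn => [tr|_]; last first.
  by rewrite mul0e; apply: mule_ge0 => //; case: pS.
rewrite mul1e; have [t [k [xy hk]]] := kernel_le tr.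
have F0 : 0 <= `|b x - b y|%:E * F y by case: pd.
apply: (@le_trans _ _ (Cn%:E * Z t k y)).
  have -> : Cn%:E * Z t k y = (Cn * w N k)%:E * (`|b x - b y|%:E * F y).
    by rewrite /Z cellind1// mul1e muleA -EFinM.
  rewrite /rkernel [(_ / _)%R]mulrC EFinM -muleA; apply: lee_wpmul2r => //.
apply: lee_wpmul2l => //.
rewrite (bigD1 t)//= (bigD1 k)//= -addeA leeDl//; apply: adde_ge0.
  by apply: sume_ge0 => i _; case: (pZ t i).
by apply: sume_ge0 => i _; case: (pZZ i).
Qed.

(** A mean is at most the largest term, whose modular is one term of the
    sum. *)
Lemma young_mod_mean th a D (I : finType) (f : I -> \bar R) : growth th a D ->
  (0 < #|I|)%N -> (forall i, 0 <= f i) ->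
  young_mod th ((#|I|%:R^-1)%:E * \sum_i f i) <= \sum_i young_mod th (f i).
Proof.
move=> g /card_gt0P[i0 _] f0.
have [j hj] : exists j, forall i, f i <= f j.
  exists [arg max_(i > i0) f i]%O; case: Order.TotalTheory.arg_maxP => // j _ hj i.
  exact: hj.
have c0 : (0 < #|I|%:R :> R)%R by rewrite ltr0n; apply/card_gt0P; exists i0.
apply: (@le_trans _ _ (young_mod th (f j))); last first.
  rewrite (bigD1 j)//= leeDl//; apply: sume_ge0 => i _; exact: young_mod_ge0 g.
apply: (le_young_mod g).
apply: (@le_trans _ _ ((#|I|%:R^-1)%:E * (#|I|%:R%:E * f j))).
  apply: lee_wpmul2l; first by rewrite lee_fin invr_ge0 ltW.
  apply: (@le_trans _ _ (\sum_(i : I) f j)); first by apply: lee_sum => i _.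
  rewrite big_const /= cardE.
  have -> : iter (size (enum I)) (adde (f j)) 0 = (size (enum I))%:R%:E * f j; last by [].
  elim: (size _) => [|m ih]; first by rewrite mul0e.
  by rewrite iterS ih -natr1 EFinD ge0_muleDl ?lee_fin// mul1e addeC.
by rewrite muleA -EFinM mulVf ?mul1e// gt_eqF.
Qed.

End kernel.

Section riesz_bound.
Context {R : realType} {n : nat}.
Local Notation E := (euclidean R n).
Local Notation mu := (@lebesgue_tuple R n).
Variables (alpha : R) (b : E -> R).
Hypothesis halpha : (0 < alpha < n%:R)%R.

Lemma rieszZ (c : R) F x : measurable_fun setT b -> (0 <= c)%R -> pmeas F ->
  riesz alpha b (fun y => c%:E * F y) x = c%:E * riesz alpha b F x.
Proof.
move=> mb c0 pF; rewrite /riesz -intZ ?lee_fin//; last exact: pm_rkernel1.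
by apply: eq_integral => y _; rewrite muleCA.
Qed.

(** Apply [dyadic_comm_modular] on each of the 2^n grids, pass to the mean over
    the grids and let the truncation tend to infinity; the resulting bound on
    the modular is reduced to 1 by convexity. *)
Lemma riesz_modular thP aP DP thS aS DS C0 :
  growth thP aP DP -> growth thS aS DS -> (0 < C0)%R ->
  index_condition thP thS (alpha / n%:R) C0 -> BMO b ->
  exists2 K : R, (0 < K)%R & forall F : E -> \bar R, pmeas F ->
    \int[mu]_x young_mod thP (F x) <= 1 ->
    \int[mu]_x young_mod thS ((K^-1)%:E * riesz alpha b F x) <= 1.
Proof.
move=> gP gS C00 hC hb; have mb : measurable_fun setT b by case: hb => -[].
have /andP[a0 an] := halpha.
have n0 : (0 < n%:R :> R)%R by exact: lt_trans an.
have n1 : (0 < n)%N by rewrite -(ltr_nat R).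
have q2 : (2 <= 2 ^+ n :> R)%R by rewrite -[leLHS]expr1 ler_weXn2l ?ler1n.
have k0 : (0 < alpha / n%:R)%R by rewrite divr_gt0.
have [B B0 hB] := bmo_dyadic hb.
have [K0 K00 hK0] := dyadic_comm_modular mu q2 gP gS k0 C00 hC B0.
pose I := {ffun 'I_n -> bool}.
have I0 : (0 < #|{: I}|)%N by apply/card_gt0P; exists [ffun=> true].
pose M : R := #|{: I}|%:R.
have M0 : (0 < M)%R by rewrite ltr0n.
pose Cn : R := (6 `^ (n%:R - alpha))%R.
have Cn0 : (0 < Cn)%R by rewrite powR_gt0.
have CM : (0 < (Cn * M)^-1)%R by rewrite invr_gt0 mulr_gt0.
(* 4 M is the total modular over the M grids, removed by convexity; the factor
   2 is the loss in Fatou's lemma. *)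
pose K := (4 * M * (2 * ((Cn * M) * K0)))%R.
have K_gt0 : (0 < K)%R by rewrite /K; repeat apply: mulr_gt0 => //.
exists K => // F pF F1.
have K0V : (0 <= K0^-1)%R by rewrite invr_ge0 ltW.
pose F' y := (K0^-1)%:E * F y.
have pF' : pmeas F' by exact: pmZ.
have F1' : \int[mu]_x young_mod thP (K0%:E * F' x) <= 1.
  rewrite (_ : \int[mu]_x _ = \int[mu]_x young_mod thP (F x))//.
  by apply: eq_integral => x _; rewrite /F' muleA -EFinM divff ?mul1e// gt_eqF.
have pdc N (t : I) := pm_dyadic_comm (alpha / n%:R)%R (hB N t) (N + N) pF'.
have bound N : \int[mu]_x young_mod thS (((Cn * M)^-1)%:E * riesz_trunc alpha b N F' x) <= (4 * M)%:E.
  have pr := pm_riesz_trunc alpha mb N pF'.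
  have psum : pmeas (fun x => \sum_(t : I) young_mod thS
      (dyadic_comm (alpha / n%:R)%R (@egrid R n N t) b (N + N) F' x)).
    by apply: pm_sum => t; exact: pm_young_mod gS (pdc N t).
  apply: (@le_trans _ _ (\int[mu]_x (\sum_(t : I) young_mod thS
      (dyadic_comm (alpha / n%:R)%R (@egrid R n N t) b (N + N) F' x)))).
    apply: intle => //; first exact: pm_young_mod gS (pmZ (ltW CM) pr).
    move=> x; apply: (le_trans _ (young_mod_mean gS I0 _)); last first.
      by move=> t; case: (pdc N t).
    apply: (le_young_mod gS).
    apply: (@le_trans _ _ (((Cn * M)^-1)%:E * (Cn%:E * \sum_(t : I)
      dyadic_comm (alpha / n%:R)%R (@egrid R n N t) b (N + N) F' x))).
      apply: lee_wpmul2l; first by rewrite lee_fin ltW.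
      exact: riesz_trunc_le.
    rewrite muleA -EFinM (_ : ((Cn * M)^-1 * Cn)%R = (M^-1)%R)//.
    by field; rewrite !gt_eqF.
  rewrite int_sum; last by move=> t; exact: pm_young_mod gS (pdc N t).
  apply: (@le_trans _ _ (\sum_(t : I) 4%:E)).
    by apply: lee_sum => t _; apply: (hK0 _ _ _ _ _ (hB N t)).
  rewrite sumEFin lee_fin sumr_const -[leLHS]mulr_natr.
  by rewrite /M lexx.
have pr := pm_riesz alpha mb pF'.
have lim : \int[mu]_x young_mod thS ((2^-1)%:E * (((Cn * M)^-1)%:E * riesz alpha b F' x)) <=
    (4 * M)%:E.
  apply: (fatou_young_mod (F := fun N x => ((Cn * M)^-1)%:E * riesz_trunc alpha b N F' x) gS) => //.
  - exact: pmZ (ltW CM) pr.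
  - by move=> N; exact: pmZ (ltW CM) (pm_riesz_trunc alpha mb N pF').
  - move=> x z hz.
    have hz' : ((Cn * M) * z)%:E < riesz alpha b F' x.
      rewrite -(@lte_pmul2l _ ((Cn * M)^-1)%:E) ?lte_fin//.
      by rewrite -EFinM mulrA mulVf ?mul1r// gt_eqF// mulr_gt0.
    have [N hN] := riesz_trunc_lim mb pF' hz'.
    exists N => m /hN h; rewrite -(@lee_pmul2l _ (Cn * M)%:E) ?lte_fin ?mulr_gt0//.
    by rewrite muleA -EFinM -EFinM divff ?mul1e// gt_eqF// mulr_gt0.
have M4 : (0 < 4 * M)%R by rewrite mulr_gt0.
have pall : pmeas (fun x => (2^-1)%:E * (((Cn * M)^-1)%:E * riesz alpha b F' x)).
  by apply: pmZ => //; exact: pmZ (ltW CM) pr.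
apply: (@le_trans _ _ (((4 * M)^-1)%:E *
  \int[mu]_x young_mod thS ((2^-1)%:E * (((Cn * M)^-1)%:E * riesz alpha b F' x)))).
  have M4V : (0 <= (4 * M)^-1)%R by rewrite invr_ge0 ltW.
  have pm := pm_young_mod gS pall.
  have KV : (0 <= K^-1)%R by rewrite invr_ge0 ltW.
  rewrite -intZ ?lee_fin//; apply: intle.
  - exact: pm_young_mod gS (pmZ KV (pm_riesz alpha mb pF)).
  - exact: pmZ.
  move=> x; apply: (le_trans _ (young_modZ _ gS _)); last first.
    rewrite M4V/= invf_le1//; have : (1 <= M)%R by rewrite ler1n.
    by lra.
  rewrite /F' rieszZ// !muleA -!EFinM.
  rewrite (_ : ((4 * M)^-1 * 2^-1 * (Cn * M)^-1 * K0^-1)%R = (K^-1)%R)//.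
  by rewrite /K; field; rewrite !gt_eqF.
rewrite -[leRHS](_ : ((4 * M)^-1)%:E * (4 * M)%:E = 1); last first.
  by rewrite -EFinM mulVf// gt_eqF.
by apply: lee_wpmul2l => //; rewrite lee_fin invr_ge0 ltW.
Qed.

End riesz_bound.

(** * From Young functions to slopes *)

Section young_growth.
Context {R : realType}.
Implicit Types (Phi Psi : R -> \bar R).

Definition young_slope Phi (r : R) : R := if (0 < r)%R then (fine (Phi r) / r)%R else 0%R.

Section one.
Variable Phi : R -> \bar R.
Hypotheses (hY : young_function Phi) (hD : Delta2 Phi) (hN : nabla2 Phi).

(** If Phi were infinite at r then, by Delta_2, it would be infinite at all
    r / 2^k, against the limit 0 at 0+. *)
Lemma young_fin r : (0 <= r)%R -> Phi r \is a fin_num.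
Proof.
case: hY => P0 Pc _ [Pz Plim] _; rewrite le_eqVlt => /predU1P[<-|r0].
  by rewrite Pz.
rewrite ge0_fin_numE; last exact: P0 (ltW r0).
rewrite ltNge leye_eq; apply/negP => /eqP Pr.
have [C C1 hC] := hD.
have inf k : Phi (r / 2 ^+ k)%R = +oo.
  elim: k => [|k ih]; first by rewrite expr0 divr1.
  have rk : (0 < r / 2 ^+ k.+1)%R by rewrite divr_gt0// exprn_gt0.
  have := hC _ rk; rewrite (_ : (2 * (r / 2 ^+ k.+1))%R = (r / 2 ^+ k)%R); last first.
    by rewrite exprS; field; rewrite expf_neq0.
  rewrite ih leye_eq => /eqP h.
  case: (Phi _) (P0 _ (ltW rk)) h => //.
have [d /= d0 hd] : \forall x \near 0^'+, Phi x < 1.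
  have h : nbhs (0 : \bar R) [set y : \bar R | y < 1].
    by apply: open_nbhs_nbhs; split; [exact: open_ereal_lt_ereal|rewrite /= lte_fin].
  exact: Plim h.
have [k hk] := expr2_unbounded (r / d)%R.
have rk : (0 < r / 2 ^+ k)%R by rewrite divr_gt0// exprn_gt0.
have := hd (r / 2 ^+ k)%R.
rewrite /= sub0r normrN ger0_norm ?ltW// inf.
rewrite ltr_pdivrMr ?exprn_gt0// mulrC -ltr_pdivrMr// hk => /(_ isT rk).
by [].
Qed.

(** If Phi vanished at r then, by Delta_2, it would vanish at all 2^k r, against
    the limit at infinity. *)
Lemma young_pos r : (0 < r)%R -> 0 < Phi r.
Proof.
case: hY => P0 Pc _ _ Plim r0; rewrite lt_neqAle P0 ?(ltW r0)// andbT eq_sym.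
apply/negP => /eqP Pr; have [C C1 hC] := hD.
have z k : Phi (2 ^+ k * r)%R = 0.
  elim: k => [|k ih]; first by rewrite expr0 mul1r.
  have rk : (0 < 2 ^+ k * r)%R by rewrite mulr_gt0// exprn_gt0.
  have := hC _ rk; rewrite ih mule0 mulrA -exprS => h.
  apply/eqP; rewrite eq_le h P0// mulr_ge0 ?exprn_ge0// ltW//.
have [M [Mr hM]] : \forall x \near +oo%R, 1 < Phi x.
  have h : nbhs (+oo : \bar R) [set y : \bar R | 1 < y].
    by apply: open_nbhs_nbhs; split; [exact: open_ereal_gt_ereal|rewrite /= ltry].
  exact: Plim h.
have [k hk] := expr2_unbounded (M / r)%R.
have := hM (2 ^+ k * r)%R; rewrite -ltr_pdivrMr// => /(_ hk).
by rewrite z lte_fin ltr10.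
Qed.

Lemma young_scale t r : (0 <= t <= 1)%R -> (0 <= r)%R -> Phi (t * r)%R <= t%:E * Phi r.
Proof.
case: hY => P0 Pc _ [Pz _] _ ht r0.
by have := Pc r 0%R t r0 (lexx _) ht; rewrite mulr0 addr0 Pz mule0 adde0.
Qed.

Lemma young_slopeE r : (0 <= r)%R -> Phi r = (young_of (young_slope Phi) r)%:E.
Proof.
move=> r0; rewrite /young_of /young_slope; case: ifPn => [rp|rn].
  rewrite mulrCA divff ?gt_eqF// mulr1 fineK//; exact: young_fin.
have -> : r = 0%R by apply/eqP; rewrite eq_le r0 leNgt rn.
by rewrite mul0r; case: hY => _ _ _ [].
Qed.

Lemma young_slope_growth : exists a D, growth (young_slope Phi) a D.
Proof.
have [C C1 hC] := hD; have [A A1 hA] := hN.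
exists A, C; have A0 : (0 < A)%R by exact: lt_trans A1.
have sl r : (0 < r)%R -> young_slope Phi r = (fine (Phi r) / r)%R.
  by rewrite /young_slope => ->.
have pos r : (0 < r)%R -> (0 < young_slope Phi r)%R.
  move=> r0; rewrite sl// divr_gt0// fine_gt0// young_pos//=.
  by rewrite -ge0_fin_numE ?young_fin ?ltW ?young_pos.
have zero r : (r <= 0)%R -> young_slope Phi r = 0%R.
  by rewrite /young_slope ltNge => ->.
have ge0 r : (0 <= young_slope Phi r)%R.
  by case: (lerP r 0) => [/zero ->//|/pos/ltW].
split => //.
- move=> x y xy; case: (lerP x 0) => x0; first by rewrite zero.
  have y0 := lt_le_trans x0 xy; rewrite !sl//.
  have ht : (0 <= x / y <= 1)%R.
    by rewrite divr_ge0 ?(ltW x0) ?(ltW y0)//= ler_pdivrMr// mul1r.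
  have := young_scale ht (ltW y0); rewrite divfK ?gt_eqF//.
  rewrite -(fineK (young_fin (ltW x0))) -(fineK (young_fin (ltW y0))) -EFinM lee_fin /=.
  move=> h; rewrite ler_pdivrMr//.
  by rewrite (_ : (fine (Phi y) / y * x = x / y * fine (Phi y))%R)//; ring.
- move=> x; case: (lerP x 0) => x0.
    by rewrite zero// mulr0.
  have Ax : (0 < A * x)%R by rewrite mulr_gt0.
  have := hA x (ltW x0); rewrite !sl//.
  rewrite -(fineK (young_fin (ltW x0))) -(fineK (young_fin (ltW Ax))) -EFinM lee_fin /= => h.
  rewrite ler_pdivlMr// mulrC.
  have h2 : (A * x * (2 * (fine (Phi x) / x)) = 2 * A * fine (Phi x))%R.
    by field; rewrite gt_eqF.
  rewrite h2 -ler_pdivlMl ?mulr_gt0//.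
- move=> x; case: (lerP x 0) => x0.
    by rewrite !zero ?mulr0// pmulr_rle0.
  have x2 : (0 < 2 * x)%R by rewrite mulr_gt0.
  have := hC x x0; rewrite !sl//.
  rewrite -(fineK (young_fin (ltW x0))) -(fineK (young_fin (ltW x2))) -EFinM lee_fin /= => h.
  rewrite ler_pdivrMr// (le_trans h)//.
  have -> : (C * (fine (Phi x) / x) * (2 * x) = 2 * (C * fine (Phi x)))%R.
    by field; rewrite gt_eqF.
  have : (0 <= C * fine (Phi x))%R.
    by rewrite mulr_ge0 ?fine_ge0 ?ltW ?young_pos// (lt_trans ltr01).
  lra.
Qed.

Lemma young_ext_slope s : 0 <= s -> young_ext Phi s = young_mod (young_slope Phi) s.
Proof. by case: s => //= r; rewrite lee_fin => r0; exact: young_slopeE. Qed.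

Lemma young_inverse_ge (u s : R) : (0 <= u)%R -> (young_of (young_slope Phi) u <= s)%R ->
  u%:E <= young_inverse Phi s%:E.
Proof.
move=> u0 us; have [a [D g]] := young_slope_growth.
apply: le_ereal_inf_tmp => _ [r [r0 hr] <-]; rewrite lee_fin leNgt; apply/negP => ru.
move: hr; rewrite young_slopeE// lte_fin ltNge.
by rewrite (le_trans (young_of_mono g (ltW ru)) us).
Qed.

Lemma young_inverse_le (u s : R) : (0 <= u)%R -> (s < young_of (young_slope Phi) u)%R ->
  young_inverse Phi s%:E <= u%:E.
Proof.
by move=> u0 us; apply: ereal_inf_lbound; exists u => //; split => //; rewrite young_slopeE// lte_fin.
Qed.

End one.

Section condition.
Variables (Phi Psi : R -> \bar R) (kappa : R).
Hypotheses (hPhi : young_function Phi) (hPsi : young_function Psi).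
Hypotheses (hPhi_D2 : Delta2 Phi) (hPhi_n2 : nabla2 Phi).
Hypotheses (hPsi_D2 : Delta2 Psi) (hPsi_n2 : nabla2 Psi).

Lemma inverse_condition_index C : (forall r : R, (0 < r)%R ->
    (r `^ (- kappa))%R%:E * young_inverse Phi r%:E <= C%:E * young_inverse Psi r%:E) ->
  (0 < C)%R -> index_condition (young_slope Phi) (young_slope Psi) kappa C.
Proof.
move=> h C0 u w s u0 w0 s0 hu hw.
have sk : (0 < s `^ (- kappa))%R by rewrite powR_gt0.
have h1 := young_inverse_ge hPhi hPhi_D2 hPhi_n2 (ltW u0) hu.
have h2 := young_inverse_le hPsi hPsi_D2 (ltW w0) hw.
have : (s `^ (- kappa))%:E * u%:E <= C%:E * w%:E.
  apply: (@le_trans _ _ ((s `^ (- kappa))%:E * young_inverse Phi s%:E)).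
    by apply: lee_wpmul2l => //; rewrite lee_fin ltW.
  by apply: (le_trans (h s s0)); apply: lee_wpmul2l => //; rewrite lee_fin ltW.
rewrite -!EFinM lee_fin powRN -ler_pdivlMl ?invr_gt0 ?powR_gt0// invrK.
by rewrite mulrCA mulrA.
Qed.

(** The factor 2 comes from [young_bracket], which locates the inverse of Phi up
    to a factor 2 only. *)
Lemma index_inverse_condition C : (0 < C)%R ->
  index_condition (young_slope Phi) (young_slope Psi) kappa C ->
  forall r : R, (0 < r)%R ->
    (r `^ (- kappa))%R%:E * young_inverse Phi r%:E <= (2 * C)%:E * young_inverse Psi r%:E.
Proof.
move=> C0 h s s0.
have [aP [DP gP]] := young_slope_growth hPhi hPhi_D2 hPhi_n2.
have [u u0 /andP[u1 u2]] := young_bracket gP s0.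
have sk : (0 < s `^ kappa)%R by rewrite powR_gt0.
have C2 : (0 < 2 * C)%R by rewrite mulr_gt0.
have sN : 0 <= (s `^ (- kappa))%:E by rewrite lee_fin powR_ge0.
apply: (@le_trans _ _ ((s `^ (- kappa))%:E * (2 * u)%:E)).
  apply: lee_wpmul2l => //; apply: (young_inverse_le hPhi hPhi_D2) => //.
  by rewrite mulr_ge0// ltW.
rewrite -(@lee_pmul2l _ ((2 * C)^-1)%:E) ?lte_fin ?invr_gt0//.
rewrite [leRHS]muleA -[((2 * C)^-1)%:E * (2 * C)%:E]EFinM mulVf ?gt_eqF// mul1e.
apply: le_ereal_inf_tmp => _ [r [r0 hr] <-].
rewrite (young_slopeE hPsi hPsi_D2 r0) lte_fin in hr.
have rp : (0 < r)%R.
  rewrite lt_neqAle r0 andbT; apply/eqP => r00; move: hr; rewrite -r00 /young_of mul0r.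
  by rewrite ltNge (ltW s0).
have := h u r s u0 rp s0 u1 hr.
rewrite -!EFinM lee_fin powRN => hu.
rewrite ler_pdivrMl// mulrC ler_pdivrMr//.
have -> : (2 * C * r * s `^ kappa = 2 * (C * s `^ kappa * r))%R by ring.
by rewrite ler_pM2l.
Qed.

End condition.
End young_growth.

Section orlicz_facts.
Context {R : realType} {n : nat}.
Local Notation E := (euclidean R n).
Local Notation mu := (@lebesgue_tuple R n).
Variable Phi : R -> \bar R.
Hypotheses (hY : young_function Phi) (hD : Delta2 Phi) (hN : nabla2 Phi).
Implicit Type f : E -> \bar R.

Lemma orlicz_modularE (k : R) f : (0 <= k)%R ->
  orlicz_modular Phi k f = \int[mu]_x young_mod (young_slope Phi) (k%:E * `|f x|).
Proof.
move=> k0; apply: eq_integral => x _.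
by apply: young_ext_slope => //; apply: mule_ge0.
Qed.

Lemma pm_abse f : measurable_fun setT f -> pmeas (fun x => `|f x|).
Proof. by move=> mf; split => //; exact: measurableT_comp. Qed.

(** By convexity a finite modular can be scaled below 1. *)
Lemma orlicz_space_unit f : orlicz_space Phi f ->
  exists2 l : R, (0 < l)%R & orlicz_modular Phi l^-1 f <= 1.
Proof.
move=> [mf [k k0]]; rewrite orlicz_modularE ?ltW//.
have [a [D g]] := young_slope_growth hY hD hN.
have pk := pm_young_mod g (pmZ (ltW k0) (pm_abse mf)).
case I : (\int[mu]_x _) => [c| |]// _; last first.
  by have := intge0 mu pk; rewrite I.
have c0 : (0 <= c)%R by rewrite -lee_fin -I; exact: intge0.
have c1 : (0 < c + 1)%R by rewrite ltr_wpDl.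
pose t := ((c + 1)^-1)%R.
have t0 : (0 < t)%R by rewrite invr_gt0.
exists ((t * k)^-1)%R; first by rewrite invr_gt0 mulr_gt0.
rewrite invrK orlicz_modularE; last by rewrite mulr_ge0// ltW.
apply: (@le_trans _ _ (t%:E * c%:E)); last first.
  by rewrite -EFinM lee_fin /t mulrC ler_pdivrMr// mul1r lerDl.
rewrite -I -intZ ?lee_fin ?(ltW t0)//; apply: intle.
- by apply: (pm_young_mod g); apply: pmZ; [rewrite mulr_ge0// ltW|exact: pm_abse].
- exact: pmZ (ltW t0) pk.
move=> x; rewrite EFinM -muleA; apply: (young_modZ _ g).
by rewrite (ltW t0)/= invf_le1// lerDr.
Qed.

End orlicz_facts.

(** * Sufficiency *)

Section riesz_operator.
Context {R : realType} {n : nat}.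
Local Notation E := (euclidean R n).
Local Notation mu := (@lebesgue_tuple R n).
Variables (alpha : R) (b : E -> R).
Hypothesis mb : measurable_fun setT b.
Implicit Type f : E -> \bar R.

Lemma measurable_rkernelM f : measurable_fun setT f ->
  measurable_fun setT (fun p : E * E => (rkernel alpha b p.1 p.2)%:E * f p.2).
Proof.
move=> mf; apply: emeasurable_funM; last exact: measurableT_comp.
by apply/measurable_EFinP; exact: measurable_rkernel.
Qed.

Lemma measurable_commutator f : measurable_fun setT f ->
  measurable_fun setT (riesz_commutator_abs b alpha f).
Proof.
move=> mf; have mK := measurable_rkernelM mf.
rewrite (_ : riesz_commutator_abs b alpha f = fun x =>
  \int[mu]_y (fun p : E * E => (rkernel alpha b p.1 p.2)%:E * f p.2)^\+ (x, y) -
  \int[mu]_y (fun p : E * E => (rkernel alpha b p.1 p.2)%:E * f p.2)^\- (x, y)).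
  apply: emeasurable_funB.
    apply: (measurable_fun_fubini_tonelli_F _ (measurable_funepos mK)) => p.
    exact: funepos_ge0.
  apply: (measurable_fun_fubini_tonelli_F _ (measurable_funeneg mK)) => p.
  exact: funeneg_ge0.
apply/funext => x; rewrite [LHS]integralE.
congr (_ - _); apply: eq_integral => y _; by rewrite ?funeposE ?funenegE.
Qed.

Lemma commutator_le f x : measurable_fun setT f ->
  `|riesz_commutator_abs b alpha f x| <= riesz alpha b (fun y => `|f y|) x.
Proof.
move=> mf; have mK := measurable_rkernelM mf.
have mKx : measurable_fun setT (fun y => (rkernel alpha b x y)%:E * f y).
  by apply: (measurableT_comp mK (g := fun y => (x, y))); exact: measurable_fun_pair.
apply: (le_trans (le_abse_integral mu measurableT mKx)).
rewrite /riesz le_eqVlt; apply/orP; left; apply/eqP.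
apply: eq_integral => y _; rewrite abseM gee0_abs// lee_fin.
exact: rkernel_ge0.
Qed.

Lemma commutatorE f x : riesz_commutator_abs b alpha f x = riesz alpha b f x.
Proof. by []. Qed.

End riesz_operator.

Section sufficiency.
Context {R : realType} {n : nat}.
Local Notation E := (euclidean R n).
Local Notation mu := (@lebesgue_tuple R n).
Variables (alpha : R) (Phi Psi : R -> \bar R).
Hypothesis halpha : (0 < alpha < n%:R)%R.
Hypotheses (hPhi : young_function Phi) (hPsi : young_function Psi).
Hypotheses (hPhi_D2 : Delta2 Phi) (hPhi_n2 : nabla2 Phi).
Hypotheses (hPsi_D2 : Delta2 Psi) (hPsi_n2 : nabla2 Psi).

Lemma commutator_bounded C (b : E -> R) : (0 < C)%R ->
  index_condition (young_slope Phi) (young_slope Psi) (alpha / n%:R)%R C ->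
  BMO b -> orlicz_bounded Phi Psi (riesz_commutator_abs b alpha).
Proof.
move=> C0 hC hb; have mb : measurable_fun setT b by case: hb => -[].
have [aP [DP gP]] := young_slope_growth hPhi hPhi_D2 hPhi_n2.
have [aS [DS gS]] := young_slope_growth hPsi hPsi_D2 hPsi_n2.
have [K K0 hK] := riesz_modular halpha gP gS C0 hC hb.
exists K => // f hf; have mf := hf.1.
have pf := pm_abse mf.
have mT := measurable_commutator alpha mb mf.
have key l : (0 < l)%R -> orlicz_modular Phi l^-1 f <= 1 ->
    orlicz_modular Psi (K * l)^-1 (riesz_commutator_abs b alpha f) <= 1.
  move=> l0; have lV : (0 <= l^-1)%R by rewrite invr_ge0 ltW.
  have KlV : (0 <= (K * l)^-1)%R by rewrite invr_ge0 ltW// mulr_gt0.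
  rewrite !orlicz_modularE// => /(hK _ (pmZ lV pf)); apply: le_trans.
  have pr := pm_riesz alpha mb pf.
  have prl := pm_riesz alpha mb (pmZ lV pf).
  have KV : (0 <= K^-1)%R by rewrite invr_ge0 ltW.
  apply: intle.
  - exact: pm_young_mod gS (pmZ KlV (pm_abse mT)).
  - exact: pm_young_mod gS (pmZ KV prl).
  move=> x; apply: (le_young_mod gS); rewrite rieszZ// muleA -EFinM -invfM mulrC.
  rewrite [(l * K)%R]mulrC; apply: lee_wpmul2l; first by rewrite lee_fin.
  exact: commutator_le.
have [l l0 hl] := orlicz_space_unit hPhi hPhi_D2 hPhi_n2 hf.
split.
  split => //; exists ((K * l)^-1)%R; first by rewrite invr_gt0 mulr_gt0.
  by apply: (le_lt_trans (key l l0 hl)); rewrite ltry.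
rewrite -(@lee_pmul2l _ (K^-1)%:E) ?lte_fin ?invr_gt0//.
rewrite muleA -EFinM mulVf ?gt_eqF// mul1e.
apply: le_ereal_inf_tmp => _ [l' [l'0 hl'] <-].
rewrite -(@lee_pmul2l _ K%:E) ?lte_fin// muleA -EFinM divff ?gt_eqF// mul1e -EFinM.
apply: ereal_inf_lbound; exists (K * l')%R => //; split; first exact: mulr_gt0.
exact: key.
Qed.

End sufficiency.

(** * Necessity *)

Section necessity.
Context {R : realType} {n : nat}.
Local Notation E := (euclidean R n).
Local Notation mu := (@lebesgue_tuple R n).
Variables (alpha : R) (Phi Psi : R -> \bar R).
Hypothesis halpha : (0 < alpha < n%:R)%R.
Hypotheses (hPhi : young_function Phi) (hPsi : young_function Psi).
Hypotheses (hPhi_D2 : Delta2 Phi) (hPhi_n2 : nabla2 Phi).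
Hypotheses (hPsi_D2 : Delta2 Psi) (hPsi_n2 : nabla2 Psi).

Lemma bounded_BMO (b : E -> R) : measurable_fun setT b ->
  (forall x, (0 <= b x <= 1)%R) -> BMO b.
Proof.
move=> mb b01.
have b0 x : (0 <= b x)%R by case/andP: (b01 x).
have b1 x : (b x <= 1)%R by case/andP: (b01 x).
have ballfin x r : (0 < r)%R -> mu (euclidean_ball x r) < +oo.
  by move=> r0; rewrite (le_lt_trans (ball_vol_le x r0))// ltry.
split.
  split => // x r r0; apply: measurable_bounded_integrable.
  - exact: measurable_ball.
  - exact: ballfin.
  - exact: measurable_funTS.
  - by exists 1%R; split => // M M1 y _ /=; rewrite ger0_norm// (le_trans (b1 y))// ltW.
apply: (@le_lt_trans _ _ 1); last by rewrite ltry.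
apply: ge_ereal_sup => _ [[x r] /= r0 <-].
have mB : measurable (euclidean_ball x r : set E) by exact: measurable_ball.
have Bfin : mu (euclidean_ball x r) \is a fin_num by rewrite ge0_fin_numE// ballfin.
have int_le : \int[mu]_(y in euclidean_ball x r) (b y)%:E <= mu (euclidean_ball x r).
  rewrite -[leRHS]mul1e -integral_cst//; apply: ge0_le_integral => //.
  - by move=> y _; rewrite lee_fin.
  - by apply/measurable_EFinP; exact: measurable_funTS.
  - by move=> y _; rewrite lee_fin.
have int_ge0 : 0 <= \int[mu]_(y in euclidean_ball x r) (b y)%:E.
  by apply: integral_ge0 => y _; rewrite lee_fin.
have avg01 : (0 <= ball_average b x r <= 1)%R.
  rewrite /ball_average /Rintegral; apply/andP; split.
    by rewrite mulr_ge0 ?invr_ge0 ?fine_ge0.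
  have [->|m0] := eqVneq (fine (mu (euclidean_ball x r))) 0%R.
    by rewrite invr0 mul0r.
  have mp : (0 < fine (mu (euclidean_ball x r)))%R by rewrite lt_neqAle eq_sym m0 fine_ge0.
  rewrite ler_pdivrMl// mulr1; apply: fine_le => //.
  by rewrite ge0_fin_numE// (le_lt_trans int_le)// ltey_eq Bfin.
rewrite /mean_oscillation.
have h : \int[mu]_(y in euclidean_ball x r) `|b y - ball_average b x r|%:E <= mu (euclidean_ball x r).
  rewrite -[leRHS]mul1e -integral_cst//; apply: ge0_le_integral => //.
  - apply/measurable_EFinP; apply: measurable_funTS; apply: measurableT_comp => //.
    exact: measurable_funB.
  - move=> y _; rewrite lee_fin ler_norml; case/andP: avg01 => h1 h2.
    by have := b0 y; have := b1 y; move=> h3 h4; apply/andP; split; lra.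
apply: (@le_trans _ _ ((mu (euclidean_ball x r))^-1 * mu (euclidean_ball x r))).
  by apply: lee_wpmul2l; rewrite ?inve_ge0.
have [->|m0] := eqVneq (mu (euclidean_ball x r)) 0; first by rewrite mule0.
by rewrite mulVe.
Qed.

(** The operator applied to the indicator of Qm, a cube of volume l^n = 1/s on
    the side of the hyperplane where b vanishes, is at least m, a multiple of l^alpha, on the
    adjacent cube Qp where b = 1.  As Phi(u) <= s, the norm of the indicator is at most
    1/u; as Psi(w) > s, a function that is at least m on Qp has norm at least
    m / w. *)
Lemma bounded_index_condition :
  (forall b : E -> R, BMO b -> orlicz_bounded Phi Psi (riesz_commutator_abs b alpha)) ->
  exists2 C : R, (0 < C)%R &
    index_condition (young_slope Phi) (young_slope Psi) (alpha / n%:R)%R C.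
Proof.
move=> hT; have /andP[a0 an] := halpha.
have n0 : (0 < n%:R :> R)%R by exact: lt_trans an.
have n1 : (0 < n)%N by rewrite -(ltr_nat R).
have [aP [DP gP]] := young_slope_growth hPhi hPhi_D2 hPhi_n2.
have [aS [DS gS]] := young_slope_growth hPsi hPsi_D2 hPsi_n2.
pose i0 := Ordinal n1.
pose H := [set x : E | (0 < tnth x i0)%R].
have mH : measurable H.
  have := @measurable_tnth _ (measurableTypeR R) n i0 measurableT _ (measurable_itv `]0%R, +oo[).
  by rewrite setTI; congr measurable; apply/seteqP; split => x /=; rewrite in_itv/= andbT.
pose b x : R := \1_H x.
have mb : measurable_fun setT b by exact: measurable_indic.
have hb : BMO b.
  by apply: bounded_BMO => // x; rewrite /b indicE; case: (_ \in _); rewrite ?lexx ler01.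
have [C C0 hC] := hT b hb.
pose cn : R := ((2 * n.+1%:R) `^ (n%:R - alpha))%R.
have cn0 : (0 < cn)%R by rewrite powR_gt0// mulr_gt0.
(* The factor 2 makes a bound on the norm of the image strict, so that some
   admissible r lies below it. *)
exists (2 * C * cn)%R; first by rewrite !mulr_gt0.
move=> u w s u0 w0 s0 hu hw.
pose l : R := (s `^ (- n%:R^-1))%R.
have l0 : (0 < l)%R by rewrite powR_gt0.
have lns : (l ^+ n * s = 1)%R.
  rewrite -powR_mulrn ?(ltW l0)// -powRrM mulNr mulVf ?gt_eqF// powRN powRr1 ?(ltW s0)//.
  by rewrite mulVf// gt_eqF.
pose Am (i : 'I_n) : set (measurableTypeR R) :=
  if i == i0 then `[(- l)%R, 0%R[%classic else `[0%R, l[%classic.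
pose Ap (i : 'I_n) : set (measurableTypeR R) :=
  if i == i0 then `]0%R, l]%classic else `[0%R, l[%classic.
have mAm i : measurable (Am i) by rewrite /Am; case: ifP => _; exact: measurable_itv.
have mAp i : measurable (Ap i) by rewrite /Ap; case: ifP => _; exact: measurable_itv.
pose Qm := [set x : E | forall i, Am i (tnth x i)].
pose Qp := [set x : E | forall i, Ap i (tnth x i)].
have mQ (A : 'I_n -> set (measurableTypeR R)) : (forall i, measurable (A i)) ->
    measurable [set x : E | forall i, A i (tnth x i)].
  move=> mA; apply: measurable_forall_ord => i; rewrite -[X in measurable X]setTI.
  exact: (@measurable_tnth _ (measurableTypeR R) n i measurableT _ (mA i)).
have mQm : measurable Qm by exact: mQ.
have mQp : measurable Qp by exact: mQ.
have vm : mu Qm = (l ^+ n)%:E.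
  rewrite lebesgue_tuple_box// (eq_bigr (fun=> l%:E)).
    by rewrite prodEFin prodr_const card_ord.
  move=> i _; rewrite /Am; case: ifP => _; rewrite lebesgue_measure_itv/= lte_fin.
    by rewrite oppr_lt0 l0 -EFinB sub0r opprK.
  by rewrite l0 -EFinB subr0.
have vp : mu Qp = (l ^+ n)%:E.
  rewrite lebesgue_tuple_box// (eq_bigr (fun=> l%:E)).
    by rewrite prodEFin prodr_const card_ord.
  by move=> i _; rewrite /Ap; case: ifP => _; rewrite lebesgue_measure_itv/= lte_fin l0 -EFinB subr0.
pose f x : \bar R := (\1_Qm x)%:E.
have pf : pmeas f by exact: pm_indic.
have ln0 : (0 < l ^+ n)%R by rewrite exprn_gt0.
have int_ind (z : R) (A : set E) : measurable A -> (0 <= z)%R ->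
    \int[mu]_x (z%:E * (\1_A x)%:E) = z%:E * mu A.
  move=> mA z0; rewrite intZ ?lee_fin//; last exact: pm_indic.
  by rewrite integral_indic// setIT.
have modf : orlicz_modular Phi u f <= 1.
  rewrite orlicz_modularE ?(ltW u0)//.
  rewrite (_ : \int[mu]_x _ = \int[mu]_x ((young_of (young_slope Phi) u)%:E * (\1_Qm x)%:E)).
    rewrite int_ind//; last exact: young_of_ge0 gP.
    by rewrite vm -EFinM lee_fin -lns [leRHS]mulrC ler_pM2r.
  apply: eq_integral => x _; rewrite /f indicE; case: (x \in Qm) => /=.
    by rewrite normr1 mulr1 mule1.
  by rewrite normr0 mulr0 mule0 {1}/young_of mul0r.
have hf : orlicz_space Phi f.
  split; first by case: pf.
  by exists u => //; rewrite (le_lt_trans modf)// ltry.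
have normf : orlicz_norm Phi f <= (u^-1)%:E.
  apply: ereal_inf_lbound; exists (u^-1)%R => //; split; first by rewrite invr_gt0.
  by rewrite invrK.
have [_ hTf] := hC f hf.
have : orlicz_norm Psi (riesz_commutator_abs b alpha f) < (2 * C / u)%:E.
  apply: (le_lt_trans hTf); apply: (@le_lt_trans _ _ (C%:E * (u^-1)%:E)).
    by apply: lee_wpmul2l => //; rewrite lee_fin ltW.
  rewrite -EFinM lte_fin ltr_pM2r ?invr_gt0//; lra.
move=> /ereal_inf_lt[_ [r [r0 hr] <-]]; rewrite lte_fin => rC.
pose m : R := ((cn^-1 * l `^ alpha))%R.
have m0 : (0 < m)%R by rewrite mulr_gt0 ?invr_gt0// powR_gt0.
have Tf x : Qp x -> m%:E <= riesz_commutator_abs b alpha f x.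
  move=> xQ; rewrite commutatorE /riesz.
  have mE : m%:E = \int[mu]_y ((cn^-1 * l `^ (alpha - n%:R))%:E * (\1_Qm y)%:E).
    rewrite int_ind//; last by rewrite mulr_ge0 ?invr_ge0 ?powR_ge0.
    rewrite vm -EFinM; congr EFin; rewrite /m -mulrA; congr (_ * _)%R.
    rewrite -powR_mulrn ?(ltW l0)// -powRD; last by rewrite (gt_eqF l0) implybT.
    by rewrite subrK.
  rewrite mE; apply: intle.
  - by apply: pmZ; [rewrite mulr_ge0 ?invr_ge0 ?powR_ge0|exact: pm_indic].
  - exact: pm_rkernel1.
  move=> y; rewrite /f indicE; case: (boolP (y \in Qm)) => /=; last by rewrite !mule0.
  rewrite inE => yQ; rewrite !mule1 lee_fin.
  have x0 := xQ i0; have y0 := yQ i0.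
  rewrite /Ap/Am eqxx /= !in_itv/= in x0 y0.
  have bx : b x = 1%R by rewrite /b indicE mem_set//=; case/andP: x0.
  have by0 : b y = 0%R.
    rewrite /b indicE memNset//= => h; case/andP: y0 => _ h2.
    by move: h; rewrite /H/= ltNge ltW.
  rewrite /rkernel bx by0 subr0 normr1 mul1r.
  have dle : (euclidean_dist x y <= 2 * n.+1%:R * l)%R.
    rewrite [(2 * _)%R]mulrC -mulrA ltW//; apply: dist_lt_coord; first by rewrite mulr_gt0.
    move=> i; have := xQ i; have := yQ i; rewrite /Ap /Am; case: ifP => _ /=.
      rewrite !in_itv/= => /andP[h1 h2] /andP[h3 h4].
      by rewrite ler_norml; apply/andP; split; lra.
    rewrite !in_itv/= => /andP[h1 h2] /andP[h3 h4].
    by rewrite ler_norml; apply/andP; split; lra.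
  have dp : (0 < euclidean_dist x y)%R.
    rewrite lt_neqAle dist_ge0 andbT eq_sym; apply/eqP => /dist0_eq xy.
    by case/andP: x0 => x0 _; case/andP: y0 => _; rewrite -xy ltNge (ltW x0).
  have na : (0 <= n%:R - alpha)%R by rewrite subr_ge0 ltW.
  rewrite (_ : (alpha - n%:R)%R = (- (n%:R - alpha))%R); last by rewrite opprB.
  rewrite powRN -invfM lef_pV2 ?posrE ?mulr_gt0 ?powR_gt0//.
  rewrite /cn -powRM ?(ltW l0)// ?mulr_ge0//.
  by apply: ge0_ler_powR; rewrite ?nnegrE ?dist_ge0// !mulr_ge0// ltW.
have mT := measurable_commutator alpha mb pf.1.
have rV : (0 <= r^-1)%R by rewrite invr_ge0 ltW.
rewrite orlicz_modularE// in hr.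
have hm : (young_of (young_slope Psi) (r^-1 * m) <= s)%R.
  rewrite -(ler_pM2l ln0) lns -lee_fin.
  have y0 := young_of_ge0 (r^-1 * m)%R gS.
  apply: le_trans hr; rewrite mulrC EFinM -vp -int_ind//.
  apply: intle.
  - exact: pmZ y0 (pm_indic mQp).
  - exact: pm_young_mod gS (pmZ rV (pm_abse mT)).
  move=> x; rewrite indicE; case: (boolP (x \in Qp)) => [|_]; last first.
    by rewrite mule0; exact: young_mod_ge0 gS.
  rewrite inE => xQ; rewrite mule1.
  rewrite -[leLHS]/(young_mod (young_slope Psi) (r^-1 * m)%:E) EFinM.
  apply: (le_young_mod gS); apply: lee_wpmul2l; first by rewrite lee_fin.
  apply: (le_trans (Tf x xQ)); exact: lee_abs.
have rmw : (r^-1 * m < w)%R.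
  rewrite ltNge; apply/negP => h; have := young_of_mono gS h.
  by rewrite leNgt (le_lt_trans hm).
have lE : (l `^ alpha)^-1%R = (s `^ (alpha / n%:R))%R.
  by rewrite /l -powRrM mulNr powRN invrK [(n%:R^-1 * _)%R]mulrC.
have la0 : (0 < l `^ alpha)%R by rewrite powR_gt0.
rewrite -lE.
have h1 : (cn^-1 * l `^ alpha < w * r)%R.
  by rewrite -ltr_pdivrMr// mulrC.
have h2 : (cn^-1 * l `^ alpha < w * (2 * C / u))%R.
  by apply: (lt_trans h1); rewrite ltr_pM2l.
have h3 : (u * (cn^-1 * l `^ alpha) < w * (2 * C))%R.
  rewrite -ltr_pdivlMl//; apply: (lt_le_trans h2).
  by rewrite [leRHS]mulrCA [(u^-1 * _)%R]mulrC.
have -> : (2 * C * cn * (l `^ alpha)^-1 * w = w * (2 * C) * (cn * (l `^ alpha)^-1))%R by ring.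
rewrite -ler_pdivrMr ?mulr_gt0 ?invr_gt0//.
by rewrite invfM invrK ltW.
Qed.

End necessity.

Theorem theorem3p7 (R : realType) (n : nat) (alpha : R) (Phi Psi : R -> \bar R)
    (halpha : (0 < alpha < n%:R)%R)
    (hPhi : young_function Phi) (hPsi : young_function Psi)
    (hPhi_D2 : Delta2 Phi) (hPhi_n2 : nabla2 Phi)
    (hPsi_D2 : Delta2 Psi) (hPsi_n2 : nabla2 Psi) :
  (exists2 C : R, (0 < C)%R &
     forall r : R, (0 < r)%R ->
       (r `^ (- (alpha / n%:R)))%R%:E * young_inverse Phi r%:E <=
       C%:E * young_inverse Psi r%:E) <->
  (forall b : euclidean R n -> R, BMO b ->
     orlicz_bounded Phi Psi (riesz_commutator_abs b alpha)).
Proof.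
split.
  move=> [C C0 hC] b hb.
  apply: (commutator_bounded halpha hPhi hPsi hPhi_D2 hPhi_n2 hPsi_D2 hPsi_n2 C0 _ hb).
  exact: (inverse_condition_index hPhi hPsi hPhi_D2 hPhi_n2 hPsi_D2).
move=> /(bounded_index_condition halpha hPhi hPsi hPhi_D2 hPhi_n2 hPsi_D2 hPsi_n2)[C C0 hC].
exists (2 * C)%R; first by rewrite mulr_gt0.
exact: (index_inverse_condition hPhi hPsi hPhi_D2 hPhi_n2 hPsi_D2).
Qed.
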